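(* Let $f\in{\cal N}_1$ have divisor $D=((a_n),(b_n))$. There is $C<\infty$ such that for all $c\in\mathbb{C}$ and all $r>1$, $$\Big|\int_1^r\frac{{\rm card}\{n:|a_n-c|<t\}-{\rm card}\{n:|b_n-c|<t\}}{t}\,dt\Big|<C,$$ and $$\Big|\frac1r\int_1^r\Big(\sum_{n:|a_n-c|<t}(a_n-c)-\sum_{n:|b_n-c|<t}(b_n-c)\Big)\frac{dt}{t}\Big|<C.$$
   Context: $\rho_S$ is the spherical metric. A meromorphic $f$ on $\mathbb{C}$ is normal if every sequence of translates $f(z+h_n)$ has a subsequence Cauchy in $\rho_S$ uniformly on compacta; $f\in{\cal N}_1$ if moreover no limit of translates is a constant function (including $\infty$). The divisor lists zeros $a_n$ and poles $b_n$ with multiplicity. *)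

(* Defs.v *)
From Stdlib Require Import Reals Lra List ClassicalEpsilon.
Open Scope R_scope.

Definition Cx : Type := (R * R)%type.
Definition C0 : Cx := (0, 0).
Definition C1 : Cx := (1, 0).
Definition Cadd (z w : Cx) : Cx := (fst z + fst w, snd z + snd w).
Definition Copp (z : Cx) : Cx := (- fst z, - snd z).
Definition Csub (z w : Cx) : Cx := Cadd z (Copp w).
Definition Cmul (z w : Cx) : Cx :=
  (fst z * fst w - snd z * snd w, fst z * snd w + snd z * fst w).
Definition Cscale (a : R) (z : Cx) : Cx := (a * fst z, a * snd z).
Definition Cinv (z : Cx) : Cx :=
  (fst z / (fst z ^ 2 + snd z ^ 2), - snd z / (fst z ^ 2 + snd z ^ 2)).
Fixpoint Cpow (z : Cx) (n : nat) : Cx :=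
  match n with O => C1 | S k => Cmul z (Cpow z k) end.
Definition Cnorm (z : Cx) : R := sqrt (fst z ^ 2 + snd z ^ 2).

Definition Ceq_dec (z w : Cx) : {z = w} + {z <> w}.
Proof.
  destruct z as [a b], w as [c d].
  destruct (Req_EM_T a c) as [H1|H1]; [destruct (Req_EM_T b d) as [H2|H2]|].
  - left; subst; reflexivity.
  - right; intro H; inversion H; contradiction.
  - right; intro H; inversion H; contradiction.
Defined.

Definition disc (a : Cx) (r : R) (z : Cx) : Prop := Cnorm (Csub z a) < r.

(* Complex differentiability at every point of U (U will be open discs). *)
Definition holo_on (U : Cx -> Prop) (g : Cx -> Cx) : Prop :=
  forall z, U z -> exists L : Cx, forall eps, eps > 0 -> exists del, del > 0 /\
    forall w, Cnorm (Csub w z) < del ->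
      Cnorm (Csub (Csub (g w) (g z)) (Cmul L (Csub w z))) <= eps * Cnorm (Csub w z).

(* Riemann sphere = option Cx, None = infinity. *)
Definition Sphere : Type := option Cx.

Definition recip (w : Cx) : Sphere :=
  if Ceq_dec w C0 then None else Some (Cinv w).

Definition meromorphic (f : Cx -> Sphere) : Prop :=
  forall z0, exists r, r > 0 /\ exists g : Cx -> Cx, holo_on (disc z0 r) g /\
    ((forall z, disc z0 r z -> f z = Some (g z)) \/
     (forall z, disc z0 r z -> f z = recip (g z))).

Definition rhoS (p q : Sphere) : R :=
  match p, q with
  | Some z, Some w =>
      2 * Cnorm (Csub z w) / (sqrt (1 + Cnorm z ^ 2) * sqrt (1 + Cnorm w ^ 2))
  | Some z, None | None, Some z => 2 / sqrt (1 + Cnorm z ^ 2)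
  | None, None => 0
  end.

(* Every compact subset of Cx lies in some closed disc |z| <= R. *)
Definition normal_fn (f : Cx -> Sphere) : Prop :=
  meromorphic f /\
  forall h : nat -> Cx, exists phi : nat -> nat,
    (forall n, (phi n < phi (S n))%nat) /\
    forall Rad eps, eps > 0 -> exists N, forall m n, (m >= N)%nat -> (n >= N)%nat ->
      forall z, Cnorm z <= Rad ->
        rhoS (f (Cadd z (h (phi m)))) (f (Cadd z (h (phi n)))) < eps.

Definition translate_limit (f : Cx -> Sphere) (h : nat -> Cx) (g : Cx -> Sphere) : Prop :=
  forall Rad eps, eps > 0 -> exists N, forall n, (n >= N)%nat ->
    forall z, Cnorm z <= Rad -> rhoS (f (Cadd z (h n))) (g z) < eps.

Definition N1 (f : Cx -> Sphere) : Prop :=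
  normal_fn f /\
  forall (h : nat -> Cx) (g : Cx -> Sphere), translate_limit f h g ->
    ~ (exists c : Sphere, forall z, g z = c).

Definition zero_order (f : Cx -> Sphere) (a : Cx) (m : nat) : Prop :=
  exists r, r > 0 /\ exists g : Cx -> Cx, holo_on (disc a r) g /\ g a <> C0 /\
    forall z, disc a r z -> f z = Some (Cmul (Cpow (Csub z a) m) (g z)).

Definition pole_order (f : Cx -> Sphere) (a : Cx) (m : nat) : Prop :=
  f a = None /\
  exists r, r > 0 /\ exists g : Cx -> Cx, holo_on (disc a r) g /\ g a <> C0 /\
    forall z, disc a r z -> z <> a -> f z = Some (Cmul (g z) (Cinv (Cpow (Csub z a) m))).

Definition zord (f : Cx -> Sphere) (a : Cx) : nat :=
  epsilon (inhabits 0%nat) (fun m => (m > 0)%nat /\ zero_order f a m).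
Definition pord (f : Cx -> Sphere) (a : Cx) : nat :=
  epsilon (inhabits 0%nat) (fun m => (m > 0)%nat /\ pole_order f a m).

Definition zlist (f : Cx -> Sphere) (c : Cx) (t : R) : list Cx :=
  epsilon (inhabits nil) (fun l => NoDup l /\
    forall z, In z l <-> (Cnorm (Csub z c) < t /\ f z = Some C0)).
Definition plist (f : Cx -> Sphere) (c : Cx) (t : R) : list Cx :=
  epsilon (inhabits nil) (fun l => NoDup l /\
    forall z, In z l <-> (Cnorm (Csub z c) < t /\ f z = None)).

(* card{n : |a_n - c| < t} and card{n : |b_n - c| < t} (with multiplicity) *)
Definition zcount (f : Cx -> Sphere) (c : Cx) (t : R) : R :=
  fold_right Rplus 0 (map (fun z => INR (zord f z)) (zlist f c t)).
Definition pcount (f : Cx -> Sphere) (c : Cx) (t : R) : R :=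
  fold_right Rplus 0 (map (fun z => INR (pord f z)) (plist f c t)).

Definition zsum (f : Cx -> Sphere) (c : Cx) (t : R) : Cx :=
  fold_right Cadd C0 (map (fun z => Cscale (INR (zord f z)) (Csub z c)) (zlist f c t)).
Definition psum (f : Cx -> Sphere) (c : Cx) (t : R) : Cx :=
  fold_right Cadd C0 (map (fun z => Cscale (INR (pord f z)) (Csub z c)) (plist f c t)).

(* Main.v *)
From Stdlib Require Import ZArith Reals Lra List Lia ClassicalEpsilon Permutation.
From Coquelicot Require Import Coquelicot.
Require Import Defs.
Open Scope R_scope.

(** By Jensen's formula the first integral is the difference of the means of [ln |f|] over the
    circles of radius [r] and [1] about [c].  Likewise, with [U(t)] the mean over [θ] of
    [ln |f(c + t e^(iθ))| e^(iθ)], the second integral is [r U(r) - U(1) - 2 ∫_1^r U]: the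
    contribution of a zero-free holomorphic factor to [U] is linear in [t] and cancels.
    So it suffices to bound the mean of [|ln |f||] over circles of radius [t >= 1], uniformly in
    the centre.  Normality makes [f] or [1/f] bounded by [2] on every disc of a fixed radius, and
    since no limit of translates is constant, a propagation-of-smallness argument bounds that
    function from below somewhere near the centre of the disc.  The number of zeros and poles per
    disc is then bounded, as is (by Harnack) the logarithm of the zero-free part, and the
    logarithmic singularities are uniformly integrable over arcs. *)

(** * Complex derivatives *)

(** Two unknowns come with the zero-free factor of f on a disc: its value and its logarithmic
    derivative at the centre. Neither is estimated; both depend on the centre and the disc. Each
    integral is therefore written as a combination of circle means that annihilates the unknown: a
    difference of two radii for the constant, and for a multiple of t the identity r (r/2) - 1/2 - 2
    ∫_1^r (t/2) dt = 0. The weight r on U(r) is why the second integral is only O(r).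

    The bound on the means has to be uniform in t as well as in c. A circle of radius t is cut into
    about t arcs of fixed length; each has normalised measure about 1/t and contributes O(1/t). Only
    the absolute value of ln |f| is estimated, so each arc may use f or 1/f, whichever is bounded
    there.

    Complex differentiability is assumed pointwise, with no continuity of the derivative, so
    everything rests on Goursat's bisection. It is carried out for homotopies, so that one theorem
    gives both the deformation of circles (Cauchy's formula) and the triangle identity
    (primitives). *)

Ltac rmin a b := pose proof (Rmin_l a b); pose proof (Rmin_r a b).

(** This has the shape of the body of [holo_on]: [Cnorm], [Csub] and [Cmul] are convertible with the
    operations on [C], so [hol] below can be exchanged with [holo_on (disc _ _)] without a proof. *)
Definition cdiff (F : C -> C) (z L : C) : Prop :=
  forall eps, 0 < eps -> exists del, 0 < del /\
    forall w, Cmod (w - z) < del ->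
      Cmod (F w - F z - L * (w - z)) <= eps * Cmod (w - z).

Lemma Cmod_pos (z : C) : z <> 0 -> 0 < Cmod z.
Proof. apply (proj1 (Cmod_gt_0 z)). Qed.

Lemma Cmod_neq_0 (z : C) : 0 < Cmod z -> z <> 0.
Proof. apply (proj2 (Cmod_gt_0 z)). Qed.

Lemma Cmod_sub_sym (z w : C) : Cmod (z - w) = Cmod (w - z).
Proof. rewrite <- (Cmod_opp (w - z)%C). f_equal. ring. Qed.

Lemma Cmod_minus_le (z w : C) : Cmod (z - w) <= Cmod z + Cmod w.
Proof.
  unfold Cminus. eapply Rle_trans; [apply Cmod_triangle|].
  rewrite Cmod_opp. lra.
Qed.

Lemma Cmod_dist_triangle (a b c : C) : Cmod (a - c) <= Cmod (a - b) + Cmod (b - c).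
Proof.
  replace (a - c)%C with ((a - b) + (b - c))%C by ring. apply Cmod_triangle.
Qed.

Lemma Cmod_le_dist (z w : C) : Cmod z <= Cmod (z - w) + Cmod w.
Proof. replace z with ((z - w) + w)%C at 1 by ring. apply Cmod_triangle. Qed.

Lemma cdiff_lipschitz (F : C -> C) z L : cdiff F z L ->
  exists K del, 0 < K /\ 0 < del /\ forall w, Cmod (w - z) < del ->
    Cmod (F w - F z) <= K * Cmod (w - z).
Proof.
  intros H. destruct (H 1 Rlt_0_1) as [d [Hd H1]].
  exists (Cmod L + 1), d. split; [pose proof (Cmod_ge_0 L); lra|]. split; [exact Hd|].
  intros w Hw. specialize (H1 w Hw).
  replace (F w - F z)%C with ((F w - F z - L * (w - z)) + L * (w - z))%C by ring.
  eapply Rle_trans; [apply Cmod_triangle|]. rewrite (Cmod_mult L). lra.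
Qed.

Lemma cdiff_continuous (F : C -> C) z L : cdiff F z L ->
  forall eps, 0 < eps -> exists del, 0 < del /\ forall w, Cmod (w - z) < del ->
    Cmod (F w - F z) < eps.
Proof.
  intros H eps He. destruct (cdiff_lipschitz _ _ _ H) as [K [d [HK [Hd H1]]]].
  exists (Rmin d (eps / K)). split; [apply Rmin_pos; auto; now apply Rdiv_lt_0_compat|].
  intros w Hw. eapply Rle_lt_trans; [apply H1; eapply Rlt_le_trans; [exact Hw|apply Rmin_l]|].
  apply Rlt_le_trans with (K * (eps / K)).
  - apply Rmult_lt_compat_l; auto. eapply Rlt_le_trans; [exact Hw|apply Rmin_r].
  - right; field; lra.
Qed.

Lemma cdiff_ext_near (F G : C -> C) z L r : 0 < r ->
  (forall w, Cmod (w - z) < r -> F w = G w) -> cdiff F z L -> cdiff G z L.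
Proof.
  intros Hr E H eps He. destruct (H eps He) as [d [Hd H1]].
  exists (Rmin d r). split; [now apply Rmin_pos|]. intros w Hw.
  rewrite <- !E.
  - apply H1. eapply Rlt_le_trans; [exact Hw|apply Rmin_l].
  - replace (z - z)%C with (RtoC 0) by ring. rewrite Cmod_0. lra.
  - eapply Rlt_le_trans; [exact Hw|apply Rmin_r].
Qed.

Lemma cdiff_ext (F G : C -> C) z L : (forall w, F w = G w) -> cdiff F z L -> cdiff G z L.
Proof. intros E. apply (cdiff_ext_near F G z L 1); auto; lra. Qed.

Lemma cdiff_const c z : cdiff (fun _ => c) z 0.
Proof.
  intros eps He. exists 1. split; [lra|]. intros w _.
  replace (c - c - 0 * (w - z))%C with (RtoC 0) by ring.
  rewrite Cmod_0. apply Rmult_le_pos; [lra|apply Cmod_ge_0].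
Qed.

Lemma cdiff_id z : cdiff (fun w => w) z 1.
Proof.
  intros eps He. exists 1. split; [lra|]. intros w _.
  replace (w - z - 1 * (w - z))%C with (RtoC 0) by ring.
  rewrite Cmod_0. apply Rmult_le_pos; [lra|apply Cmod_ge_0].
Qed.

Lemma cdiff_plus (F G : C -> C) z L M : cdiff F z L -> cdiff G z M ->
  cdiff (fun w => F w + G w)%C z (L + M)%C.
Proof.
  intros HF HG eps He.
  destruct (HF (eps / 2)) as [d1 [Hd1 H1]]; [lra|].
  destruct (HG (eps / 2)) as [d2 [Hd2 H2]]; [lra|].
  exists (Rmin d1 d2). split; [now apply Rmin_pos|]. intros w Hw.
  rmin d1 d2.
  specialize (H1 w ltac:(lra)). specialize (H2 w ltac:(lra)).
  replace (F w + G w - (F z + G z) - (L + M) * (w - z))%C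
    with ((F w - F z - L * (w - z)) + (G w - G z - M * (w - z)))%C by ring.
  eapply Rle_trans; [apply Cmod_triangle|]. lra.
Qed.

Lemma cdiff_mult (F G : C -> C) z L M : cdiff F z L -> cdiff G z M ->
  cdiff (fun w => F w * G w)%C z (L * G z + F z * M)%C.
Proof.
  intros HF HG eps He.
  destruct (cdiff_continuous _ _ _ HG 1) as [d0 [Hd0 H0]]; [lra|].
  set (A := Cmod (G z) + 1). set (B := Cmod (F z) + 1). set (D := Cmod L + 1).
  assert (HA : 0 < A) by (unfold A; pose proof (Cmod_ge_0 (G z)); lra).
  assert (HB : 0 < B) by (unfold B; pose proof (Cmod_ge_0 (F z)); lra).
  assert (HD : 0 < D) by (unfold D; pose proof (Cmod_ge_0 L); lra).
  destruct (HF (eps / 3 / A)) as [d1 [Hd1 H1]]; [apply Rdiv_lt_0_compat; lra|].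
  destruct (HG (eps / 3 / B)) as [d2 [Hd2 H2]]; [apply Rdiv_lt_0_compat; lra|].
  destruct (cdiff_continuous _ _ _ HG (eps / 3 / D)) as [d3 [Hd3 H3]];
    [apply Rdiv_lt_0_compat; lra|].
  exists (Rmin (Rmin d0 d1) (Rmin d2 d3)). split; [repeat apply Rmin_pos; auto|].
  intros w Hw.
  rmin (Rmin d0 d1) (Rmin d2 d3).
  rmin d0 d1.
  rmin d2 d3.
  specialize (H0 w ltac:(lra)). specialize (H1 w ltac:(lra)).
  specialize (H2 w ltac:(lra)). specialize (H3 w ltac:(lra)).
  replace (F w * G w - F z * G z - (L * G z + F z * M) * (w - z))%C
    with ((F w - F z - L * (w - z)) * G w + (F z * (G w - G z - M * (w - z))
          + (w - z) * L * (G w - G z)))%C by ring.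
  set (t := Cmod (w - z)) in *. pose proof (Cmod_ge_0 (w - z)%C) as Ht. fold t in Ht.
  assert (E1 : Cmod (G w) <= A).
  { unfold A. pose proof (Cmod_le_dist (G w) (G z)). lra. }
  eapply Rle_trans; [apply Cmod_triangle|]. rewrite Cmod_mult.
  assert (K1 : Cmod (F w - F z - L * (w - z)) * Cmod (G w) <= eps / 3 * t).
  { apply Rle_trans with (eps / 3 / A * t * A).
    - apply Rmult_le_compat; auto using Cmod_ge_0.
    - right; field; lra. }
  assert (K2 : Cmod (F z * (G w - G z - M * (w - z))) <= eps / 3 * t).
  { rewrite Cmod_mult. apply Rle_trans with (B * (eps / 3 / B * t)).
    - apply Rmult_le_compat; auto using Cmod_ge_0. unfold B; lra.
    - right; field; lra. }
  assert (K3 : Cmod ((w - z) * L * (G w - G z)) <= eps / 3 * t).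
  { rewrite !Cmod_mult. fold t. apply Rle_trans with (t * D * (eps / 3 / D)).
    - apply Rmult_le_compat; auto using Cmod_ge_0, Rmult_le_pos.
      + apply Rmult_le_compat_l; auto. unfold D; lra.
      + lra.
    - right; field; lra. }
  pose proof (Cmod_triangle (F z * (G w - G z - M * (w - z)))%C ((w - z) * L * (G w - G z))%C).
  lra.
Qed.

Lemma cdiff_inv (F : C -> C) z L : F z <> 0 -> cdiff F z L ->
  cdiff (fun w => / F w)%C z (- L / (F z * F z))%C.
Proof.
  intros Hz HF eps He.
  set (m := Cmod (F z)). assert (Hm : 0 < m) by (now apply Cmod_pos).
  destruct (cdiff_continuous _ _ _ HF (m / 2)) as [d0 [Hd0 H0]]; [lra|].
  set (D := Cmod L + 1).
  assert (HD : 0 < D) by (unfold D; pose proof (Cmod_ge_0 L); lra).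
  set (e1 := eps * m * m / 4). set (e2 := eps * m * m * m / 4 / D).
  assert (He1 : 0 < e1) by (unfold e1; repeat apply Rmult_lt_0_compat; lra).
  assert (He2 : 0 < e2).
  { unfold e2; apply Rdiv_lt_0_compat; auto. repeat apply Rmult_lt_0_compat; lra. }
  destruct (HF e1 He1) as [d1 [Hd1 H1]].
  destruct (cdiff_continuous _ _ _ HF e2 He2) as [d3 [Hd3 H3]].
  exists (Rmin d0 (Rmin d1 d3)). split; [repeat apply Rmin_pos; auto|].
  intros w Hw.
  rmin d0 (Rmin d1 d3).
  rmin d1 d3.
  specialize (H0 w ltac:(lra)). specialize (H1 w ltac:(lra)). specialize (H3 w ltac:(lra)).
  assert (Hw2 : m / 2 <= Cmod (F w)).
  { pose proof (Cmod_le_dist (F z) (F w)) as T. rewrite Cmod_sub_sym in T. fold m in T. lra. }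
  assert (Hwn : F w <> 0) by (apply Cmod_neq_0; lra).
  replace (/ F w - / F z - - L / (F z * F z) * (w - z))%C
    with ((L * (w - z) * (F w - F z) - (F w - F z - L * (w - z)) * F z)
           / (F w * (F z * F z)))%C by (field; auto).
  rewrite Cmod_div by (repeat apply Cmult_neq_0; auto).
  rewrite !Cmod_mult. fold m.
  set (t := Cmod (w - z)) in *. pose proof (Cmod_ge_0 (w - z)%C) as Ht. fold t in Ht.
  assert (K : Cmod (L * (w - z) * (F w - F z) - (F w - F z - L * (w - z)) * F z)
              <= eps * m * m * m / 2 * t).
  { eapply Rle_trans; [apply Cmod_minus_le|]. rewrite (Cmod_mult _ (F z)), !Cmod_mult.
    fold t m.
    assert (A1 : Cmod L * t * Cmod (F w - F z) <= D * t * e2).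
    { apply Rmult_le_compat; auto using Cmod_ge_0, Rmult_le_pos; [|lra].
      apply Rmult_le_compat_r; auto. unfold D; lra. }
    assert (A2 : Cmod (F w - F z - L * (w - z)) * m <= e1 * t * m)
      by (apply Rmult_le_compat_r; lra).
    replace (eps * m * m * m / 2 * t) with (D * t * e2 + e1 * t * m).
    - lra.
    - unfold e1, e2. field. lra. }
  apply (Rmult_le_reg_r (Cmod (F w) * (m * m))).
  { repeat apply Rmult_lt_0_compat; lra. }
  unfold Rdiv at 1. rewrite Rmult_assoc, Rinv_l, Rmult_1_r.
  2:{ apply Rgt_not_eq. repeat apply Rmult_lt_0_compat; lra. }
  eapply Rle_trans; [exact K|].
  apply Rle_trans with (eps * t * (m / 2 * (m * m))); [right; field|].
  apply Rmult_le_compat_l; [apply Rmult_le_pos; lra|].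
  apply Rmult_le_compat_r; [apply Rmult_le_pos; lra|lra].
Qed.

Lemma cdiff_unique (F : C -> C) z L M : cdiff F z L -> cdiff F z M -> L = M.
Proof.
  intros HL HM. apply Ceq_minus. apply Cmod_eq_0.
  destruct (Rle_lt_or_eq_dec 0 (Cmod (L - M)) (Cmod_ge_0 _)) as [Hp|]; [|auto].
  exfalso. set (e := Cmod (L - M) / 4).
  destruct (HL e) as [d1 [Hd1 H1]]; [unfold e; lra|].
  destruct (HM e) as [d2 [Hd2 H2]]; [unfold e; lra|].
  set (d := Rmin d1 d2 / 2).
  assert (Hd : 0 < d) by (unfold d; pose proof (Rmin_pos d1 d2 Hd1 Hd2); lra).
  rmin d1 d2.
  assert (E : (z + RtoC d - z)%C = RtoC d) by ring.
  specialize (H1 (z + RtoC d)%C). specialize (H2 (z + RtoC d)%C).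
  rewrite E, Cmod_R, Rabs_pos_eq in H1, H2 by lra.
  specialize (H1 ltac:(unfold d in *; lra)). specialize (H2 ltac:(unfold d in *; lra)).
  assert (K : Cmod ((L - M) * RtoC d) <= e * d + e * d).
  { replace ((L - M) * RtoC d)%C with
     ((F (z + RtoC d) - F z - M * RtoC d) - (F (z + RtoC d) - F z - L * RtoC d))%C by ring.
    eapply Rle_trans; [apply Cmod_minus_le|]. lra. }
  rewrite Cmod_mult, Cmod_R, Rabs_pos_eq in K by lra.
  assert (Cmod (L - M) * d <= Cmod (L - M) / 2 * d) by (unfold e in K; lra).
  apply Rmult_le_reg_r in H3; lra.
Qed.

Lemma cdiff_eq (F : C -> C) z L M : cdiff F z L -> L = M -> cdiff F z M.
Proof. intros H <-. exact H. Qed.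

Lemma cdiff_shift a z : cdiff (fun w => w - a)%C z 1.
Proof.
  eapply cdiff_eq; [apply (cdiff_plus (fun w => w) (fun _ => - a)%C)|].
  - apply cdiff_id.
  - apply cdiff_const.
  - ring.
Qed.

Lemma cdiff_scal c (F : C -> C) z L : cdiff F z L -> cdiff (fun w => c * F w)%C z (c * L)%C.
Proof.
  intros H. eapply cdiff_eq; [apply (cdiff_mult (fun _ => c) F)|].
  - apply cdiff_const.
  - exact H.
  - ring.
Qed.

Lemma cdiff_minus (F G : C -> C) z L M : cdiff F z L -> cdiff G z M ->
  cdiff (fun w => F w - G w)%C z (L - M)%C.
Proof.
  intros HF HG. eapply cdiff_eq; [eapply cdiff_ext; [|apply cdiff_plus;
    [exact HF|apply (cdiff_scal (- (1))%C G z M HG)]]|].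
  - intros w; simpl. ring.
  - ring.
Qed.

Lemma cdiff_div (F G : C -> C) z L M : G z <> 0 -> cdiff F z L -> cdiff G z M ->
  cdiff (fun w => F w / G w)%C z ((L * G z - F z * M) / (G z * G z))%C.
Proof.
  intros Hz HF HG. eapply cdiff_eq; [apply (cdiff_mult F (fun w => / G w)%C)|].
  - exact HF.
  - apply cdiff_inv; [exact Hz|exact HG].
  - field. auto.
Qed.

(** * Curves and integrals with values in the complex plane *)

Lemma Rabs_fst_le_Cmod (z : C) : Rabs (fst z) <= Cmod z.
Proof. eapply Rle_trans; [apply Rmax_l|apply Rmax_Cmod]. Qed.

Lemma Rabs_snd_le_Cmod (z : C) : Rabs (snd z) <= Cmod z.
Proof. eapply Rle_trans; [apply Rmax_r|apply Rmax_Cmod]. Qed.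

Lemma Cmod_le_sum (z : C) : Cmod z <= Rabs (fst z) + Rabs (snd z).
Proof.
  replace z with (RtoC (fst z) + Ci * RtoC (snd z))%C at 1.
  2:{ destruct z as [x y]; unfold Ci, RtoC, Cplus, Cmult; simpl; f_equal; ring. }
  eapply Rle_trans; [apply Cmod_triangle|].
  rewrite Cmod_mult, !Cmod_R.
  replace (Cmod Ci) with 1; [lra|].
  unfold Cmod, Ci; simpl. replace (0 * (0 * 1) + 1 * (1 * 1)) with 1 by ring.
  now rewrite sqrt_1.
Qed.

Lemma continuous_R_eps (f : R -> R) (t : R) : continuous f t <->
  forall eps, 0 < eps -> exists del, 0 < del /\
    forall s, Rabs (s - t) < del -> Rabs (f s - f t) < eps.
Proof.
  split.
  - intros H eps He. unfold continuous in H.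
    apply (filterlim_locally (F := locally t)) with (eps := mkposreal eps He) in H.
    destruct H as [d Hd]. exists d. split; [apply cond_pos|].
    intros s Hs. apply (Hd s). exact Hs.
  - intros H. apply (filterlim_locally (F := locally t)). intros eps.
    destruct (H eps (cond_pos eps)) as [d [Hd H1]].
    exists (mkposreal d Hd). intros s Hs. apply (H1 s). exact Hs.
Qed.

Lemma ex_derive_cont (f : R -> R) t : ex_derive f t -> continuous f t.
Proof. apply (ex_derive_continuous (K := R_AbsRing) (V := R_NormedModule)). Qed.

Lemma continuous_Rplus (f g : R -> R) t : continuous f t -> continuous g t ->
  continuous (fun t => f t + g t) t.
Proof. apply (continuous_plus (V := R_NormedModule)). Qed.

Lemma continuous_Rmult (f g : R -> R) t : continuous f t -> continuous g t ->
  continuous (fun t => f t * g t) t.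
Proof. apply (continuous_mult (K := R_AbsRing)). Qed.

Lemma ex_RInt_cont (f : R -> R) a b : a <= b -> (forall t, a <= t <= b -> continuous f t) ->
  ex_RInt f a b.
Proof.
  intros Hab H. apply (ex_RInt_continuous (V := R_CompleteNormedModule)).
  now rewrite Rmin_left, Rmax_right by lra.
Qed.

(** Continuity, derivatives and integrals of curves are taken by coordinates, so that the real
    [RInt] and its fundamental theorem apply to each coordinate. *)
Definition ccont (f : R -> C) (t : R) : Prop :=
  continuous (fun s => fst (f s)) t /\ continuous (fun s => snd (f s)) t.

Lemma ccont_eps (f : R -> C) t : ccont f t <->
  forall eps, 0 < eps -> exists del, 0 < del /\
    forall s, Rabs (s - t) < del -> Cmod (f s - f t) < eps.
Proof.
  split.
  - intros [H1 H2] eps He.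
    destruct (proj1 (continuous_R_eps _ _) H1 (eps / 2)) as [d1 [Hd1 K1]]; [lra|].
    destruct (proj1 (continuous_R_eps _ _) H2 (eps / 2)) as [d2 [Hd2 K2]]; [lra|].
    exists (Rmin d1 d2). split; [now apply Rmin_pos|]. intros s Hs.
    rmin d1 d2.
    specialize (K1 s ltac:(lra)). specialize (K2 s ltac:(lra)).
    eapply Rle_lt_trans; [apply Cmod_le_sum|]. simpl. unfold Rminus in K1, K2. lra.
  - intros H. split; apply continuous_R_eps; intros eps He;
      destruct (H eps He) as [d [Hd K]]; exists d; split; auto; intros s Hs;
      specialize (K s Hs); eapply Rle_lt_trans; [|exact K| |exact K].
    + apply (Rabs_fst_le_Cmod (f s - f t)).
    + apply (Rabs_snd_le_Cmod (f s - f t)).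
Qed.

Lemma ccont_const c t : ccont (fun _ => c) t.
Proof. split; apply continuous_const. Qed.

Lemma ccont_plus (f g : R -> C) t : ccont f t -> ccont g t -> ccont (fun s => f s + g s)%C t.
Proof.
  intros [] []; split; simpl.
  - now apply continuous_Rplus.
  - now apply continuous_Rplus.
Qed.

Lemma ccont_mult (f g : R -> C) t : ccont f t -> ccont g t -> ccont (fun s => f s * g s)%C t.
Proof.
  intros [] []; split; simpl.
  - apply (continuous_minus (V := R_NormedModule)); now apply continuous_Rmult.
  - apply continuous_Rplus; now apply continuous_Rmult.
Qed.

Lemma ccont_comp (F : C -> C) (f : R -> C) t L : cdiff F (f t) L -> ccont f t ->
  ccont (fun s => F (f s)) t.
Proof.
  intros HF Hf. apply ccont_eps. intros eps He.
  destruct (cdiff_continuous _ _ _ HF eps He) as [d [Hd K]].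
  destruct (proj1 (ccont_eps _ _) Hf d Hd) as [d' [Hd' K']].
  exists d'. split; auto.
Qed.

Lemma ccont_inv (f : R -> C) t : f t <> 0 -> ccont f t -> ccont (fun s => / f s)%C t.
Proof.
  intros H Hf. apply (ccont_comp (fun w => / w)%C f t (- (1) / (f t * f t))%C); auto.
  apply (cdiff_inv (fun w => w) (f t) 1); auto. apply cdiff_id.
Qed.

Lemma ccont_minus (f g : R -> C) t : ccont f t -> ccont g t -> ccont (fun s => f s - g s)%C t.
Proof.
  intros Hf Hg. apply ccont_plus; auto.
  destruct Hg; split; simpl; now apply (continuous_opp (V := R_NormedModule)).
Qed.

Lemma ccont_RtoC (f : R -> R) t : continuous f t -> ccont (fun s => RtoC (f s)) t.
Proof. intros H. split; simpl; auto. apply continuous_const. Qed.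

Lemma ccont_ext f g t : (forall s, f s = g s) -> ccont f t -> ccont g t.
Proof.
  intros E [H1 H2]; split.
  - eapply continuous_ext; [|exact H1]. intros s; simpl. now rewrite E.
  - eapply continuous_ext; [|exact H2]. intros s; simpl. now rewrite E.
Qed.

Lemma ccont_Cmod f t : ccont f t -> continuous (fun s => Cmod (f s)) t.
Proof.
  intros H. apply continuous_R_eps. intros eps He.
  destruct (proj1 (ccont_eps _ _) H eps He) as [d [Hd K]]. exists d; split; auto.
  intros s Hs. eapply Rle_lt_trans; [|apply (K s Hs)].
  pose proof (Cmod_le_dist (f s) (f t)). pose proof (Cmod_le_dist (f t) (f s)) as Q.
  rewrite Cmod_sub_sym in Q. apply Rabs_le. lra.
Qed.

Definition CInt (f : R -> C) (a b : R) : C :=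
  (RInt (fun t => fst (f t)) a b, RInt (fun t => snd (f t)) a b).

Definition ccont_on (f : R -> C) (a b : R) : Prop := forall t, a <= t <= b -> ccont f t.

Lemma ccont_on_ex f a b : a <= b -> ccont_on f a b ->
  ex_RInt (fun t => fst (f t)) a b /\ ex_RInt (fun t => snd (f t)) a b.
Proof.
  intros Hab H. split; apply ex_RInt_cont; auto; intros z Hz; now apply H.
Qed.

Lemma ccont_on_sub f a b a' b' : a <= a' -> b' <= b -> ccont_on f a b -> ccont_on f a' b'.
Proof. intros H1 H2 H t Ht. apply H. lra. Qed.

Lemma CInt_ext f g a b : a <= b -> (forall t, a <= t <= b -> f t = g t) ->
  CInt f a b = CInt g a b.
Proof.
  intros Hab E. unfold CInt. f_equal; apply RInt_ext; intros t Ht;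
    rewrite Rmin_left, Rmax_right in Ht by lra; rewrite E; auto; lra.
Qed.

Lemma CInt_plus f g a b : a <= b -> ccont_on f a b -> ccont_on g a b ->
  CInt (fun t => f t + g t)%C a b = (CInt f a b + CInt g a b)%C.
Proof.
  intros Hab Hf Hg. destruct (ccont_on_ex _ _ _ Hab Hf), (ccont_on_ex _ _ _ Hab Hg).
  unfold CInt, Cplus; simpl.
  f_equal; now apply (RInt_plus (V := R_CompleteNormedModule)).
Qed.

Lemma CInt_minus f g a b : a <= b -> ccont_on f a b -> ccont_on g a b ->
  CInt (fun t => f t - g t)%C a b = (CInt f a b - CInt g a b)%C.
Proof.
  intros Hab Hf Hg. destruct (ccont_on_ex _ _ _ Hab Hf), (ccont_on_ex _ _ _ Hab Hg).
  unfold CInt, Cminus, Cplus, Copp; simpl.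
  f_equal; now apply (RInt_minus (V := R_CompleteNormedModule)).
Qed.

Lemma CInt_scal c f a b : a <= b -> ccont_on f a b ->
  CInt (fun t => c * f t)%C a b = (c * CInt f a b)%C.
Proof.
  intros Hab Hf. destruct (ccont_on_ex _ _ _ Hab Hf) as [E1 E2].
  unfold CInt, Cmult; simpl. f_equal.
  - rewrite <- (RInt_scal (V := R_CompleteNormedModule)) by auto.
    rewrite <- (RInt_scal (V := R_CompleteNormedModule)) by auto.
    apply (RInt_minus (V := R_CompleteNormedModule));
      now apply (ex_RInt_scal (V := R_NormedModule)).
  - rewrite <- (RInt_scal (V := R_CompleteNormedModule)) by auto.
    rewrite <- (RInt_scal (V := R_CompleteNormedModule)) by auto.
    apply (RInt_plus (V := R_CompleteNormedModule));
      now apply (ex_RInt_scal (V := R_NormedModule)).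
Qed.

Lemma CInt_const c a b : CInt (fun _ => c) a b = (RtoC (b - a) * c)%C.
Proof.
  unfold CInt. rewrite !RInt_const. unfold scal; simpl; unfold mult; simpl.
  destruct c; unfold Cmult, RtoC; simpl; f_equal; ring.
Qed.

Lemma CInt_Chasles f a b c : a <= b -> b <= c -> ccont_on f a c ->
  CInt f a c = (CInt f a b + CInt f b c)%C.
Proof.
  intros Hab Hbc H.
  destruct (ccont_on_ex f a b Hab) as [E1 E2]; [apply (ccont_on_sub f a c); auto; lra|].
  destruct (ccont_on_ex f b c Hbc) as [E3 E4]; [apply (ccont_on_sub f a c); auto; lra|].
  unfold CInt, Cplus; simpl. f_equal; symmetry;
    now apply (RInt_Chasles (V := R_CompleteNormedModule)).
Qed.

(** The factor 2 comes from estimating the two coordinates separately. It is harmless: the bound is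
    used either with an arbitrarily small M or inside the power trick of [maximum_principle]. *)
Lemma CInt_norm f a b M : a <= b -> ccont_on f a b ->
  (forall t, a <= t <= b -> Cmod (f t) <= M) -> Cmod (CInt f a b) <= 2 * M * (b - a).
Proof.
  intros Hab H HM. destruct (ccont_on_ex _ _ _ Hab H) as [E1 E2].
  eapply Rle_trans; [apply Cmod_le_sum|]. simpl.
  assert (Rabs (RInt (fun t => fst (f t)) a b) <= (b - a) * M).
  { apply abs_RInt_le_const; auto. intros t Ht.
    eapply Rle_trans; [apply Rabs_fst_le_Cmod|]. now apply HM. }
  assert (Rabs (RInt (fun t => snd (f t)) a b) <= (b - a) * M).
  { apply abs_RInt_le_const; auto. intros t Ht.
    eapply Rle_trans; [apply Rabs_snd_le_Cmod|]. now apply HM. }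
  lra.
Qed.

Definition cder (g : R -> C) (t : R) (v : C) : Prop :=
  is_derive (fun s => fst (g s)) t (fst v) /\ is_derive (fun s => snd (g s)) t (snd v).

Lemma is_derive_R_eps (f : R -> R) t l : is_derive f t l <->
  forall eps, 0 < eps -> exists del, 0 < del /\
    forall s, Rabs (s - t) < del -> Rabs (f s - f t - (s - t) * l) <= eps * Rabs (s - t).
Proof.
  split.
  - intros [_ H] eps He. specialize (H t (fun P HP => HP) (mkposreal eps He)).
    destruct H as [d Hd]. exists d. split; [apply cond_pos|]. intros s Hs.
    apply (Hd s Hs).
  - intros H. split; [apply is_linear_scal_l|]. intros x Hx eps.
    apply (is_filter_lim_locally_unique t x) in Hx. subst x.
    destruct (H eps (cond_pos eps)) as [d [Hd K]]. exists (mkposreal d Hd).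
    intros s Hs. apply (K s Hs).
Qed.

Lemma cder_eps (g : R -> C) t v : cder g t v <->
  forall eps, 0 < eps -> exists del, 0 < del /\
    forall s, Rabs (s - t) < del ->
      Cmod (g s - g t - RtoC (s - t) * v) <= eps * Rabs (s - t).
Proof.
  assert (F : forall s, fst (g s - g t - RtoC (s - t) * v)%C
                 = fst (g s) - fst (g t) - (s - t) * fst v)
    by (intros; simpl; ring).
  assert (S : forall s, snd (g s - g t - RtoC (s - t) * v)%C
                 = snd (g s) - snd (g t) - (s - t) * snd v)
    by (intros; simpl; ring).
  split.
  - intros [H1 H2] eps He.
    destruct (proj1 (is_derive_R_eps _ _ _) H1 (eps / 2)) as [d1 [Hd1 K1]]; [lra|].
    destruct (proj1 (is_derive_R_eps _ _ _) H2 (eps / 2)) as [d2 [Hd2 K2]]; [lra|].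
    exists (Rmin d1 d2). split; [now apply Rmin_pos|]. intros s Hs.
    rmin d1 d2.
    specialize (K1 s ltac:(lra)). specialize (K2 s ltac:(lra)).
    eapply Rle_trans; [apply Cmod_le_sum|]. rewrite F, S. lra.
  - intros H. split; apply is_derive_R_eps; intros eps He;
      destruct (H eps He) as [d [Hd K]]; exists d; split; auto; intros s Hs;
      (eapply Rle_trans; [|apply (K s Hs)]).
    + rewrite <- F. apply Rabs_fst_le_Cmod.
    + rewrite <- S. apply Rabs_snd_le_Cmod.
Qed.

Lemma cder_ccont g t v : cder g t v -> ccont g t.
Proof.
  intros [H1 H2]. split; apply ex_derive_cont.
  - now exists (fst v).
  - now exists (snd v).
Qed.

Lemma cder_comp (F : C -> C) (g : R -> C) t L v : cdiff F (g t) L -> cder g t v ->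
  cder (fun s => F (g s)) t (L * v)%C.
Proof.
  intros HF Hg. apply cder_eps. intros eps He.
  pose proof (Cmod_ge_0 L) as PL. pose proof (Cmod_ge_0 v) as Pv.
  set (A := Cmod v + 1). set (B := Cmod L + 1).
  assert (HA : 0 < A) by (unfold A; lra). assert (HB : 0 < B) by (unfold B; lra).
  destruct (HF (eps / 2 / A)) as [d [Hd KF]]; [apply Rdiv_lt_0_compat; lra|].
  destruct (proj1 (cder_eps _ _ _) Hg 1 Rlt_0_1) as [d1 [Hd1 K1]].
  destruct (proj1 (cder_eps _ _ _) Hg (eps / 2 / B)) as [d2 [Hd2 K2]];
    [apply Rdiv_lt_0_compat; lra|].
  destruct (proj1 (ccont_eps _ _) (cder_ccont _ _ _ Hg) d Hd) as [d3 [Hd3 K3]].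
  exists (Rmin d1 (Rmin d2 d3)). split; [repeat apply Rmin_pos; auto|].
  intros s Hs. rmin d1 (Rmin d2 d3).
  rmin d2 d3.
  specialize (K1 s ltac:(lra)). specialize (K2 s ltac:(lra)). specialize (K3 s ltac:(lra)).
  specialize (KF (g s) K3).
  pose proof (Rabs_pos (s - t)) as Pt.
  assert (Hgs : Cmod (g s - g t) <= A * Rabs (s - t)).
  { replace (g s - g t)%C with ((g s - g t - RtoC (s - t) * v) + RtoC (s - t) * v)%C by ring.
    eapply Rle_trans; [apply Cmod_triangle|]. rewrite (Cmod_mult (RtoC _)), Cmod_R.
    unfold A. lra. }
  replace (F (g s) - F (g t) - RtoC (s - t) * (L * v))%C with
    ((F (g s) - F (g t) - L * (g s - g t)) + L * (g s - g t - RtoC (s - t) * v))%C by ring.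
  eapply Rle_trans; [apply Cmod_triangle|]. rewrite (Cmod_mult L).
  assert (Q1 : Cmod (F (g s) - F (g t) - L * (g s - g t)) <= eps / 2 * Rabs (s - t)).
  { eapply Rle_trans; [exact KF|]. apply Rle_trans with (eps / 2 / A * (A * Rabs (s - t))).
    - apply Rmult_le_compat_l; auto. left; apply Rdiv_lt_0_compat; lra.
    - right; field; lra. }
  assert (Q2 : Cmod L * Cmod (g s - g t - RtoC (s - t) * v) <= eps / 2 * Rabs (s - t)).
  { apply Rle_trans with (B * (eps / 2 / B * Rabs (s - t))).
    - apply Rmult_le_compat; auto using Cmod_ge_0. unfold B; lra.
    - right; field; lra. }
  lra.
Qed.

Lemma CInt_FTC g g' a b : a <= b -> (forall t, a <= t <= b -> cder g t (g' t)) ->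
  ccont_on g' a b -> CInt g' a b = (g b - g a)%C.
Proof.
  intros Hab Hd Hc. unfold CInt, Cminus, Cplus, Copp; simpl.
  f_equal; apply is_RInt_unique.
  - apply (is_RInt_derive (V := R_CompleteNormedModule) (fun t => fst (g t)));
      rewrite Rmin_left, Rmax_right by lra; intros t Ht; [apply (Hd t Ht)|apply (Hc t Ht)].
  - apply (is_RInt_derive (V := R_CompleteNormedModule) (fun t => snd (g t)));
      rewrite Rmin_left, Rmax_right by lra; intros t Ht; [apply (Hd t Ht)|apply (Hc t Ht)].
Qed.

(** * Goursat's theorem for homotopies *)

Lemma nested_intervals (s h : nat -> R) : (forall n, 0 < h n) ->
  (forall n, s n <= s (S n)) -> (forall n, s (S n) + h (S n) <= s n + h n) ->
  exists u, forall n, s n <= u <= s n + h n.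
Proof.
  intros Hh Hs Hsh.
  assert (Mono : forall n k, s n <= s (n + k)%nat /\ s (n + k)%nat + h (n + k)%nat <= s n + h n).
  { intros n k. induction k as [|k IH]; [rewrite Nat.add_0_r; lra|].
    rewrite Nat.add_succ_r. specialize (Hs (n + k)%nat). specialize (Hsh (n + k)%nat). lra. }
  assert (UB : forall n m, s m <= s n + h n).
  { intros n m. destruct (Nat.le_ge_cases n m) as [H|H].
    - replace m with (n + (m - n))%nat by lia. destruct (Mono n (m - n)%nat).
      specialize (Hh (n + (m - n))%nat). lra.
    - replace n with (m + (n - m))%nat by lia. destruct (Mono m (n - m)%nat).
      specialize (Hh (m + (n - m))%nat). lra. }
  destruct (completeness (fun x => exists n, x = s n)) as [u [Hu1 Hu2]].
  - exists (s O + h O). intros x [n ->]. apply UB.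
  - exists (s O). now exists O.
  - exists u. intros n. split; [apply Hu1; now exists n|].
    apply Hu2. intros x [m ->]. apply UB.
Qed.

(** Goursat's subdivision as an induction principle. If P failed on the unit square, it would fail
    on a quarter of every failing square; the nested failing squares shrink to a point, where the
    local hypothesis is contradicted. *)
Lemma square_bisection (P : R -> R -> R -> Prop) :
  (forall s t h, 0 <= s -> 0 <= t -> 0 < h -> s + h <= 1 -> t + h <= 1 ->
    P s t (h / 2) -> P (s + h / 2) t (h / 2) -> P s (t + h / 2) (h / 2) ->
    P (s + h / 2) (t + h / 2) (h / 2) -> P s t h) ->
  (forall u v, 0 <= u <= 1 -> 0 <= v <= 1 -> exists d, 0 < d /\
    forall s t h, 0 < h < d -> s <= u <= s + h -> t <= v <= t + h ->
      0 <= s -> 0 <= t -> s + h <= 1 -> t + h <= 1 -> P s t h) ->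
  P 0 0 1.
Proof.
  intros Hq Hloc. apply Classical_Prop.NNPP. intros Hn.
  (* The first quarter on which P fails; if P holds on the first three, the last one is taken, and P
     must fail there because the four together would give P on the whole square. *)
  pose (step := fun (p : R * R) (h : R) =>
    let s := fst p in let t := snd p in
    if excluded_middle_informative (P s t (h / 2)) then
      if excluded_middle_informative (P (s + h / 2) t (h / 2)) then
        if excluded_middle_informative (P s (t + h / 2) (h / 2)) then (s + h / 2, t + h / 2)
        else (s, t + h / 2)
      else (s + h / 2, t)
    else (s, t)).
  pose (h := fun n => (1 / 2) ^ n).
  pose (q := fix q n := match n with O => (0, 0) | S k => step (q k) (h k) end).
  assert (Hh : forall n, 0 < h n) by (intros n; apply pow_lt; lra).
  assert (HhS : forall n, h (S n) = h n / 2) by (intros n; unfold h; simpl; lra).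
  assert (Stp : forall n, fst (q n) <= fst (q (S n)) <= fst (q n) + h n / 2
                       /\ snd (q n) <= snd (q (S n)) <= snd (q n) + h n / 2).
  { intros n. specialize (Hh n). simpl. unfold step.
    repeat destruct (excluded_middle_informative _); simpl; lra. }
  assert (Inv : forall n, 0 <= fst (q n) /\ 0 <= snd (q n) /\ fst (q n) + h n <= 1 /\
             snd (q n) + h n <= 1 /\ ~ P (fst (q n)) (snd (q n)) (h n)).
  { induction n as [|n [I1 [I2 [I3 [I4 I5]]]]].
    - simpl. unfold h; simpl. repeat split; try lra. exact Hn.
    - rewrite HhS. specialize (Stp n). specialize (Hh n).
      repeat split; try lra. simpl. unfold step.
      repeat destruct (excluded_middle_informative _); simpl; auto.
      all: intros HP; apply I5; apply Hq; auto. }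
  destruct (nested_intervals (fun n => fst (q n)) h Hh) as [u Hu].
  { intros n; apply Stp. }
  { intros n. specialize (Stp n). rewrite HhS. lra. }
  destruct (nested_intervals (fun n => snd (q n)) h Hh) as [v Hv].
  { intros n; apply Stp. }
  { intros n. specialize (Stp n). rewrite HhS. lra. }
  assert (U01 : 0 <= u <= 1) by (specialize (Hu O); specialize (Inv O); lra).
  assert (V01 : 0 <= v <= 1) by (specialize (Hv O); specialize (Inv O); lra).
  destruct (Hloc u v U01 V01) as [d [Hd K]].
  destruct (pow_lt_1_zero (1 / 2)) with (y := d) as [N HN]; auto.
  { rewrite Rabs_pos_eq; lra. }
  specialize (HN N (le_n _)). fold (h N) in HN. rewrite Rabs_pos_eq in HN by (left; auto).
  destruct (Inv N) as [I1 [I2 [I3 [I4 I5]]]]. apply I5. apply K; auto.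
Qed.

(** Since T' has the primitive T, its integral along g is the exact difference of end values, and
    only F - T' contributes an error. Below, T' is the affine approximation of F at a point. *)
Lemma path_integral_estimate (F T T' : C -> C) (g g' : R -> C) a b M : a <= b ->
  (forall t, a <= t <= b -> cder g t (g' t)) -> ccont_on g' a b ->
  (forall t, a <= t <= b -> ccont (fun s => F (g s)) t) ->
  (forall t, a <= t <= b -> ccont (fun s => T' (g s)) t) ->
  (forall t, a <= t <= b -> cdiff T (g t) (T' (g t))) ->
  (forall t, a <= t <= b -> Cmod (F (g t) - T' (g t)) * Cmod (g' t) <= M) ->
  Cmod (CInt (fun t => F (g t) * g' t)%C a b - (T (g b) - T (g a))) <= 2 * M * (b - a).
Proof.
  intros Hab Hg Hg' HF HT' HT HM.
  rewrite <- (CInt_FTC (fun t => T (g t)) (fun t => T' (g t) * g' t)%C a b); auto.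
  - rewrite <- CInt_minus; auto.
    + apply CInt_norm; auto.
      * intros t Ht. apply ccont_minus; apply ccont_mult; auto.
      * intros t Ht. replace (F (g t) * g' t - T' (g t) * g' t)%C
          with ((F (g t) - T' (g t)) * g' t)%C by ring.
        rewrite Cmod_mult. auto.
    + intros t Ht. apply ccont_mult; auto.
    + intros t Ht. apply ccont_mult; auto.
  - intros t Ht. apply cder_comp; auto.
  - intros t Ht. apply ccont_mult; auto.
Qed.

Section Goursat.
Variables (Phi Phis Phit : R -> R -> C) (B : R) (F : C -> C).
Hypothesis HB : 0 < B.
Hypothesis Hs : forall s t, cder (fun s => Phi s t) s (Phis s t).
Hypothesis Ht : forall s t, cder (fun t => Phi s t) t (Phit s t).
Hypothesis Cs : forall s t, ccont (fun s => Phis s t) s.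
Hypothesis Ct : forall s t, ccont (fun t => Phit s t) t.
Hypothesis Bs : forall s t, 0 <= s <= 1 -> 0 <= t <= 1 -> Cmod (Phis s t) <= B.
Hypothesis Bt : forall s t, 0 <= s <= 1 -> 0 <= t <= 1 -> Cmod (Phit s t) <= B.
Hypothesis Lip : forall s t u v, 0 <= s <= 1 -> 0 <= t <= 1 -> 0 <= u <= 1 -> 0 <= v <= 1 ->
  Cmod (Phi s t - Phi u v) <= B * (Rabs (s - u) + Rabs (t - v)).
Hypothesis HF : forall s t, 0 <= s <= 1 -> 0 <= t <= 1 -> exists L, cdiff F (Phi s t) L.

Let V (s a b : R) : C := CInt (fun t => F (Phi s t) * Phit s t)%C a b.
Let W (t a b : R) : C := CInt (fun s => F (Phi s t) * Phis s t)%C a b.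
(** The integral of F along the image under [Phi] of the boundary of the square with corner (s, t)
    and side h. *)
Let I (s t h : R) : C :=
  (V (s + h) t (t + h) - V s t (t + h) - W (t + h) s (s + h) + W t s (s + h))%C.

Lemma goursat_ccont_t s t : 0 <= s <= 1 -> 0 <= t <= 1 -> ccont (fun t => F (Phi s t)) t.
Proof.
  intros H1 H2. destruct (HF s t H1 H2) as [L HL].
  apply (ccont_comp F (fun t => Phi s t) t L); auto. eapply cder_ccont; apply Ht.
Qed.

Lemma goursat_ccont_s s t : 0 <= s <= 1 -> 0 <= t <= 1 -> ccont (fun s => F (Phi s t)) s.
Proof.
  intros H1 H2. destruct (HF s t H1 H2) as [L HL].
  apply (ccont_comp F (fun s => Phi s t) s L); auto. eapply cder_ccont; apply Hs.
Qed.

(** Near [Phi u v] the function F is affine up to a small multiple of the distance. The affine part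
    has the quadratic primitive T, whose end values cancel around the boundary, so only an error of
    order h per unit length remains on sides of length of order h. *)
Lemma goursat_local e : 0 < e -> forall u v, 0 <= u <= 1 -> 0 <= v <= 1 ->
  exists d, 0 < d /\
    forall s t h, 0 < h < d -> s <= u <= s + h -> t <= v <= t + h ->
      0 <= s -> 0 <= t -> s + h <= 1 -> t + h <= 1 -> Cmod (I s t h) <= e * h * h.
Proof.
  intros He u v Hu Hv. destruct (HF u v Hu Hv) as [L HL].
  (* Each of the four sides has error 2 M h with M = e1 (2 B h) B, in total 16 e1 B^2 h^2; hence the
     divisor 16 B^2. *)
  set (z0 := Phi u v) in *. set (e1 := e / (16 * B * B)).
  assert (He1 : 0 < e1).
  { unfold e1. apply Rdiv_lt_0_compat; auto. repeat apply Rmult_lt_0_compat; lra. }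
  destruct (HL e1 He1) as [d [Hd K]].
  exists (d / (2 * B)). split; [apply Rdiv_lt_0_compat; lra|].
  intros s t h Hh Hsu Htv Hs0 Ht0 Hs1 Ht1.
  assert (Hhd : B * (h + h) < d).
  { replace d with (B * (2 * (d / (2 * B)))) by (field; lra).
    apply Rmult_lt_compat_l; lra. }
  set (T := fun z => (F z0 * z + L / 2 * ((z - z0) * (z - z0)))%C).
  set (T' := fun z => (F z0 + L * (z - z0))%C).
  assert (HT : forall z, cdiff T z (T' z)).
  { intros z. unfold T, T'. eapply cdiff_eq;
      [apply cdiff_plus; [apply cdiff_scal, cdiff_id|]|].
    - apply cdiff_scal, cdiff_mult; apply cdiff_shift.
    - cbv beta; field. }
  assert (HT'c : forall g t, ccont g t -> ccont (fun s => T' (g s)) t).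
  { intros g x Hg. unfold T'. apply ccont_plus; [apply ccont_const|].
    apply ccont_mult; [apply ccont_const|]. apply ccont_minus; [auto|apply ccont_const]. }
  set (M := e1 * (B * (h + h)) * B).
  assert (Near : forall x y, s <= x <= s + h -> t <= y <= t + h ->
      Cmod (Phi x y - z0) <= B * (h + h)).
  { intros x y Hx Hy. unfold z0. eapply Rle_trans; [apply Lip; lra|].
    apply Rmult_le_compat_l; [lra|]. apply Rplus_le_compat; apply Rabs_le; lra. }
  assert (HM : forall x y (w : C), s <= x <= s + h -> t <= y <= t + h -> Cmod w <= B ->
      Cmod (F (Phi x y) - T' (Phi x y)) * Cmod w <= M).
  { intros x y w Hx Hy Hw. unfold M. specialize (Near x y Hx Hy).
    apply Rmult_le_compat; auto using Cmod_ge_0. unfold T'.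
    replace (F (Phi x y) - (F z0 + L * (Phi x y - z0)))%C
      with (F (Phi x y) - F z0 - L * (Phi x y - z0))%C by ring.
    eapply Rle_trans; [apply K; lra|]. apply Rmult_le_compat_l; lra. }
  assert (EV : forall x, s <= x <= s + h ->
    Cmod (V x t (t + h) - (T (Phi x (t + h)) - T (Phi x t))) <= 2 * M * h).
  { intros x Hx. replace (2 * M * h) with (2 * M * (t + h - t)) by ring.
    apply (path_integral_estimate F T T' (fun t => Phi x t) (fun t => Phit x t)); auto; try lra.
    - intros y _. auto.
    - intros y Hy. apply goursat_ccont_t; lra.
    - intros y _. apply HT'c. eapply cder_ccont; apply Ht.
    - intros y Hy. apply HM; auto. apply Bt; lra. }
  assert (EW : forall y, t <= y <= t + h ->
    Cmod (W y s (s + h) - (T (Phi (s + h) y) - T (Phi s y))) <= 2 * M * h).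
  { intros y Hy. replace (2 * M * h) with (2 * M * (s + h - s)) by ring.
    apply (path_integral_estimate F T T' (fun s => Phi s y) (fun s => Phis s y)); auto; try lra.
    - intros x _. auto.
    - intros x Hx. apply goursat_ccont_s; lra.
    - intros x _. apply HT'c. eapply cder_ccont; apply Hs.
    - intros x Hx. apply HM; auto. apply Bs; lra. }
  pose proof (EV (s + h) ltac:(lra)) as E1. pose proof (EV s ltac:(lra)) as E2.
  pose proof (EW (t + h) ltac:(lra)) as E3. pose proof (EW t ltac:(lra)) as E4.
  set (X1 := (V (s + h) t (t + h) - (T (Phi (s + h) (t + h)) - T (Phi (s + h) t)))%C) in *.
  set (X2 := (V s t (t + h) - (T (Phi s (t + h)) - T (Phi s t)))%C) in *.
  set (X3 := (W (t + h) s (s + h) - (T (Phi (s + h) (t + h)) - T (Phi s (t + h))))%C) in *.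
  set (X4 := (W t s (s + h) - (T (Phi (s + h) t) - T (Phi s t)))%C) in *.
  replace (I s t h) with ((X1 - X2) - (X3 - X4))%C by (unfold I, X1, X2, X3, X4; ring).
  pose proof (Cmod_minus_le (X1 - X2)%C (X3 - X4)%C).
  pose proof (Cmod_minus_le X1 X2). pose proof (Cmod_minus_le X3 X4).
  replace (e * h * h) with (4 * (2 * M * h)); [lra|].
  unfold M, e1. field. lra.
Qed.

Lemma V_split s a b c : 0 <= s <= 1 -> 0 <= a -> a <= b -> b <= c -> c <= 1 ->
  V s a c = (V s a b + V s b c)%C.
Proof.
  intros. apply CInt_Chasles; auto. intros x Hx.
  apply ccont_mult; auto. apply goursat_ccont_t; lra.
Qed.

Lemma W_split t a b c : 0 <= t <= 1 -> 0 <= a -> a <= b -> b <= c -> c <= 1 ->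
  W t a c = (W t a b + W t b c)%C.
Proof.
  intros. apply CInt_Chasles; auto. intros x Hx.
  apply ccont_mult; auto. apply goursat_ccont_s; lra.
Qed.

(** The bound [e * h * h] is preserved when four quarters are assembled, because [I] is additive and
    the areas add up. It holds on small squares by [goursat_local], so it holds on the unit square
    for every positive e. *)
Theorem goursat_homotopy :
  (CInt (fun t => F (Phi 1 t) * Phit 1 t)%C 0 1 - CInt (fun t => F (Phi 0 t) * Phit 0 t)%C 0 1)%C
  = (CInt (fun s => F (Phi s 1) * Phis s 1)%C 0 1 - CInt (fun s => F (Phi s 0) * Phis s 0)%C 0 1)%C.
Proof.
  assert (Z : Cmod (I 0 0 1) <= 0).
  (* With e equal to half of the supposed positive value, the bisection bound at h = 1 says that the
     value is at most half of itself. *)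
  { apply Rnot_lt_le. intros Hp. set (e := Cmod (I 0 0 1) / 2).
    assert (He : 0 < e) by (unfold e; lra).
    assert (Q : Cmod (I 0 0 1) <= e * 1 * 1).
    { apply (square_bisection (fun s t h => Cmod (I s t h) <= e * h * h)).
      - intros s t h H1 H2 H3 H4 H5 Q1 Q2 Q3 Q4.
        assert (E : I s t h = ((I s t (h / 2) + I (s + h / 2) t (h / 2))
           + (I s (t + h / 2) (h / 2) + I (s + h / 2) (t + h / 2) (h / 2)))%C).
        { unfold I. replace (s + h / 2 + h / 2) with (s + h) by field.
          replace (t + h / 2 + h / 2) with (t + h) by field.
          rewrite (V_split (s + h) t (t + h / 2) (t + h)) by lra.
          rewrite (V_split s t (t + h / 2) (t + h)) by lra.
          rewrite (W_split (t + h) s (s + h / 2) (s + h)) by lra.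
          rewrite (W_split t s (s + h / 2) (s + h)) by lra.
          ring. }
        rewrite E.
        pose proof (Cmod_triangle (I s t (h / 2) + I (s + h / 2) t (h / 2))%C
          (I s (t + h / 2) (h / 2) + I (s + h / 2) (t + h / 2) (h / 2))%C).
        pose proof (Cmod_triangle (I s t (h / 2)) (I (s + h / 2) t (h / 2))).
        pose proof (Cmod_triangle (I s (t + h / 2) (h / 2)) (I (s + h / 2) (t + h / 2) (h / 2))).
        replace (e * h * h) with (4 * (e * (h / 2) * (h / 2))) by field. lra.
      - now apply goursat_local. }
    unfold e in Q. lra. }
  pose proof (Cmod_ge_0 (I 0 0 1)).
  assert (Z0 : I 0 0 1 = 0) by (apply Cmod_eq_0; lra).
  unfold I, V, W in Z0. replace (0 + 1) with 1 in Z0 by ring.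
  apply Ceq_minus. rewrite <- Z0. ring.
Qed.
End Goursat.

(** * Cauchy's formula and its consequences *)

(** The period is 1, so that means over circles are plain integrals over the unit interval. *)
Definition cis (t : R) : C := (cos (2 * PI * t), sin (2 * PI * t)).
Definition cis' (t : R) : C := (2 * PI * (- sin (2 * PI * t)), 2 * PI * cos (2 * PI * t)).

Lemma Cmod_cis t : Cmod (cis t) = 1.
Proof.
  unfold Cmod, cis; simpl.
  replace (_ + _) with 1; [apply sqrt_1|].
  pose proof (sin2_cos2 (2 * PI * t)) as H. unfold Rsqr in H. lra.
Qed.

Lemma cis_0 : cis 0 = 1.
Proof. unfold cis. rewrite Rmult_0_r, cos_0, sin_0. reflexivity. Qed.

Lemma cis_1 : cis 1 = 1.
Proof. unfold cis. rewrite Rmult_1_r, cos_2PI, sin_2PI. reflexivity. Qed.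

Lemma cis_neq_0 t : cis t <> 0.
Proof. apply Cmod_neq_0. rewrite Cmod_cis. lra. Qed.

Lemma cis'_cis t : cis' t = (RtoC (2 * PI) * Ci * cis t)%C.
Proof. unfold cis', cis, RtoC, Ci, Cmult; simpl; f_equal; ring. Qed.

Lemma cder_cis t : cder cis t (cis' t).
Proof. split; simpl; auto_derive; auto; ring. Qed.

Lemma ccont_cis t : ccont cis t.
Proof. eapply cder_ccont, cder_cis. Qed.

Lemma Cmod_cis' t : Cmod (cis' t) = 2 * PI.
Proof.
  pose proof PI_RGT_0. rewrite cis'_cis, !Cmod_mult, Cmod_cis, Cmod_R, Rabs_pos_eq by lra.
  replace (Cmod Ci) with 1; [ring|].
  unfold Cmod, Ci; simpl. replace (0 * (0 * 1) + 1 * (1 * 1)) with 1 by ring.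
  now rewrite sqrt_1.
Qed.

Lemma ccont_cis' t : ccont cis' t.
Proof.
  apply (ccont_ext (fun t => (RtoC (2 * PI) * Ci * cis t)%C)).
  - intros s. now rewrite cis'_cis.
  - apply ccont_mult; [apply ccont_const|apply ccont_cis].
Qed.

Lemma cis_lipschitz s t : Cmod (cis s - cis t) <= 4 * PI * Rabs (s - t).
Proof.
  assert (K : forall a b, a <= b -> Cmod (cis b - cis a) <= 4 * PI * (b - a)).
  { intros a b Hab. rewrite <- (CInt_FTC cis cis' a b); auto.
    - eapply Rle_trans; [apply (CInt_norm _ a b (2 * PI)); auto|lra].
      + intros x _. apply ccont_cis'.
      + intros x _. rewrite Cmod_cis'. lra.
    - intros x _. apply cder_cis.
    - intros x _. apply ccont_cis'. }
  destruct (Rle_dec t s) as [H|H].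
  - rewrite Rabs_pos_eq by lra. now apply K.
  - rewrite Cmod_sub_sym, Rabs_minus_sym, Rabs_pos_eq by lra. apply K. lra.
Qed.

Definition hol (z0 : C) (Q : R) (g : C -> C) : Prop :=
  forall z, Cmod (z - z0) < Q -> exists L, cdiff g z L.

Lemma hol_sub z0 Q z1 R1 g : Cmod (z1 - z0) + R1 <= Q -> hol z0 Q g -> hol z1 R1 g.
Proof.
  intros H Hg z Hz. apply Hg. pose proof (Cmod_dist_triangle z z1 z0). lra.
Qed.

Lemma hol_const z0 Q c : hol z0 Q (fun _ => c).
Proof. intros z _. eexists. apply cdiff_const. Qed.

Lemma hol_shift z0 Q a : hol z0 Q (fun w => w - a)%C.
Proof. intros z _. eexists. apply cdiff_shift. Qed.

Lemma hol_minus z0 Q f g : hol z0 Q f -> hol z0 Q g -> hol z0 Q (fun w => f w - g w)%C.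
Proof.
  intros Hf Hg z Hz. destruct (Hf z Hz), (Hg z Hz). eexists. now apply cdiff_minus; eauto.
Qed.

Lemma hol_mult z0 Q f g : hol z0 Q f -> hol z0 Q g -> hol z0 Q (fun w => f w * g w)%C.
Proof.
  intros Hf Hg z Hz. destruct (Hf z Hz), (Hg z Hz). eexists. now apply cdiff_mult; eauto.
Qed.

Lemma hol_div z0 Q (f g : C -> C) : hol z0 Q f -> hol z0 Q g ->
  (forall z, Cmod (z - z0) < Q -> g z <> 0) -> hol z0 Q (fun w => f w / g w)%C.
Proof.
  intros Hf Hg H z Hz. destruct (Hf z Hz), (Hg z Hz). eexists. now apply cdiff_div; eauto.
Qed.

Lemma hol_pow z0 Q f n : hol z0 Q f -> hol z0 Q (fun w => Complex.Cpow (f w) n)%C.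
Proof.
  intros Hf. induction n as [|n IH]; [exact (hol_const z0 Q (RtoC 1))|].
  simpl. now apply (hol_mult z0 Q f (fun w => Complex.Cpow (f w) n)).
Qed.

Lemma hol_continuous z0 Q g z : hol z0 Q g -> Cmod (z - z0) < Q ->
  forall eps, 0 < eps -> exists del, 0 < del /\ forall w, Cmod (w - z) < del ->
    Cmod (g w - g z) < eps.
Proof. intros Hg Hz. destruct (Hg z Hz) as [L HL]. now apply cdiff_continuous with L. Qed.

Definition circ (z0 : C) (r : R) (t : R) : C := (z0 + RtoC r * cis t)%C.

Lemma circ_dist z0 r t : 0 <= r -> Cmod (circ z0 r t - z0) = r.
Proof.
  intros Hr. unfold circ. replace (z0 + RtoC r * cis t - z0)%C with (RtoC r * cis t)%C by ring.
  rewrite Cmod_mult, Cmod_cis, Cmod_R, Rabs_pos_eq by auto. ring.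
Qed.

Lemma circ_ccont z0 r t : ccont (circ z0 r) t.
Proof.
  apply ccont_plus; [apply ccont_const|]. apply ccont_mult; [apply ccont_const|apply ccont_cis].
Qed.

Lemma hol_circ_ccont z0 Q g r t : 0 <= r < Q -> hol z0 Q g -> ccont (fun t => g (circ z0 r t)) t.
Proof.
  intros Hr Hg. destruct (Hg (circ z0 r t)) as [L HL]; [rewrite circ_dist; lra|].
  eapply (ccont_comp g); [exact HL|apply circ_ccont].
Qed.

Lemma two_pi_i_neq_0 : (RtoC (2 * PI) * Ci)%C <> 0.
Proof.
  pose proof PI_RGT_0. apply Cmult_neq_0; [|apply Ci_nz].
  intros E. apply RtoC_inj in E. lra.
Qed.

(** The centre moves linearly from z0 to a while the radius moves from r to e. At time s the
    distance from the centre to a is (1-s)|a - z0|, less than the radius (1-s)r + se, so no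
    intermediate circle meets a. The factor r cis(t) dt is dz / (2πi). *)
Lemma circle_homotopy (F : C -> C) z0 Q a r e :
  0 < e -> 0 < r < Q -> Cmod (a - z0) + e < Q -> Cmod (a - z0) < r ->
  (forall z, Cmod (z - z0) < Q -> z <> a -> exists L, cdiff F z L) ->
  CInt (fun t => F (circ a e t) * (RtoC e * cis t))%C 0 1
  = CInt (fun t => F (circ z0 r t) * (RtoC r * cis t))%C 0 1.
Proof.
  intros He Hr HeR Har HF.
  set (d := (a - z0)%C) in *. set (k := Cmod d) in *.
  assert (Hk : 0 <= k) by apply Cmod_ge_0. pose proof PI_RGT_0 as Hpi.
  set (rho := fun s => r + s * (e - r)).
  set (Phi := fun s t => (z0 + RtoC s * d + RtoC (rho s) * cis t)%C).
  set (Phis := fun s t : R => (d + RtoC (e - r) * cis t)%C).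
  set (Phit := fun s t => (RtoC (rho s) * cis' t)%C).
  set (K := k + r + e).
  assert (Hrho : forall s, 0 <= s <= 1 -> 0 < rho s <= r + e).
  { intros s Hs. unfold rho. replace (r + s * (e - r)) with ((1 - s) * r + s * e) by ring.
    split; [|nra]. destruct (Req_dec s 0) as [->|]; [lra|].
    assert (0 < s * e) by (apply Rmult_lt_0_compat; lra). nra. }
  assert (Hin : forall s t, 0 <= s <= 1 -> exists L, cdiff F (Phi s t) L).
  { intros s t Hs. apply HF.
    - unfold Phi. replace (z0 + RtoC s * d + RtoC (rho s) * cis t - z0)%C
        with (RtoC s * d + RtoC (rho s) * cis t)%C by ring.
      eapply Rle_lt_trans; [apply Cmod_triangle|].
      rewrite !Cmod_mult, !Cmod_R, Cmod_cis. fold k.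
      specialize (Hrho s Hs). rewrite !Rabs_pos_eq by lra. unfold rho.
      replace (s * k + (r + s * (e - r)) * 1) with ((1 - s) * r + s * (k + e)) by ring.
      destruct (Req_dec s 0) as [->|]; [lra|].
      assert (s * (k + e) < s * Q) by (apply Rmult_lt_compat_l; lra). nra.
    - intros E.
      assert (E2 : (RtoC (rho s) * cis t)%C = (RtoC (1 - s) * d)%C).
      { replace (RtoC (rho s) * cis t)%C with (Phi s t - z0 - RtoC s * d)%C by (unfold Phi; ring).
        rewrite E. rewrite RtoC_minus. unfold d. ring. }
      apply (f_equal Cmod) in E2. rewrite !Cmod_mult, !Cmod_R, Cmod_cis in E2. fold k in E2.
      specialize (Hrho s Hs). rewrite !Rabs_pos_eq in E2 by lra. unfold rho in E2.
      assert (Z : (1 - s) * (r - k) + s * e = 0) by lra.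
      assert (0 <= (1 - s) * (r - k)) by (apply Rmult_le_pos; lra).
      destruct (Req_dec s 0) as [->|]; [lra|].
      assert (0 < s * e) by (apply Rmult_lt_0_compat; lra). lra. }
  assert (G := goursat_homotopy Phi Phis Phit (K * (4 * PI + 1)) F).
  assert (S0 : forall s, Phi s 1 = Phi s 0).
  { intros s. unfold Phi. now rewrite cis_0, cis_1. }
  assert (S1 : forall s, Phis s 1 = Phis s 0).
  { intros s. unfold Phis. now rewrite cis_0, cis_1. }
  assert (HK : 0 < K) by (unfold K; lra).
  assert (Ct : forall s t, ccont (fun t => Phit s t) t).
  { intros s t. apply ccont_mult; [apply ccont_const|apply ccont_cis']. }
  assert (Dt : forall s t, cder (fun t => Phi s t) t (Phit s t)).
  { intros s t. unfold Phi, Phit, cis, cis', RtoC. split; simpl; auto_derive; auto; ring. }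
  assert (Ds : forall s t, cder (fun s => Phi s t) s (Phis s t)).
  { intros s t. unfold Phi, Phis, rho, RtoC. split; simpl; auto_derive; auto; ring. }
  (* The curves are closed, so the two sides of the homotopy square at t = 0 and t = 1 have the same
     image and their integrals cancel. *)
  rewrite (CInt_ext (fun s => F (Phi s 1) * Phis s 1)%C (fun s => F (Phi s 0) * Phis s 0)%C) in G.
  2: lra.
  2:{ intros s _. now rewrite S0, S1. }
  match type of G with _ -> _ -> _ -> _ -> _ -> _ -> _ -> _ -> _ -> ?X => assert (X) end.
  { apply G; auto.
    - apply Rmult_lt_0_compat; lra.
    - intros s t. apply ccont_const.
    - intros s t Hs _. unfold Phis. eapply Rle_trans; [apply Cmod_triangle|].
      rewrite Cmod_mult, Cmod_cis, Cmod_R. fold k.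
      assert (Rabs (e - r) <= r + e) by (apply Rabs_le; lra).
      unfold K. nra.
    - intros s t Hs _. unfold Phit. rewrite Cmod_mult, Cmod_cis', Cmod_R.
      specialize (Hrho s Hs). rewrite Rabs_pos_eq by lra.
      assert (rho s <= K) by (unfold K; lra). nra.
    - intros s t u v Hs Ht Hu Hv.
      replace (Phi s t - Phi u v)%C with
        (RtoC (s - u) * (d + RtoC (e - r) * cis t) + RtoC (rho u) * (cis t - cis v))%C.
      2:{ unfold Phi, rho. rewrite !RtoC_plus, !RtoC_mult, !RtoC_minus. ring. }
      eapply Rle_trans; [apply Cmod_triangle|]. rewrite !Cmod_mult, !Cmod_R.
      assert (X1 : Cmod (d + RtoC (e - r) * cis t) <= K).
      { eapply Rle_trans; [apply Cmod_triangle|].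
        rewrite Cmod_mult, Cmod_cis, Cmod_R. fold k.
        assert (Rabs (e - r) <= r + e) by (apply Rabs_le; lra). unfold K; lra. }
      pose proof (cis_lipschitz t v) as X2.
      specialize (Hrho u Hu). rewrite (Rabs_pos_eq (rho u)) by lra.
      assert (X3 : rho u <= K) by (unfold K; lra).
      pose proof (Rabs_pos (s - u)) as P1. pose proof (Rabs_pos (t - v)) as P2.
      assert (Rabs (s - u) * Cmod (d + RtoC (e - r) * cis t) <= Rabs (s - u) * K)
        by (apply Rmult_le_compat_l; auto).
      assert (rho u * Cmod (cis t - cis v) <= K * (4 * PI * Rabs (t - v)))
        by (apply Rmult_le_compat; auto using Cmod_ge_0; lra).
      assert (0 <= K * (4 * PI * Rabs (s - u))) by (apply Rmult_le_pos; [lra|apply Rmult_le_pos; lra]).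
      assert (0 <= K * Rabs (t - v)) by (apply Rmult_le_pos; lra).
      lra. }
  clear G.
  assert (G : forall s b p, 0 <= s <= 1 -> (forall t, Phi s t = circ b p t) -> rho s = p ->
     CInt (fun t => F (Phi s t) * Phit s t)%C 0 1 =
     (RtoC (2 * PI) * Ci * CInt (fun t => F (circ b p t) * (RtoC p * cis t))%C 0 1)%C).
  { intros s b p Hs Hc Hp. rewrite <- CInt_scal.
    - apply CInt_ext; [lra|]. intros t _. rewrite Hc. unfold Phit. rewrite cis'_cis, Hp. ring.
    - lra.
    - intros t Ht. apply ccont_mult.
      + destruct (Hin s t Hs) as [L HL]. rewrite Hc in HL.
        apply (ccont_comp F _ t L HL). apply circ_ccont.
      + apply ccont_mult; [apply ccont_const|apply ccont_cis]. }
  rewrite (G 1 a e) in H; try lra.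
  2:{ intros t. unfold Phi, circ, rho, d. replace (r + 1 * (e - r)) with e by ring. ring. }
  2:{ unfold rho; ring. }
  rewrite (G 0 z0 r) in H; try lra.
  2:{ intros t. unfold Phi, circ, rho, d. replace (r + 0 * (e - r)) with r by ring. ring. }
  2:{ unfold rho; ring. }
  apply Ceq_minus. pose proof two_pi_i_neq_0 as Hp.
  match goal with |- (?A - ?B)%C = _ => replace (A - B)%C with
    ((RtoC (2 * PI) * Ci * A - RtoC (2 * PI) * Ci * B) / (RtoC (2 * PI) * Ci))%C end.
  - rewrite H. field. split; [apply Ci_nz|]. intros E; apply Hp; rewrite E; ring.
  - field. split; [apply Ci_nz|]. intros E; apply Hp; rewrite E; ring.
Qed.

Lemma circ_sub_neq z0 r t z : 0 <= r -> Cmod (z - z0) < r -> (circ z0 r t - z)%C <> 0.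
Proof.
  intros Hr Hz E. apply Ceq_minus in E. rewrite <- E, circ_dist in Hz by auto. lra.
Qed.

Lemma circ_sub_ge z0 r t z : 0 <= r -> r - Cmod (z - z0) <= Cmod (circ z0 r t - z).
Proof.
  intros Hr. pose proof (Cmod_dist_triangle (circ z0 r t) z z0). rewrite circ_dist in H by auto. lra.
Qed.

(** The circle is deformed to a small one about a, on which the integrand becomes g itself;
    continuity of g at a then leaves no room for a positive difference. *)
Lemma cauchy_formula g z0 Q r a : 0 < r < Q -> hol z0 Q g -> Cmod (a - z0) < r ->
  CInt (fun t => g (circ z0 r t) * (RtoC r * cis t) / (circ z0 r t - a))%C 0 1 = g a.
Proof.
  intros Hr Hg Ha.
  set (F := fun z => (g z / (z - a))%C).
  assert (HF : forall z, Cmod (z - z0) < Q -> z <> a -> exists L, cdiff F z L).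
  { intros z Hz Hza. destruct (Hg z Hz) as [L HL]. eexists.
    apply cdiff_div; [now apply Cminus_eq_contra|exact HL|apply cdiff_shift]. }
  set (X := CInt (fun t => g (circ z0 r t) * (RtoC r * cis t) / (circ z0 r t - a))%C 0 1).
  apply Ceq_minus, Cmod_eq_0. apply Rle_antisym; [|apply Cmod_ge_0].
  apply Rnot_lt_le. intros Hp. set (e := Cmod (X - g a)) in *.
  (* Together with the factor 2 of [CInt_norm], e/4 gives a difference of at most e/2, which
     contradicts its being equal to e > 0. *)
  destruct (hol_continuous z0 Q g a Hg ltac:(lra) (e / 4)) as [d [Hd K]]; [lra|].
  set (ep := Rmin (d / 2) ((r - Cmod (a - z0)) / 2)).
  assert (Hep : 0 < ep) by (unfold ep; apply Rmin_pos; lra).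
  assert (He1 : ep <= d / 2) by apply Rmin_l.
  assert (He2 : ep <= (r - Cmod (a - z0)) / 2) by apply Rmin_r.
  assert (E : X = CInt (fun t => g (circ a ep t)) 0 1).
  { unfold X. transitivity (CInt (fun t => F (circ z0 r t) * (RtoC r * cis t))%C 0 1).
    - apply CInt_ext; [lra|]. intros t _. unfold F, Cdiv. ring.
    - rewrite <- (circle_homotopy F z0 Q a r ep); auto; try lra.
      apply CInt_ext; [lra|]. intros t _. unfold F, circ.
      assert (RtoC ep <> 0) by (intros Z; apply RtoC_inj in Z; lra).
      pose proof (cis_neq_0 t). field.
      replace (a + RtoC ep * cis t - a)%C with (RtoC ep * cis t)%C by ring.
      now apply Cmult_neq_0. }
  assert (B : e <= 2 * (e / 4) * (1 - 0)).
  { unfold e at 1. rewrite E.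
    assert (Hc : forall t, ccont (fun t => g (circ a ep t)) t).
    { intros t. apply hol_circ_ccont with (Q := ep + ep); [lra|].
      apply hol_sub with (2 := Hg). lra. }
    replace (g a) with (CInt (fun _ => g a) 0 1)
      by (rewrite CInt_const; replace (1 - 0) with 1 by ring; ring).
    rewrite <- CInt_minus; try lra.
    - apply CInt_norm; try lra.
      + intros t _. apply ccont_minus; [apply Hc|apply ccont_const].
      + intros t _. left. apply K. rewrite circ_dist; lra.
    - intros t _. apply Hc.
    - intros t _. apply ccont_const. }
  lra.
Qed.

Lemma mean_value g z0 Q r : 0 < r < Q -> hol z0 Q g ->
  CInt (fun t => g (circ z0 r t)) 0 1 = g z0.
Proof.
  intros Hr Hg. rewrite <- (cauchy_formula g z0 Q r z0); auto.
  - apply CInt_ext; [lra|]. intros t _. unfold circ.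
    assert (RtoC r <> 0) by (intros Z; apply RtoC_inj in Z; lra).
    pose proof (cis_neq_0 t). field.
    replace (z0 + RtoC r * cis t - z0)%C with (RtoC r * cis t)%C by ring.
    now apply Cmult_neq_0.
  - replace (z0 - z0)%C with (RtoC 0) by ring. rewrite Cmod_0. lra.
Qed.

Lemma ccont_on_bounded f a b : a <= b -> ccont_on f a b ->
  exists M, 0 < M /\ forall t, a <= t <= b -> Cmod (f t) <= M.
Proof.
  intros Hab Hf.
  destruct (continuity_ab_maj (fun t => Cmod (f t)) a b Hab) as [x [Hx _]].
  - intros t Ht. apply continuity_pt_filterlim. apply ccont_Cmod. now apply Hf.
  - exists (Cmod (f x) + 1). split; [pose proof (Cmod_ge_0 (f x)); lra|].
    intros t Ht. specialize (Hx t Ht). lra.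
Qed.

(** Differentiation under the integral sign from a remainder that is quadratic in w - z uniformly in
    t; the Cauchy kernels provide such a remainder by explicit algebra. *)
Lemma cdiff_param (k : C -> R -> C) (k' : R -> C) z M d : 0 < d ->
  (forall w, Cmod (w - z) < d -> ccont_on (k w) 0 1) -> ccont_on k' 0 1 ->
  (forall w t, Cmod (w - z) < d -> 0 <= t <= 1 ->
     Cmod (k w t - k z t - (w - z) * k' t) <= M * Cmod (w - z) * Cmod (w - z)) ->
  cdiff (fun w => CInt (k w) 0 1) z (CInt k' 0 1).
Proof.
  intros Hd Hk Hk' HM eps He.
  set (A := 2 * Rabs M + 1). assert (HA : 0 < A) by (unfold A; pose proof (Rabs_pos M); lra).
  exists (Rmin d (eps / A)). split; [apply Rmin_pos; auto; now apply Rdiv_lt_0_compat|].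
  intros w Hw. rmin d (eps / A).
  assert (Hz : Cmod (z - z) < d).
  { replace (z - z)%C with (RtoC 0) by ring. now rewrite Cmod_0. }
  assert (Ck : ccont_on (k w) 0 1) by (apply Hk; lra).
  assert (Cz : ccont_on (k z) 0 1) by now apply Hk.
  assert (Cl : ccont_on (fun t => (w - z) * k' t)%C 0 1)
    by (intros t Ht; apply ccont_mult; [apply ccont_const|auto]).
  replace (CInt (k w) 0 1 - CInt (k z) 0 1 - CInt k' 0 1 * (w - z))%C
    with (CInt (k w) 0 1 - CInt (k z) 0 1 - (w - z) * CInt k' 0 1)%C by ring.
  rewrite <- CInt_scal by (auto; lra).
  rewrite <- CInt_minus by (auto; lra).
  rewrite <- CInt_minus; auto; try lra.
  2:{ intros t Ht. apply ccont_minus; auto. }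
  set (x := Cmod (w - z)) in *. assert (Hx : 0 <= x) by apply Cmod_ge_0.
  eapply Rle_trans; [apply (CInt_norm _ 0 1 (M * x * x)); try lra|].
  - intros t Ht. repeat apply ccont_minus; auto.
  - intros t Ht. apply HM; auto. fold x. lra.
  - replace (2 * (M * x * x) * (1 - 0)) with (2 * M * x * x) by ring.
    apply Rmult_le_compat_r; auto.
    apply Rle_trans with (A * x).
    + apply Rmult_le_compat_r; auto. unfold A. pose proof (Rle_abs M). lra.
    + apply Rle_trans with (A * (eps / A)); [apply Rmult_le_compat_l; lra|].
      right; field; lra.
Qed.

Section Kernel.
Variables (phi : R -> C) (z0 : C) (r : R).
Hypothesis Hphi : ccont_on phi 0 1.
Hypothesis Hr : 0 < r.

Lemma kernel_ccont w n : Cmod (w - z0) < r ->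
  ccont_on (fun t => phi t / Complex.Cpow (circ z0 r t - w) n)%C 0 1.
Proof.
  intros Hw t Ht. apply ccont_mult; auto. apply ccont_inv.
  - apply Cpow_nz. apply circ_sub_neq; auto; lra.
  - induction n as [|n IH]; [apply (ccont_const 1)|].
    apply (ccont_mult (fun t => circ z0 r t - w)%C
      (fun t => Complex.Cpow (circ z0 r t - w) n)); auto.
    apply ccont_minus; [apply circ_ccont|apply ccont_const].
Qed.

Lemma kernel_near z w : Cmod (w - z) < (r - Cmod (z - z0)) / 2 -> Cmod (w - z0) < r /\
  forall t, (r - Cmod (z - z0)) / 2 <= Cmod (circ z0 r t - w).
Proof.
  intros Hw. pose proof (Cmod_dist_triangle w z z0). pose proof (Cmod_ge_0 (w - z)).
  split; [lra|]. intros t. pose proof (circ_sub_ge z0 r t w). lra.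
Qed.

Lemma cauchy_kernel1 z : Cmod (z - z0) < r ->
  cdiff (fun w => CInt (fun t => phi t / Complex.Cpow (circ z0 r t - w) 1)%C 0 1) z
    (CInt (fun t => phi t / Complex.Cpow (circ z0 r t - z) 2)%C 0 1).
Proof.
  intros Hz. destruct (ccont_on_bounded phi 0 1) as [A [HA HAb]]; auto; try lra.
  set (d := (r - Cmod (z - z0)) / 2). assert (Hd : 0 < d) by (unfold d; lra).
  assert (Hw := kernel_near z). fold d in Hw.
  apply cdiff_param with (M := A / (d * d * d)) (d := d); auto.
  - intros w Hww. apply kernel_ccont. now apply Hw.
  - now apply kernel_ccont.
  - intros w t Hww Ht. destruct (Hw w Hww) as [W1 W2]. specialize (W2 t).
    assert (Z2 : d <= Cmod (circ z0 r t - z)).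
    { apply Hw. replace (z - z)%C with (RtoC 0) by ring. now rewrite Cmod_0. }
    set (x := (circ z0 r t - w)%C) in *. set (y := (circ z0 r t - z)%C) in *.
    assert (Hx : x <> 0) by (apply Cmod_neq_0; lra).
    assert (Hy : y <> 0) by (apply Cmod_neq_0; lra).
    replace (w - z)%C with (y - x)%C by (unfold x, y; ring).
    replace (phi t / Complex.Cpow x 1 - phi t / Complex.Cpow y 1
      - (y - x) * (phi t / Complex.Cpow y 2))%C
      with (phi t * ((y - x) * (y - x)) / (x * (y * y)))%C by (simpl; field; auto).
    rewrite Cmod_div by (repeat apply Cmult_neq_0; auto).
    rewrite !Cmod_mult. unfold Rdiv.
    replace (A * / (d * d * d) * Cmod (y - x) * Cmod (y - x))
      with (A * (Cmod (y - x) * Cmod (y - x)) * / (d * d * d)) by ring.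
    apply Rmult_le_compat.
    + repeat apply Rmult_le_pos; apply Cmod_ge_0.
    + left. apply Rinv_0_lt_compat. repeat apply Rmult_lt_0_compat; lra.
    + apply Rmult_le_compat_r; auto. apply Rmult_le_pos; apply Cmod_ge_0.
    + apply Rinv_le_contravar; [repeat apply Rmult_lt_0_compat; lra|].
      rewrite Rmult_assoc. apply Rmult_le_compat; try lra.
      * apply Rmult_le_pos; lra.
      * apply Rmult_le_compat; lra.
Qed.

(** The first kernel differentiates a Cauchy integral; this second one shows that the derivative is
    again differentiable, which is needed to integrate g'/g. *)
Lemma cauchy_kernel2 z : Cmod (z - z0) < r ->
  cdiff (fun w => CInt (fun t => phi t / Complex.Cpow (circ z0 r t - w) 2)%C 0 1) z
    (CInt (fun t => 2 * (phi t / Complex.Cpow (circ z0 r t - z) 3))%C 0 1).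
Proof.
  intros Hz. destruct (ccont_on_bounded phi 0 1) as [A [HA HAb]]; auto; try lra.
  set (d := (r - Cmod (z - z0)) / 2). assert (Hd : 0 < d) by (unfold d; lra).
  assert (Hw := kernel_near z). fold d in Hw.
  apply cdiff_param with (M := A * (3 / (d * d * d * d))) (d := d); auto.
  - intros w Hww. apply kernel_ccont. now apply Hw.
  - intros t Ht. apply ccont_mult; [apply ccont_const|]. now apply kernel_ccont.
  - intros w t Hww Ht. destruct (Hw w Hww) as [W1 W2]. specialize (W2 t).
    assert (Z2 : d <= Cmod (circ z0 r t - z)).
    { apply Hw. replace (z - z)%C with (RtoC 0) by ring. now rewrite Cmod_0. }
    set (x := (circ z0 r t - w)%C) in *. set (y := (circ z0 r t - z)%C) in *.
    assert (Hx : x <> 0) by (apply Cmod_neq_0; lra).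
    assert (Hy : y <> 0) by (apply Cmod_neq_0; lra).
    replace (w - z)%C with (y - x)%C by (unfold x, y; ring).
    replace (phi t / Complex.Cpow x 2 - phi t / Complex.Cpow y 2
      - (y - x) * (2 * (phi t / Complex.Cpow y 3)))%C
      with (phi t * ((y - x) * (y - x)) * (/ (x * x) * / (y * y) + 2 * (/ x * / (y * (y * y)))))%C
      by (simpl; field; auto).
    rewrite !Cmod_mult.
    replace (A * (3 / (d * d * d * d)) * Cmod (y - x) * Cmod (y - x))
      with (A * (Cmod (y - x) * Cmod (y - x)) * (3 / (d * d * d * d))) by ring.
    apply Rmult_le_compat.
    + repeat apply Rmult_le_pos; apply Cmod_ge_0.
    + apply Cmod_ge_0.
    + apply Rmult_le_compat_r; auto. apply Rmult_le_pos; apply Cmod_ge_0.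
    + eapply Rle_trans; [apply Cmod_triangle|].
      rewrite !Cmod_mult, !Cmod_inv by (repeat apply Cmult_neq_0; auto).
      rewrite !Cmod_mult, Cmod_R, Rabs_pos_eq by lra.
      set (p := / d). assert (Hp : 0 < p) by now apply Rinv_0_lt_compat.
      assert (X : 0 <= / Cmod x <= p).
      { split; [left; apply Rinv_0_lt_compat; lra|apply Rinv_le_contravar; lra]. }
      assert (Y : 0 <= / Cmod y <= p).
      { split; [left; apply Rinv_0_lt_compat; lra|apply Rinv_le_contravar; lra]. }
      rewrite !Rinv_mult.
      replace (3 / (d * d * d * d)) with (p * p * (p * p) + 2 * (p * (p * (p * p)))).
      2:{ unfold p. field. lra. }
      set (ix := / Cmod x) in *. set (iy := / Cmod y) in *.
      assert (XX : 0 <= ix * ix <= p * p) by (split; [apply Rmult_le_pos|apply Rmult_le_compat]; lra).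
      assert (YY : 0 <= iy * iy <= p * p) by (split; [apply Rmult_le_pos|apply Rmult_le_compat]; lra).
      apply Rplus_le_compat.
      * apply Rmult_le_compat; lra.
      * apply Rmult_le_compat_l; [lra|]. apply Rmult_le_compat; try lra.
        -- apply Rmult_le_pos; lra.
        -- apply Rmult_le_compat; lra.
Qed.
End Kernel.

Lemma hol_derivative g z0 Q r : 0 < r < Q -> hol z0 Q g ->
  exists g', (forall z, Cmod (z - z0) < r -> cdiff g z (g' z)) /\ hol z0 r g'.
Proof.
  intros Hr Hg. set (phi := fun t => (g (circ z0 r t) * (RtoC r * cis t))%C).
  assert (Hphi : ccont_on phi 0 1).
  { intros t _. apply ccont_mult; [apply hol_circ_ccont with Q; auto; lra|].
    apply ccont_mult; [apply ccont_const|apply ccont_cis]. }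
  exists (fun z => CInt (fun t => phi t / Complex.Cpow (circ z0 r t - z) 2)%C 0 1). split.
  - intros z Hz.
    apply (cdiff_ext_near
      (fun w => CInt (fun t => phi t / Complex.Cpow (circ z0 r t - w) 1)%C 0 1)
      g z _ (r - Cmod (z - z0))); [lra| |apply cauchy_kernel1; auto; lra].
    intros w Hw. pose proof (Cmod_dist_triangle w z z0).
    rewrite <- (cauchy_formula g z0 Q r w); auto; try lra.
    apply CInt_ext; [lra|]. intros t _. unfold phi.
    assert ((circ z0 r t - w)%C <> 0) by (apply circ_sub_neq; lra).
    simpl. field. auto.
  - intros z Hz. eexists. apply cauchy_kernel2; auto; lra.
Qed.

(* The removable singularity of the quotient is filled by the Cauchy integral of
   [g(ζ) / ((ζ - a)(ζ - z))]. *)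
Lemma hol_divide g z0 Q a : hol z0 Q g -> Cmod (a - z0) < Q -> g a = 0 ->
  exists g1, hol z0 Q g1 /\ forall z, Cmod (z - z0) < Q -> g z = ((z - a) * g1 z)%C.
Proof.
  intros Hg Ha Hga. set (r := (Cmod (a - z0) + Q) / 2).
  pose proof (Cmod_ge_0 (a - z0)%C) as Pa.
  assert (Hr : 0 < r < Q) by (unfold r; lra). assert (Har : Cmod (a - z0) < r) by (unfold r; lra).
  set (phi := fun t => (g (circ z0 r t) * (RtoC r * cis t) / (circ z0 r t - a))%C).
  assert (Hphi : ccont_on phi 0 1).
  { intros t _. apply ccont_mult.
    - apply ccont_mult; [apply hol_circ_ccont with Q; auto; lra|].
      apply ccont_mult; [apply ccont_const|apply ccont_cis].
    - apply ccont_inv; [apply circ_sub_neq; auto; lra|].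
      apply ccont_minus; [apply circ_ccont|apply ccont_const]. }
  set (G := fun z => CInt (fun t => phi t / Complex.Cpow (circ z0 r t - z) 1)%C 0 1).
  assert (E : forall z, Cmod (z - z0) < r -> g z = ((z - a) * G z)%C).
  { intros z Hz. unfold G. rewrite <- CInt_scal; [|lra|apply kernel_ccont; auto; lra].
    replace (g z) with (g z - g a)%C by (rewrite Hga; ring).
    rewrite <- (cauchy_formula g z0 Q r z), <- (cauchy_formula g z0 Q r a) by auto.
    assert (CC : forall x, Cmod (x - z0) < r -> ccont_on (fun t => g (circ z0 r t) * (RtoC r * cis t) / (circ z0 r t - x))%C 0 1).
    { intros x Hx t _. apply ccont_mult.
      - apply ccont_mult; [apply hol_circ_ccont with Q; auto; lra|].
        apply ccont_mult; [apply ccont_const|apply ccont_cis].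
      - apply ccont_inv; [apply circ_sub_neq; auto; lra|].
        apply ccont_minus; [apply circ_ccont|apply ccont_const]. }
    rewrite <- CInt_minus; auto; try lra.
    apply CInt_ext; [lra|]. intros t _. unfold phi.
    assert ((circ z0 r t - z)%C <> 0) by (apply circ_sub_neq; lra).
    assert ((circ z0 r t - a)%C <> 0) by (apply circ_sub_neq; lra).
    simpl. field. auto. }
  exists (fun z => if Ceq_dec z a then G a else (g z / (z - a))%C). split.
  - intros z Hz. destruct (Ceq_dec z a) as [->|Hza].
    + eexists. apply (cdiff_ext_near G _ a _ (r - Cmod (a - z0))); [lra| |].
      * intros w Hw. destruct (Ceq_dec w a) as [->|Hwa]; auto.
        pose proof (Cmod_dist_triangle w a z0). rewrite E by lra.
        field. now apply Cminus_eq_contra.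
      * apply cauchy_kernel1; auto; lra.
    + destruct (Hg z Hz) as [L HL]. eexists.
      apply (cdiff_ext_near (fun w => g w / (w - a))%C _ z _ (Cmod (z - a))).
      * apply Cmod_pos. now apply Cminus_eq_contra.
      * intros w Hw. destruct (Ceq_dec w a) as [->|]; auto.
        rewrite Cmod_sub_sym in Hw. lra.
      * apply cdiff_div; [now apply Cminus_eq_contra|exact HL|apply cdiff_shift].
  - intros z Hz. destruct (Ceq_dec z a) as [->|Hza].
    + rewrite Hga. ring.
    + field. now apply Cminus_eq_contra.
Qed.

Lemma circle_bound_interior g z0 Q r M z : 0 < r < Q -> hol z0 Q g ->
  (forall t, Cmod (g (circ z0 r t)) <= M) -> Cmod (z - z0) < r ->
  Cmod (g z) <= 2 * M * (r / (r - Cmod (z - z0))).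
Proof.
  intros Hr Hg HM Hz. rewrite <- (cauchy_formula g z0 Q r z) by auto.
  assert (PM : 0 <= M) by (eapply Rle_trans; [apply Cmod_ge_0|apply (HM 0)]).
  eapply Rle_trans; [apply (CInt_norm _ 0 1 (M * (r / (r - Cmod (z - z0))))); try lra|lra].
  - intros t _. apply ccont_mult.
    + apply ccont_mult; [apply hol_circ_ccont with Q; auto; lra|].
      apply ccont_mult; [apply ccont_const|apply ccont_cis].
    + apply ccont_inv; [apply circ_sub_neq; auto; lra|].
      apply ccont_minus; [apply circ_ccont|apply ccont_const].
  - intros t _. assert (N : (circ z0 r t - z)%C <> 0) by (apply circ_sub_neq; auto; lra).
    rewrite Cmod_div, !Cmod_mult, Cmod_cis, Cmod_R, Rabs_pos_eq by (auto; lra).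
    pose proof (circ_sub_ge z0 r t z ltac:(lra)).
    unfold Rdiv. rewrite Rmult_assoc. apply Rmult_le_compat; auto using Cmod_ge_0.
    + apply Rmult_le_pos; [lra|]. left; apply Rinv_0_lt_compat. now apply Cmod_pos.
    + rewrite Rmult_1_r. apply Rmult_le_compat_l; [lra|]. apply Rinv_le_contravar; lra.
Qed.

(* Applying the crude Cauchy bound to [g^n] and letting [n] tend to infinity removes its constant. *)
Lemma maximum_principle g z0 Q r M z : 0 < r < Q -> hol z0 Q g ->
  (forall t, Cmod (g (circ z0 r t)) <= M) -> Cmod (z - z0) < r -> Cmod (g z) <= M.
Proof.
  intros Hr Hg HM Hz.
  assert (PM : 0 <= M) by (eapply Rle_trans; [apply Cmod_ge_0|apply (HM 0)]).
  apply Rnot_lt_le. intros Hlt.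
  set (K := 2 * (r / (r - Cmod (z - z0)))).
  assert (B : forall n, Cmod (g z) ^ n <= K * M ^ n).
  { intros n. rewrite <- Cmod_pow. unfold K.
    replace (2 * (r / (r - Cmod (z - z0))) * M ^ n)
      with (2 * M ^ n * (r / (r - Cmod (z - z0)))) by ring.
    apply (circle_bound_interior (fun w => Complex.Cpow (g w) n) z0 Q r); auto.
    - now apply hol_pow.
    - intros t. rewrite Cmod_pow. apply pow_incr. split; auto using Cmod_ge_0. }
  destruct (Req_dec M 0) as [E|E].
  - specialize (B 1%nat). rewrite E in *. simpl in B. lra.
  - assert (1 < Cmod (g z) / M).
    { apply (Rmult_lt_reg_r M); [lra|]. unfold Rdiv. rewrite Rmult_assoc, Rinv_l by auto. lra. }
    destruct (Pow_x_infinity (Cmod (g z) / M)) with (b := K + 1) as [N HN].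
    { now rewrite Rabs_pos_eq by lra. }
    specialize (HN N (le_n _)). rewrite Rabs_pos_eq in HN by (apply pow_le; lra).
    assert (PN : 0 < M ^ N) by (apply pow_lt; lra).
    specialize (B N). unfold Rdiv in HN. rewrite Rpow_mult_distr, pow_inv in HN.
    assert (Cmod (g z) ^ N * / M ^ N <= K).
    { apply (Rmult_le_reg_r (M ^ N)); auto. rewrite Rmult_assoc, Rinv_l by lra. lra. }
    lra.
Qed.

(** * Holomorphic logarithms and logarithmic means over circles *)

(** P integrates F along radii. Goursat's theorem on the triangle z0, z, w turns P w - P z into the
    integral over the segment from z to w, and continuity of F at z gives the derivative. *)
Lemma hol_primitive F z0 Q : hol z0 Q F ->
  exists P : C -> C, P z0 = 0 /\ forall z, Cmod (z - z0) < Q -> cdiff P z (F z).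
Proof.
  intros HF.
  set (P := fun z => CInt (fun t => F (z0 + RtoC t * (z - z0)) * (z - z0))%C 0 1).
  exists P. split.
  { unfold P. rewrite (CInt_ext _ (fun _ => RtoC 0)); [|lra|intros; ring].
    rewrite CInt_const. ring. }
  intros z Hz.
  assert (Seg : forall w, Cmod (w - z0) < Q -> forall s, 0 <= s <= 1 ->
    Cmod (z - z0 + RtoC s * (w - z)) < Q).
  { intros w Hw s Hs.
    replace (z - z0 + RtoC s * (w - z))%C with (RtoC (1 - s) * (z - z0) + RtoC s * (w - z0))%C
      by (rewrite RtoC_minus; ring).
    eapply Rle_lt_trans; [apply Cmod_triangle|].
    rewrite !Cmod_mult, !Cmod_R, !Rabs_pos_eq by lra.
    destruct (Req_dec s 0) as [->|].
    - replace (1 - 0) with 1 by ring. lra.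
    - assert (s * Cmod (w - z0) < s * Q) by (apply Rmult_lt_compat_l; lra).
      assert ((1 - s) * Cmod (z - z0) <= (1 - s) * Q) by (apply Rmult_le_compat_l; lra).
      lra. }
  assert (K : forall w, Cmod (w - z0) < Q ->
    (P w - P z)%C = CInt (fun s => F (z + RtoC s * (w - z)) * (w - z))%C 0 1).
  { intros w Hw.
    (* The side t = 0 of this homotopy is collapsed to z0, and the side t = 1 is the segment from z
       to w. *)
    set (Phi := fun s t => (z0 + RtoC t * (z - z0 + RtoC s * (w - z)))%C).
    set (Phis := fun s t : R => (RtoC t * (w - z))%C).
    set (Phit := fun s t : R => (z - z0 + RtoC s * (w - z))%C).
    set (a := Cmod (z - z0)). set (b := Cmod (w - z)).
    assert (Pa : 0 <= a) by apply Cmod_ge_0. assert (Pb : 0 <= b) by apply Cmod_ge_0.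
    assert (BT : forall s t, 0 <= s <= 1 -> Cmod (Phit s t) <= a + b + 1).
    { intros s t Hs. unfold Phit. eapply Rle_trans; [apply Cmod_triangle|].
      rewrite Cmod_mult, Cmod_R, Rabs_pos_eq by lra. fold a b.
      assert (s * b <= 1 * b) by (apply Rmult_le_compat_r; lra). lra. }
    pose proof (goursat_homotopy Phi Phis Phit (a + b + 1) F) as G.
    match type of G with _ -> _ -> _ -> _ -> _ -> _ -> _ -> _ -> _ -> ?X => assert (X) as H end.
    { apply G; clear G.
      - lra.
      - intros s t. unfold Phi, Phis, RtoC. split; simpl; auto_derive; auto; ring.
      - intros s t. unfold Phi, Phit, RtoC. split; simpl; auto_derive; auto; ring.
      - intros s t. apply ccont_const.
      - intros s t. apply ccont_const.
      - intros s t Hs Ht. unfold Phis. rewrite Cmod_mult, Cmod_R, Rabs_pos_eq by lra. fold b.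
        assert (t * b <= 1 * b) by (apply Rmult_le_compat_r; lra). lra.
      - intros s t Hs Ht. now apply BT.
      - intros s t u v Hs Ht Hu Hv.
        replace (Phi s t - Phi u v)%C with (RtoC (t - v) * Phit s t + RtoC v * (RtoC (s - u) * (w - z)))%C
          by (unfold Phi, Phit; rewrite !RtoC_minus; ring).
        eapply Rle_trans; [apply Cmod_triangle|].
        rewrite !Cmod_mult, !Cmod_R. rewrite (Rabs_pos_eq v) by lra. fold b.
        specialize (BT s t Hs). pose proof (Rabs_pos (t - v)). pose proof (Rabs_pos (s - u)).
        assert (Rabs (t - v) * Cmod (Phit s t) <= Rabs (t - v) * (a + b + 1))
          by (apply Rmult_le_compat_l; auto).
        assert (v * (Rabs (s - u) * b) <= 1 * (Rabs (s - u) * b))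
          by (apply Rmult_le_compat_r; [apply Rmult_le_pos; auto|lra]).
        assert (Rabs (s - u) * b <= Rabs (s - u) * (a + b + 1)) by (apply Rmult_le_compat_l; lra).
        lra.
      - intros s t Hs Ht. apply HF. unfold Phi.
        replace (z0 + RtoC t * (z - z0 + RtoC s * (w - z)) - z0)%C
          with (RtoC t * (z - z0 + RtoC s * (w - z)))%C by ring.
        rewrite Cmod_mult, Cmod_R, Rabs_pos_eq by lra.
        specialize (Seg w Hw s Hs).
        eapply Rle_lt_trans; [|exact Seg].
        replace (Cmod (z - z0 + RtoC s * (w - z))) with (1 * Cmod (z - z0 + RtoC s * (w - z))) at 2 by ring.
        apply Rmult_le_compat_r; [apply Cmod_ge_0|lra]. }
    clear G. unfold P.
    transitivity (CInt (fun t => F (Phi 1 t) * Phit 1 t)%C 0 1 - CInt (fun t => F (Phi 0 t) * Phit 0 t)%C 0 1)%C.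
    { f_equal; apply CInt_ext; try lra; intros t _; unfold Phi, Phit.
      - replace (z - z0 + RtoC 1 * (w - z))%C with (w - z0)%C by ring. reflexivity.
      - replace (z - z0 + RtoC 0 * (w - z))%C with (z - z0)%C by ring. reflexivity. }
    rewrite H. rewrite (CInt_ext (fun s => F (Phi s 0) * Phis s 0)%C (fun _ => RtoC 0)).
    - rewrite CInt_const.
      rewrite (CInt_ext (fun s => F (Phi s 1) * Phis s 1)%C (fun s => F (z + RtoC s * (w - z)) * (w - z))%C).
      + ring.
      + lra.
      + intros s _. unfold Phi, Phis.
        replace (z0 + RtoC 1 * (z - z0 + RtoC s * (w - z)))%C with (z + RtoC s * (w - z))%C by ring.
        ring.
    - lra.
    - intros s _. unfold Phis. ring. }
  intros eps He.
  destruct (hol_continuous z0 Q F z HF Hz (eps / 2)) as [d [Hd HC]]; [lra|].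
  exists (Rmin d (Q - Cmod (z - z0))). split; [apply Rmin_pos; lra|].
  intros w Hw. rmin d (Q - Cmod (z - z0)).
  assert (Hw0 : Cmod (w - z0) < Q) by (pose proof (Cmod_dist_triangle w z z0); lra).
  rewrite K by auto.
  assert (Cc : ccont_on (fun s => F (z + RtoC s * (w - z)) * (w - z))%C 0 1).
  { intros s Hs. apply ccont_mult; [|apply ccont_const].
    destruct (HF (z + RtoC s * (w - z))%C) as [L HL].
    - replace (z + RtoC s * (w - z) - z0)%C with (z - z0 + RtoC s * (w - z))%C by ring. now apply Seg.
    - apply (ccont_comp F (fun s => z + RtoC s * (w - z))%C s L HL).
      apply ccont_plus; [apply ccont_const|]. apply ccont_mult; [|apply ccont_const].
      apply ccont_RtoC, continuous_id. }
  replace (F z * (w - z))%C with (CInt (fun _ => F z * (w - z))%C 0 1)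
    by (rewrite CInt_const; replace (1 - 0) with 1 by ring; ring).
  rewrite <- CInt_minus; auto; try lra.
  2:{ intros s _. apply ccont_const. }
  eapply Rle_trans; [apply (CInt_norm _ 0 1 (eps / 2 * Cmod (w - z))); try lra|right; field].
  - intros s Hs. apply ccont_minus; [now apply Cc|apply ccont_const].
  - intros s Hs.
    replace (F (z + RtoC s * (w - z)) * (w - z) - F z * (w - z))%C
      with ((F (z + RtoC s * (w - z)) - F z) * (w - z))%C by ring.
    rewrite Cmod_mult. apply Rmult_le_compat_r; [apply Cmod_ge_0|]. left. apply HC.
    replace (z + RtoC s * (w - z) - z)%C with (RtoC s * (w - z))%C by ring.
    rewrite Cmod_mult, Cmod_R, Rabs_pos_eq by lra.
    pose proof (Cmod_ge_0 (w - z)%C).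
    assert (s * Cmod (w - z) <= 1 * Cmod (w - z)) by (apply Rmult_le_compat_r; lra). lra.
Qed.

Lemma is_derive_ln_Cmod (g : R -> C) t v : cder g t v -> g t <> 0 ->
  is_derive (fun s => ln (Cmod (g s))) t (fst (v / g t)%C).
Proof.
  intros [H1 H2] Hg.
  assert (Hq : 0 < fst (g t) ^ 2 + snd (g t) ^ 2).
  { pose proof (Cmod2_alt (g t)) as E. unfold Re, Im in E. rewrite <- E.
    apply pow_lt. now apply Cmod_pos. }
  unfold Cmod.
  set (X := fun s => fst (g s)) in *. set (Y := fun s => snd (g s)) in *.
  change (is_derive (fun s => ln (sqrt (X s ^ 2 + Y s ^ 2))) t (fst (v / g t)%C)).
  change (0 < X t ^ 2 + Y t ^ 2) in Hq.
  replace (fst (v / g t)%C) with ((fst v * X t + snd v * Y t) / (X t ^ 2 + Y t ^ 2)).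
  2:{ unfold Cdiv, Cinv, Complex.Cinv, Cmult; simpl. fold (X t) (Y t).
      change (fst (g t)) with (X t). change (snd (g t)) with (Y t). field. lra. }
  assert (Hs : 0 < sqrt (X t ^ 2 + Y t ^ 2)) by now apply sqrt_lt_R0.
  auto_derive.
  - repeat split; auto; [now exists (fst v)|now exists (snd v)].
  - replace (Derive (fun x : R => X x) t) with (fst v) by (symmetry; now apply is_derive_unique).
    replace (Derive (fun x : R => Y x) t) with (snd v) by (symmetry; now apply is_derive_unique).
    simpl in *. rewrite !Rmult_1_r in *.
    set (q := X t * X t + Y t * Y t) in *. set (w := sqrt q) in *.
    assert (E : w * w = q) by (apply sqrt_sqrt; lra).
    rewrite <- E. field. lra.
Qed.

(** P is the primitive of g'/g vanishing at the centre, and ln |g| - Re P has zero derivative along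
    each ray. The last clause identifies P'(z0) with the logarithmic derivative of g; it gives the
    first Fourier coefficient of ln |g|. *)
Lemma hol_log g z0 Q r : 0 < r < Q -> hol z0 Q g ->
  (forall z, Cmod (z - z0) < Q -> g z <> 0) ->
  exists P : C -> C, hol z0 r P /\ P z0 = 0 /\ (forall z, Cmod (z - z0) < r -> ln (Cmod (g z)) = ln (Cmod (g z0)) + fst (P z)) /\
    (forall L, cdiff g z0 (L * g z0)%C -> cdiff P z0 L).
Proof.
  intros Hr Hg Hnz.
  destruct (hol_derivative g z0 Q r Hr Hg) as [g' [Hg' Hhg']].
  assert (Hq : hol z0 r (fun z => g' z / g z)%C).
  { apply hol_div; auto.
    - apply hol_sub with (2 := Hg). replace (z0 - z0)%C with (RtoC 0) by ring. rewrite Cmod_0. lra.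
    - intros z Hz. apply Hnz. lra. }
  destruct (hol_primitive _ _ _ Hq) as [P [HP0 HP]].
  assert (C0r : Cmod (z0 - z0) < r)
    by (replace (z0 - z0)%C with (RtoC 0) by ring; rewrite Cmod_0; lra).
  exists P. split; [|split; [exact HP0|split]].
  - intros z Hz. eexists. now apply HP.
  - intros z Hz.
    set (ray := fun t => (z0 + RtoC t * (z - z0))%C).
    assert (Hray : forall t, 0 <= t <= 1 -> Cmod (ray t - z0) < r).
    { intros t Ht. unfold ray. replace (z0 + RtoC t * (z - z0) - z0)%C with (RtoC t * (z - z0))%C by ring.
      rewrite Cmod_mult, Cmod_R, Rabs_pos_eq by lra. pose proof (Cmod_ge_0 (z - z0)%C).
      assert (t * Cmod (z - z0) <= 1 * Cmod (z - z0)) by (apply Rmult_le_compat_r; lra). lra. }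
    assert (Dray : forall t, cder ray t (z - z0)%C).
    { intros t. unfold ray, RtoC. split; simpl; auto_derive; auto; ring. }
    set (h := fun t => minus (ln (Cmod (g (ray t))) : R_NormedModule) (fst (P (ray t)))).
    assert (E : h 0 = h 1).
    { apply (eq_is_derive (V := R_NormedModule) h 0 1); [|lra].
      intros t Ht.
      replace (zero : R_NormedModule) with
        (minus (fst ((g' (ray t) * (z - z0)) / g (ray t))%C : R_NormedModule)
          (fst ((g' (ray t) / g (ray t)) * (z - z0))%C)).
      - apply (is_derive_minus (K := R_AbsRing) (V := R_NormedModule)).
        + apply is_derive_ln_Cmod.
          * apply cder_comp; auto.
          * apply Hnz. specialize (Hray t Ht). lra.
        + apply (cder_comp P ray t _ _ (HP _ (Hray t Ht)) (Dray t)).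
      - replace ((g' (ray t) * (z - z0)) / g (ray t))%C with ((g' (ray t) / g (ray t)) * (z - z0))%C
          by (unfold Cdiv; ring).
        apply (minus_eq_zero (G := R_NormedModule)). }
    unfold h, minus, plus, opp in E; simpl in E.
    replace (ray 0) with z0 in E by (unfold ray; ring).
    replace (ray 1) with z in E by (unfold ray; ring).
    rewrite HP0 in E. simpl in E. lra.
  - intros L HL. apply (cdiff_eq _ _ _ _ (HP z0 C0r)).
    assert (Hn : g z0 <> 0) by (apply Hnz; lra).
    rewrite (cdiff_unique _ _ _ _ (Hg' z0 C0r) HL). field. auto.
Qed.

Lemma ccont_conj f t : ccont f t -> ccont (fun s => Cconj (f s)) t.
Proof. intros [H1 H2]. split; simpl; auto. now apply (continuous_opp (V := R_NormedModule)). Qed.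

Lemma CInt_conj f a b : a <= b -> ccont_on f a b ->
  CInt (fun t => Cconj (f t)) a b = Cconj (CInt f a b).
Proof.
  intros Hab Hf. destruct (ccont_on_ex _ _ _ Hab Hf) as [E1 E2].
  unfold CInt, Cconj; simpl. f_equal. now apply (RInt_opp (V := R_CompleteNormedModule)).
Qed.

Lemma CInt_cis : CInt cis 0 1 = 0.
Proof.
  rewrite (CInt_ext cis (fun t => circ 0 1 t - 0)%C); [|lra|intros; unfold circ; ring].
  rewrite (mean_value (fun z => z - 0)%C 0 2 1); [ring|lra|apply hol_shift].
Qed.

(** Here ln |g| = ln |g z0| + (P + conj P)/2 with P z0 = 0, so the mean is the value at the centre.
    Against [cis], the P part is the mean of (z - z0) P / r, which vanishes at z0. Writing P = (z -
    z0) P1 and using cis · conj cis = 1, the conjugate part has mean r conj(P1 z0). Hence the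
    dependence on r is linear. *)
Lemma log_circle_means g z0 Q r L : 0 < r < Q -> hol z0 Q g ->
  (forall z, Cmod (z - z0) < Q -> g z <> 0) -> cdiff g z0 (L * g z0)%C ->
  RInt (fun t => ln (Cmod (g (circ z0 r t)))) 0 1 = ln (Cmod (g z0)) /\ CInt (fun t => RtoC (ln (Cmod (g (circ z0 r t)))) * cis t)%C 0 1 = (RtoC (r / 2) * Cconj L)%C.
Proof.
  intros Hr Hg Hnz HL. set (r' := (r + Q) / 2).
  destruct (hol_log g z0 Q r') as [P [HP [HP0 [HPl HPd]]]]; auto; [unfold r'; lra|].
  specialize (HPd L HL).
  assert (Hr' : 0 < r < r') by (unfold r'; lra).
  assert (C0r : Cmod (z0 - z0) < r')
    by (replace (z0 - z0)%C with (RtoC 0) by ring; rewrite Cmod_0; lra).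
  assert (El : forall t, ln (Cmod (g (circ z0 r t))) = ln (Cmod (g z0)) + fst (P (circ z0 r t))).
  { intros t. apply HPl. rewrite circ_dist; lra. }
  assert (CP : ccont_on (fun t => P (circ z0 r t)) 0 1).
  { intros t _. apply hol_circ_ccont with r'; auto. lra. }
  assert (Ccis : ccont_on cis 0 1) by (intros t _; apply ccont_cis).
  split.
  - transitivity (RInt (fun t => ln (Cmod (g z0)) + fst (P (circ z0 r t))) 0 1).
    { apply RInt_ext. intros t _. apply El. }
    assert (M : RInt (fun t => fst (P (circ z0 r t))) 0 1 = 0).
    { change (fst (CInt (fun t => P (circ z0 r t)) 0 1) = 0).
      rewrite (mean_value P z0 r' r) by auto. now rewrite HP0. }
    etransitivity; [apply (RInt_plus (V := R_CompleteNormedModule))|].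
    + apply ex_RInt_const.
    + exact (proj1 (ccont_on_ex (fun t => P (circ z0 r t)) 0 1 Rle_0_1 CP)).
    + rewrite RInt_const. unfold plus, scal; simpl; unfold mult; simpl. rewrite M. ring.
  - destruct (hol_divide P z0 r' z0) as [P1 [HP1 EP1]]; auto.
    assert (E1 : P1 z0 = L).
    { destruct (HP1 z0 C0r) as [M HM].
      apply (cdiff_unique P z0); auto.
      apply (cdiff_ext_near (fun z => (z - z0) * P1 z)%C P z0 _ r'); [lra| |].
      - intros w Hw. symmetry. now apply EP1.
      - eapply cdiff_eq; [apply cdiff_mult; [apply cdiff_shift|exact HM]|]. cbv beta. ring. }
    assert (C1 : ccont_on (fun t => P1 (circ z0 r t)) 0 1).
    { intros t _. apply hol_circ_ccont with r'; auto. lra. }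
    assert (I1 : CInt (fun t => P (circ z0 r t) * cis t)%C 0 1 = 0).
    { transitivity (CInt (fun t => / RtoC r * ((circ z0 r t - z0) * P (circ z0 r t)))%C 0 1).
      - apply CInt_ext; [lra|]. intros t _. unfold circ at 2.
        assert (RtoC r <> 0) by (intros Z; apply RtoC_inj in Z; lra). field. auto.
      - rewrite CInt_scal; [|lra|].
        + rewrite (mean_value (fun z => (z - z0) * P z)%C z0 r' r); auto; [ring|].
          apply hol_mult; [apply hol_shift|auto].
        + intros t Ht. apply ccont_mult; [|now apply CP].
          apply ccont_minus; [apply circ_ccont|apply ccont_const]. }
    assert (I2 : CInt (fun t => Cconj (P (circ z0 r t)) * cis t)%C 0 1 = (RtoC r * Cconj L)%C).
    { transitivity (CInt (fun t => RtoC r * Cconj (P1 (circ z0 r t)))%C 0 1).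
      - apply CInt_ext; [lra|]. intros t _. rewrite EP1 by (rewrite circ_dist; lra).
        replace (circ z0 r t - z0)%C with (RtoC r * cis t)%C by (unfold circ; ring).
        rewrite !Cmult_conj.
        replace (Cconj (RtoC r)) with (RtoC r) by (unfold Cconj, RtoC; simpl; f_equal; ring).
        transitivity (RtoC r * (cis t * Cconj (cis t)) * Cconj (P1 (circ z0 r t)))%C; [ring|].
        rewrite <- Cmod2_conj, Cmod_cis. replace (1 ^ 2) with 1 by ring. ring.
      - rewrite CInt_scal; [|lra|].
        + rewrite CInt_conj by (auto; lra). rewrite (mean_value P1 z0 r' r), E1; auto.
        + intros t Ht. apply ccont_conj. now apply C1. }
    transitivity (CInt (fun t => RtoC (ln (Cmod (g z0))) * cis t
      + (/ 2 * (P (circ z0 r t) * cis t) + / 2 * (Cconj (P (circ z0 r t)) * cis t)))%C 0 1).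
    { apply CInt_ext; [lra|]. intros t _. rewrite El, RtoC_plus.
      change (fst (P (circ z0 r t))) with (Re (P (circ z0 r t))). rewrite re_alt. field. }
    assert (X1 : ccont_on (fun t => P (circ z0 r t) * cis t)%C 0 1)
      by (intros t Ht; apply ccont_mult; [now apply CP|apply ccont_cis]).
    assert (X2 : ccont_on (fun t => Cconj (P (circ z0 r t)) * cis t)%C 0 1)
      by (intros t Ht; apply ccont_mult; [now apply ccont_conj, CP|apply ccont_cis]).
    rewrite !CInt_plus, !CInt_scal, I1, I2, CInt_cis; auto; try lra.
    + rewrite RtoC_div by lra. field.
    + intros t Ht. apply ccont_mult; [apply ccont_const|auto].
    + intros t Ht. apply ccont_mult; [apply ccont_const|auto].
    + intros t Ht. apply ccont_mult; [apply ccont_const|auto].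
    + intros t Ht. apply ccont_plus; apply ccont_mult; auto using ccont_const.
Qed.

(** * Zeros of bounded holomorphic functions *)

Lemma RtoC_neq_0 x : x <> 0 -> RtoC x <> 0.
Proof. intros H E. apply RtoC_inj in E. auto. Qed.

Lemma Cmod_minus_self z : Cmod (z - z) = 0.
Proof. replace (z - z)%C with (RtoC 0) by ring. apply Cmod_0. Qed.

Lemma Cinv_conj_Cmod (z : C) : z <> 0 -> (Cconj (/ z) = RtoC (/ (Cmod z ^ 2)) * z)%C.
Proof.
  intros Hz. assert (0 < Cmod z) by now apply Cmod_pos.
  rewrite RtoC_inv by (apply pow_nonzero; lra). rewrite Cmod2_conj.
  rewrite Cinv_conj by auto.
  assert (Cconj z <> 0).
  { apply Cmod_neq_0. now rewrite Cmod_conj. }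
  field. auto.
Qed.

(** If a is outside the circle, z - a is zero-free and the previous lemma applies. If a is inside, z
    - a is replaced by a function with the same modulus on the circle whose zero is the reflection
    of a in the circle. *)
Lemma factor_log_means a z0 r : 0 < r -> r <> Cmod (a - z0) ->
  RInt (fun t => ln (Cmod (circ z0 r t - a))) 0 1 = ln (Rmax r (Cmod (a - z0))) /\
  CInt (fun t => RtoC (ln (Cmod (circ z0 r t - a))) * cis t)%C 0 1
  = (RtoC (- (r / (2 * Rmax r (Cmod (a - z0)) ^ 2))) * (a - z0))%C.
Proof.
  intros Hr Hne. set (A := Cmod (a - z0)) in *. assert (HA : 0 <= A) by apply Cmod_ge_0.
  destruct (Rle_lt_dec A r) as [Hlt|Hlt].
  - assert (HAr : A < r) by lra. rewrite Rmax_left by lra.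
    set (b := (a - z0)%C) in *.
    set (g := fun w => (RtoC r - Cconj b / RtoC r * (w - z0))%C).
    assert (Hr0 : RtoC r <> 0) by (apply RtoC_neq_0; lra).
    assert (Eg : forall t, Cmod (circ z0 r t - a) = Cmod (g (circ z0 r t))).
    { intros t. unfold g, circ.
      replace (RtoC r - Cconj b / RtoC r * (z0 + RtoC r * cis t - z0))%C
        with (RtoC r - Cconj b * cis t)%C by (field; auto).
      rewrite <- (Rmult_1_l (Cmod (RtoC r - _))), <- (Cmod_cis t), <- (Cmod_conj (RtoC r - _)%C).
      rewrite <- Cmod_mult. f_equal. rewrite Cminus_conj, Cmult_conj, Cconj_conj.
      replace (Cconj (RtoC r)) with (RtoC r) by (unfold Cconj, RtoC; simpl; f_equal; ring).
      transitivity (RtoC r * cis t - b * 1)%C; [unfold b; ring|].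
      replace (RtoC 1) with (cis t * Cconj (cis t))%C; [ring|].
      rewrite <- Cmod2_conj, Cmod_cis. f_equal. ring. }
    (* The reflected zero lies at distance r^2/A from z0 when A > 0, and A (2r - A) < r^2 because (r
       - A)^2 > 0; so g is zero-free on a disc of radius 2r - A > r. *)
    destruct (log_circle_means g z0 (2 * r - A) r (- (Cconj b / (RtoC r * RtoC r)))%C) as [M1 M2].
    + lra.
    + apply hol_minus; [apply hol_const|]. apply hol_mult; [apply hol_const|apply hol_shift].
    + intros w Hw E.
      assert (E2 : Cmod (RtoC r) = Cmod (Cconj b / RtoC r * (w - z0))).
      { f_equal. apply Ceq_minus. exact E. }
      rewrite Cmod_mult, Cmod_div, Cmod_conj, Cmod_R, Rabs_pos_eq in E2 by (auto; lra).
      fold A in E2.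
      assert (E3 : r * r = A * Cmod (w - z0)).
      { rewrite E2 at 1. field. lra. }
      assert (A * Cmod (w - z0) <= A * (2 * r - A)) by (apply Rmult_le_compat_l; lra).
      assert (0 < (r - A) * (r - A)) by (apply Rmult_lt_0_compat; lra). lra.
    + eapply cdiff_eq; [apply cdiff_minus; [apply cdiff_const|apply cdiff_scal, cdiff_shift]|].
      unfold g. field. auto.
    + split.
      * rewrite (RInt_ext _ (fun t => ln (Cmod (g (circ z0 r t))))) by (intros; now rewrite Eg).
        rewrite M1. unfold g. replace (RtoC r - Cconj b / RtoC r * (z0 - z0))%C with (RtoC r) by ring.
        now rewrite Cmod_R, Rabs_pos_eq by lra.
      * rewrite (CInt_ext _ (fun t => RtoC (ln (Cmod (g (circ z0 r t)))) * cis t)%C) by (try lra; intros; now rewrite Eg).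
        rewrite M2. rewrite Copp_conj, Cdiv_conj, Cconj_conj, Cmult_conj by now apply Cmult_neq_0.
        replace (Cconj (RtoC r)) with (RtoC r) by (unfold Cconj, RtoC; simpl; f_equal; ring).
        rewrite RtoC_opp, !RtoC_div, RtoC_mult, RtoC_pow.
        -- field. auto.
        -- apply Rgt_not_eq. apply Rmult_lt_0_compat; [lra|apply pow_lt; lra].
        -- lra.
  - rewrite Rmax_right by lra.
    assert (Hn : (z0 - a)%C <> 0).
    { apply Cmod_neq_0. rewrite Cmod_sub_sym. fold A. lra. }
    destruct (log_circle_means (fun w => w - a)%C z0 A r (/ (z0 - a))%C) as [M1 M2].
    + lra.
    + apply hol_shift.
    + intros w Hw E. apply Ceq_minus in E. subst w. fold A in Hw. lra.
    + eapply cdiff_eq; [apply cdiff_shift|]. field. auto.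
    + split.
      * rewrite M1, Cmod_sub_sym. reflexivity.
      * rewrite M2, Cinv_conj_Cmod, Cmod_sub_sym by auto. fold A.
        rewrite Cmult_assoc, <- RtoC_mult.
        replace (- (r / (2 * A ^ 2))) with (- (r / 2 * / A ^ 2)) by (field; lra).
        rewrite RtoC_opp. ring.
Qed.

(** Iterated division: in F = F w + (z - w) F1, the bounds of F1 on the two circles are 2M/r2 and
    2e/r1. Multiplying back by |z - w| <= r2/3 costs the large bound M only a factor 2/3 per step,
    while the small bound e collects a coefficient that depends on r1, r2 and n alone. *)
Lemma smallness_coefficient r1 r2 n : 0 < r1 < r2 -> exists A, 0 <= A /\
  forall (F : C -> C) w Q M e, r2 < Q -> hol w Q F ->
    (forall t, Cmod (F (circ w r2 t)) <= M) -> (forall t, Cmod (F (circ w r1 t)) <= e) ->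
    forall z, Cmod (z - w) <= r2 / 3 -> Cmod (F z) <= e * A + M * (2 / 3) ^ n.
Proof.
  intros Hr. induction n as [|n [A [HA IH]]].
  - exists 0. split; [lra|]. intros F w Q M e HQ HF HM He z Hz.
    simpl. rewrite Rmult_0_r, Rplus_0_l, Rmult_1_r.
    apply (maximum_principle F w Q r2); auto; lra.
  - exists (1 + 2 * r2 / (3 * r1) * A). split.
    { assert (0 <= 2 * r2 / (3 * r1) * A); [|lra]. apply Rmult_le_pos; auto.
      left. apply Rdiv_lt_0_compat; lra. }
    intros F w Q M e HQ HF HM He z Hz.
    assert (Hw : Cmod (F w) <= e).
    { apply (maximum_principle F w Q r1); auto; [lra|]. rewrite Cmod_minus_self. lra. }
    assert (HwM : Cmod (F w) <= M).
    { apply (maximum_principle F w Q r2); auto; [lra|]. rewrite Cmod_minus_self. lra. }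
    destruct (hol_divide (fun z => F z - F w)%C w Q w) as [F1 [HF1 E1]].
    { apply hol_minus; auto. apply hol_const. }
    { rewrite Cmod_minus_self. lra. }
    { ring. }
    assert (B : forall r m, 0 < r < Q -> Cmod (F w) <= m -> (forall t, Cmod (F (circ w r t)) <= m) ->
       forall t, Cmod (F1 (circ w r t)) <= 2 * m / r).
    { intros r m Hr' Hm Hc t. specialize (E1 (circ w r t)). rewrite circ_dist in E1 by lra.
      specialize (E1 ltac:(lra)). apply (f_equal Cmod) in E1. rewrite Cmod_mult, circ_dist in E1 by lra.
      pose proof (Cmod_minus_le (F (circ w r t)) (F w)). specialize (Hc t).
      apply (Rmult_le_reg_l r); [lra|]. rewrite <- E1.
      replace (r * (2 * m / r)) with (2 * m) by (field; lra). lra. }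
    specialize (IH F1 w Q (2 * M / r2) (2 * e / r1) HQ HF1 (B r2 M ltac:(lra) HwM HM)
      (B r1 e ltac:(lra) Hw He) z Hz).
    specialize (E1 z ltac:(lra)).
    replace (F z) with (F w + (z - w) * F1 z)%C by (rewrite <- E1; ring).
    eapply Rle_trans; [apply Cmod_triangle|]. rewrite Cmod_mult.
    assert (Cmod (z - w) * Cmod (F1 z)
       <= r2 / 3 * (2 * e / r1 * A + 2 * M / r2 * (2 / 3) ^ n))
      by (apply Rmult_le_compat; auto using Cmod_ge_0).
    assert (Ea : r2 / 3 * (2 * e / r1 * A + 2 * M / r2 * (2 / 3) ^ n)
       = e * (2 * r2 / (3 * r1) * A) + M * (2 / 3 * (2 / 3) ^ n)) by (field; lra).
    simpl pow. lra.
Qed.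

(** First n is chosen so that M (2/3)^n is at most e/2, then d so that the coefficient attached to
    this n contributes at most e/2. The resulting d serves all functions and all centres. *)
Lemma smallness_propagation r1 r2 M e : 0 < r1 < r2 -> 0 < M -> 0 < e ->
  exists d, 0 < d /\ forall (F : C -> C) w Q, r2 < Q -> hol w Q F ->
    (forall t, Cmod (F (circ w r2 t)) <= M) -> (forall t, Cmod (F (circ w r1 t)) <= d) ->
    forall z, Cmod (z - w) <= r2 / 3 -> Cmod (F z) <= e.
Proof.
  intros Hr HM He.
  destruct (pow_lt_1_zero (2 / 3)) with (y := e / 2 / M) as [n Hn].
  { rewrite Rabs_pos_eq; lra. }
  { repeat apply Rdiv_lt_0_compat; lra. }
  specialize (Hn n (le_n _)). rewrite Rabs_pos_eq in Hn by (apply pow_le; lra).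
  destruct (smallness_coefficient r1 r2 n Hr) as [A [HA K]].
  exists (e / 2 / (A + 1)). split; [repeat apply Rdiv_lt_0_compat; lra|].
  intros F w Q HQ HF H1 H2 z Hz.
  eapply Rle_trans; [apply (K F w Q M (e / 2 / (A + 1))); auto|].
  assert (X1 : e / 2 / (A + 1) * A <= e / 2 / (A + 1) * (A + 1)).
  { apply Rmult_le_compat_l; [|lra]. left; repeat apply Rdiv_lt_0_compat; lra. }
  replace (e / 2 / (A + 1) * (A + 1)) with (e / 2) in X1 by (field; lra).
  assert (X2 : M * (2 / 3) ^ n <= M * (e / 2 / M)) by (apply Rmult_le_compat_l; lra).
  replace (M * (e / 2 / M)) with (e / 2) in X2 by (field; lra). lra.
Qed.

(** * Dividing out the zeros of a bounded function *)

Definition prodl (l : list C) (z : C) : C := fold_right (fun a p => (z - a) * p)%C (RtoC 1) l.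

Lemma prodl_hol l z0 Q : hol z0 Q (prodl l).
Proof.
  induction l as [|a l IH]; simpl; [apply (hol_const z0 Q 1)|].
  apply (hol_mult z0 Q (fun z => z - a)%C (prodl l)); auto. apply hol_shift.
Qed.

Lemma prodl_le l z B : (forall a, In a l -> Cmod (z - a) <= B) -> Cmod (prodl l z) <= B ^ length l.
Proof.
  induction l as [|a l IH]; intros H; simpl.
  - rewrite Cmod_1. lra.
  - rewrite Cmod_mult. apply Rmult_le_compat; auto using Cmod_ge_0.
    + apply H; now left.
    + apply IH. intros; apply H; now right.
Qed.

Lemma prodl_ge l z B : 0 <= B -> (forall a, In a l -> B <= Cmod (z - a)) ->
  B ^ length l <= Cmod (prodl l z).
Proof.
  intros HB. induction l as [|a l IH]; intros H; simpl.
  - rewrite Cmod_1. lra.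
  - rewrite Cmod_mult. apply Rmult_le_compat; auto using pow_le.
    + apply H; now left.
    + apply IH. intros; apply H; now right.
Qed.

Lemma circle_far_from_zeros z0 rho t (a : C) : 0 < rho -> Cmod (a - z0) < rho ->
  2 * rho <= Cmod (circ z0 (3 * rho) t - a).
Proof.
  intros Hr Ha. pose proof (circ_sub_ge z0 (3 * rho) t a). lra.
Qed.

(** By the maximum principle it suffices to bound g on the circle of radius 3 rho, where every
    factor z - a has modulus at least 2 rho. *)
Lemma quotient_bound h g l z0 Q rho M : 0 < rho -> 3 * rho < Q -> hol z0 Q g ->
  (forall z, Cmod (z - z0) < Q -> Cmod (h z) <= M) ->
  (forall z, Cmod (z - z0) < Q -> h z = (prodl l z * g z)%C) ->
  (forall a, In a l -> Cmod (a - z0) < rho) ->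
  forall z, Cmod (z - z0) < 3 * rho -> Cmod (g z) <= M / (2 * rho) ^ length l.
Proof.
  intros Hr HQ Hg HM E Hl z Hz.
  apply (maximum_principle g z0 Q (3 * rho)); auto; [lra|]. intros t.
  assert (D : Cmod (circ z0 (3 * rho) t - z0) < Q) by (rewrite circ_dist; lra).
  specialize (HM _ D). rewrite (E _ D), Cmod_mult in HM.
  assert (P := prodl_ge l (circ z0 (3 * rho) t) (2 * rho) ltac:(lra)).
  specialize (P (fun a Ha => circle_far_from_zeros z0 rho t a Hr (Hl a Ha))).
  assert (Pp : 0 < (2 * rho) ^ length l) by (apply pow_lt; lra).
  apply (Rmult_le_reg_l ((2 * rho) ^ length l)); auto.
  replace ((2 * rho) ^ length l * (M / (2 * rho) ^ length l)) with M by (field; lra).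
  eapply Rle_trans; [|exact HM]. apply Rmult_le_compat_r; auto using Cmod_ge_0.
Qed.

(** Each extracted zero gains a factor 2 at the centre: it contributes at most rho to |h z0| but at
    least 2 rho to the denominator bounding g. Hence d <= M / 2^n for n zeros, and the extraction
    stops with n <= K. *)
Lemma zero_factorization h z0 Q rho M d K : 0 < rho -> 3 * rho < Q -> hol z0 Q h ->
  (forall z, Cmod (z - z0) < Q -> Cmod (h z) <= M) -> d <= Cmod (h z0) -> M < d * 2 ^ K ->
  exists l g, (length l <= K)%nat /\ hol z0 Q g /\
    (forall z, Cmod (z - z0) < Q -> h z = (prodl l z * g z)%C) /\
    (forall a, In a l -> Cmod (a - z0) < rho /\ h a = 0) /\
    (forall z, Cmod (z - z0) < rho -> g z <> 0).
Proof.
  intros Hr HQ Hh HM Hd HK.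
  assert (C0r : Cmod (z0 - z0) < rho) by (rewrite Cmod_minus_self; lra).
  assert (Len : forall l g, hol z0 Q g ->
    (forall z, Cmod (z - z0) < Q -> h z = (prodl l z * g z)%C) ->
    (forall a, In a l -> Cmod (a - z0) < rho /\ h a = 0) -> (length l <= K)%nat).
  { intros l g Hg E Hl. apply Nat.nlt_ge. intros Hlt.
    assert (B := quotient_bound h g l z0 Q rho M Hr HQ Hg HM E (fun a Ha => proj1 (Hl a Ha)) z0 ltac:(lra)).
    assert (B2 := prodl_le l z0 rho).
    specialize (B2 ltac:(intros a Ha; rewrite Cmod_sub_sym; left; now apply Hl)).
    specialize (E z0 ltac:(lra)). rewrite E, Cmod_mult in Hd.
    assert (Hp : 0 < rho ^ length l) by (apply pow_lt; lra).
    assert (H2 : 0 < 2 ^ length l) by (apply pow_lt; lra).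
    assert (B3 : Cmod (prodl l z0) * Cmod (g z0) <= rho ^ length l * (M / (2 * rho) ^ length l))
      by (apply Rmult_le_compat; auto using Cmod_ge_0).
    rewrite Rpow_mult_distr in B3.
    replace (rho ^ length l * (M / (2 ^ length l * rho ^ length l))) with (M / 2 ^ length l) in B3
      by (field; lra).
    assert (B4 : d * 2 ^ length l <= M).
    { apply (Rmult_le_compat_r (2 ^ length l)) in B3; [|lra].
      replace (M / 2 ^ length l * 2 ^ length l) with M in B3 by (field; lra).
      assert (d * 2 ^ length l <= Cmod (prodl l z0) * Cmod (g z0) * 2 ^ length l)
        by (apply Rmult_le_compat_r; lra). lra. }
    assert (M0 : 0 <= M) by (eapply Rle_trans; [apply Cmod_ge_0|apply (HM z0); lra]).
    assert (HKp : 0 < 2 ^ K) by (apply pow_lt; lra).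
    assert (Hd0 : 0 < d) by nra.
    assert (2 ^ K <= 2 ^ length l) by (apply Rle_pow; [lra|lia]).
    nra. }
  (* After n attempts either the quotient is already zero-free on the small disc or exactly n zeros
     have been extracted. With n = K + 1 the second case contradicts [Len]. *)
  assert (Main : forall n, exists l g, hol z0 Q g /\
    (forall z, Cmod (z - z0) < Q -> h z = (prodl l z * g z)%C) /\
    (forall a, In a l -> Cmod (a - z0) < rho /\ h a = 0) /\
    ((forall z, Cmod (z - z0) < rho -> g z <> 0) \/ length l = n)).
  { induction n as [|n [l [g [Hg [E [Hl Hor]]]]]].
    - exists nil, h. split; auto. split; [intros; simpl; ring|]. split; [intros a []|now right].
    - destruct Hor as [Hz|Hn]; [exists l, g; auto|].
      destruct (classic (exists a, Cmod (a - z0) < rho /\ g a = 0)) as [[a [Ha Hga]]|Hno].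
      + destruct (hol_divide g z0 Q a Hg ltac:(lra) Hga) as [g1 [Hg1 E1]].
        exists (a :: l), g1. split; auto. split; [|split].
        * intros z Hz. simpl. rewrite E, E1 by auto. fold (prodl l z). ring.
        * intros b [<-|Hb]; [split; auto|now apply Hl].
          rewrite E by lra. rewrite Hga. ring.
        * right. simpl. now rewrite Hn.
      + exists l, g. repeat split; auto; try now apply Hl. left. intros z Hz Hgz.
        apply Hno. now exists z. }
  destruct (Main (S K)) as [l [g [Hg [E [Hl Hor]]]]].
  assert (L := Len l g Hg E Hl).
  exists l, g. repeat split; auto; try now apply Hl.
  destruct Hor; auto. lia.
Qed.

(** Collects the factors at p to read off the order of the zero there; m = 0 occurs when p is not in
    l. *)
Lemma prodl_order l p : exists m l', ~ In p l' /\
  (forall a, In a l' -> In a l) /\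
  forall z, prodl l z = (Complex.Cpow (z - p) m * prodl l' z)%C.
Proof.
  induction l as [|a l [m [l' [H1 [H2 H3]]]]].
  - exists O, nil. split; [intros []|]. split; auto. intros z. simpl. ring.
  - destruct (Ceq_dec a p) as [->|Ha].
    + exists (S m), l'. split; auto. split; [intros; right; auto|].
      intros z. simpl. fold (prodl l z). rewrite H3. ring.
    + exists m, (a :: l'). split; [intros [|]; auto|]. split.
      * intros b [<-|Hb]; [now left|right; auto].
      * intros z. simpl. fold (prodl l z) (prodl l' z). rewrite H3. ring.
Qed.

Lemma prodl_neq_0 l z : ~ In z l -> prodl l z <> 0.
Proof.
  induction l as [|a l IH]; intros H; simpl; [apply C1_nz|].
  apply Cmult_neq_0; [|apply IH; intros Hi; apply H; now right].
  apply Cminus_eq_contra. intros ->. apply H. now left.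
Qed.

(** The Borel-Carathéodory argument for P = log(g / g z0): Re P is bounded above, so P / (2q - P)
    has modulus at most 1 and vanishes at z0. The Schwarz lemma makes it at most 2/3 on the half
    disc, and solving for P gives |P| <= 4q. *)
Lemma harnack g z0 rho A B z : 0 < rho -> hol z0 rho g ->
  (forall z, Cmod (z - z0) < rho -> g z <> 0) ->
  (forall z, Cmod (z - z0) < rho -> Cmod (g z) <= A) -> 0 < B -> B <= Cmod (g z0) ->
  Cmod (z - z0) < rho / 2 -> Rabs (ln (Cmod (g z))) <= Rabs (ln A) + Rabs (ln B) + 4 * (ln A - ln B + 1).
Proof.
  intros Hr Hg Hnz HA HB HBg Hz.
  assert (C0r : Cmod (z0 - z0) < rho / 2) by (rewrite Cmod_minus_self; lra).
  destruct (hol_log g z0 rho (7 / 8 * rho)) as [P [HP [HP0 [HPl _]]]]; auto; [lra|].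
  assert (HAp : 0 < A) by (specialize (HA z0 ltac:(lra)); lra).
  (* The summand 1 keeps q positive, so that the denominator 2q - P has positive real part even if A
     = B. *)
  set (q := ln A - ln B + 1).
  assert (L0 : ln B <= ln (Cmod (g z0)) <= ln A).
  { split; apply ln_le; auto; try lra. apply HA. lra. }
  assert (Hq : 1 <= q) by (unfold q; lra).
  assert (ReP : forall w, Cmod (w - z0) < 7 / 8 * rho -> fst (P w) <= q - 1).
  { intros w Hw. specialize (HPl w Hw). unfold q.
    assert (ln (Cmod (g w)) <= ln A).
    { apply ln_le; [apply Cmod_pos, Hnz; lra|apply HA; lra]. }
    lra. }
  set (D := fun w => (RtoC (2 * q) - P w)%C).
  assert (Dn : forall w, Cmod (w - z0) < 7 / 8 * rho -> D w <> 0).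
  { intros w Hw E. specialize (ReP w Hw). apply (f_equal fst) in E. simpl in E. lra. }
  assert (DP : forall w, Cmod (w - z0) < 7 / 8 * rho -> Cmod (P w) <= Cmod (D w)).
  { intros w Hw. specialize (ReP w Hw). unfold Cmod, D. apply sqrt_le_1_alt. simpl. nra. }
  assert (Hphi : hol z0 (7 / 8 * rho) (fun w => P w / D w)%C).
  { apply hol_div; auto. apply hol_minus; auto. apply hol_const. }
  destruct (hol_divide _ z0 (7 / 8 * rho) z0 Hphi) as [f1 [Hf1 E1]]; [lra| |].
  { simpl. rewrite HP0. unfold Cdiv. ring. }
  (* The Schwarz lemma is applied on the circle of radius s; the ratio (rho/2) / s is the 2/3
     below. *)
  set (s := 3 / 4 * rho).
  assert (B1 : forall w, Cmod (w - z0) < s -> Cmod (f1 w) <= / s).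
  { intros w Hw. apply (maximum_principle f1 z0 (7 / 8 * rho) s); auto; [unfold s; lra|].
    intros t. assert (Hd : Cmod (circ z0 s t - z0) = s) by (apply circ_dist; unfold s; lra).
    assert (Hd2 : Cmod (circ z0 s t - z0) < 7 / 8 * rho) by (rewrite Hd; unfold s; lra).
    specialize (E1 _ Hd2). specialize (DP _ Hd2). specialize (Dn _ Hd2).
    apply (f_equal Cmod) in E1. rewrite Cmod_mult, Hd, Cmod_div in E1 by auto.
    assert (Hs : 0 < s) by (unfold s; lra).
    apply (Rmult_le_reg_l s); auto. rewrite <- E1, Rinv_r by lra.
    assert (0 < Cmod (D (circ z0 s t))) by now apply Cmod_pos.
    apply (Rmult_le_reg_r (Cmod (D (circ z0 s t)))); auto.
    unfold Rdiv. rewrite Rmult_assoc, Rinv_l by lra. lra. }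
  set (phi := (P z / D z)%C).
  assert (Hz2 : Cmod (z - z0) < 7 / 8 * rho) by lra.
  assert (Bphi : Cmod phi <= 2 / 3).
  { unfold phi. rewrite E1 by auto. rewrite Cmod_mult.
    specialize (B1 z ltac:(unfold s; lra)).
    apply Rle_trans with (rho / 2 * / s).
    - apply Rmult_le_compat; auto using Cmod_ge_0. lra.
    - right. unfold s. field. lra. }
  assert (BP : Cmod (P z) <= 4 * q).
  { assert (E : P z = (RtoC (2 * q) * phi - P z * phi)%C).
    { unfold phi. specialize (Dn z Hz2). transitivity (D z * (P z / D z))%C; [field; auto|unfold D; ring]. }
    pose proof (Cmod_minus_le (RtoC (2 * q) * phi)%C (P z * phi)%C) as T. rewrite <- E in T.
    rewrite !Cmod_mult, Cmod_R, Rabs_pos_eq in T by lra.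
    pose proof (Cmod_ge_0 (P z)).
    assert (2 * q * Cmod phi <= 2 * q * (2 / 3)) by (apply Rmult_le_compat_l; lra).
    assert (Cmod (P z) * Cmod phi <= Cmod (P z) * (2 / 3)) by (apply Rmult_le_compat_l; lra). lra. }
  rewrite HPl by auto.
  eapply Rle_trans; [apply Rabs_triang|].
  pose proof (Rabs_fst_le_Cmod (P z)). fold q.
  assert (Rabs (ln (Cmod (g z0))) <= Rabs (ln A) + Rabs (ln B)).
  { pose proof (Rle_abs (ln A)). pose proof (Rabs_pos (ln A)). pose proof (Rabs_pos (ln B)).
    pose proof (Rle_abs (- ln B)) as X. rewrite Rabs_Ropp in X. apply Rabs_le. lra. }
  lra.
Qed.

Definition sumR {T} (F : T -> R) (l : list T) : R := fold_right Rplus 0 (map F l).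

Lemma ln_prodl l z : ~ In z l -> ln (Cmod (prodl l z)) = sumR (fun p => ln (Cmod (z - p))) l.
Proof.
  unfold sumR. induction l as [|a l IH]; intros H; simpl.
  - rewrite Cmod_1. apply ln_1.
  - fold (prodl l z). rewrite Cmod_mult, ln_mult.
    + rewrite IH; auto. intros Hi; apply H; now right.
    + apply Cmod_pos, Cminus_eq_contra. intros ->. apply H. now left.
    + apply Cmod_pos, prodl_neq_0. intros Hi; apply H; now right.
Qed.

Lemma Rabs_sumR {T} (F : T -> R) l : Rabs (sumR F l) <= sumR (fun x => Rabs (F x)) l.
Proof.
  unfold sumR. induction l as [|a l IH]; simpl; [rewrite Rabs_R0; lra|].
  eapply Rle_trans; [apply Rabs_triang|]. lra.
Qed.

Lemma pow_bounds x K n : 0 < x -> (n <= K)%nat -> x ^ n <= (1 + x) ^ K.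
Proof.
  intros Hx Hn. apply Rle_trans with ((1 + x) ^ n).
  - apply pow_incr. lra.
  - apply Rle_pow; [lra|auto].
Qed.

(** Combines the factorization with Harnack's estimate for the zero-free quotient. K and M' depend
    only on rho, M and d, which is what makes the later estimates uniform in the centre. *)
Lemma local_log_bound rho M d : 0 < rho -> 0 < M -> 0 < d ->
  exists K M', forall h z0 Q, 3 * rho < Q -> hol z0 Q h ->
    (forall z, Cmod (z - z0) < Q -> Cmod (h z) <= M) -> d <= Cmod (h z0) ->
    exists l, (length l <= K)%nat /\ (forall a, In a l -> Cmod (a - z0) < rho /\ h a = 0) /\
      (forall z, Cmod (z - z0) < rho -> h z = 0 -> In z l /\
         exists m g, (m > 0)%nat /\ hol z0 Q g /\ g z <> 0 /\
           forall w, Cmod (w - z0) < Q -> h w = (Complex.Cpow (w - z) m * g w)%C) /\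
      forall z, Cmod (z - z0) < rho / 2 -> h z <> 0 ->
        Rabs (ln (Cmod (h z))) <= M' + sumR (fun p => Rabs (ln (Cmod (z - p)))) l.
Proof.
  intros Hr HM Hd.
  destruct (Pow_x_infinity 2) with (b := M / d + 1) as [K HK].
  { rewrite Rabs_pos_eq; lra. }
  specialize (HK K (le_n _)). rewrite Rabs_pos_eq in HK by (apply pow_le; lra).
  assert (HKd : M < d * 2 ^ K).
  { apply Rlt_le_trans with (d * (M / d + 1)).
    - replace (d * (M / d + 1)) with (M + d) by (field; lra). lra.
    - apply Rmult_le_compat_l; lra. }
  (* A bounds the quotient from above and B bounds it from below at the centre. The bases are
     increased by 1 so that the powers with exponent at most K are dominated by the K-th power. *)
  set (A := M * (1 + / (2 * rho)) ^ K). set (B := d / (1 + rho) ^ K).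
  assert (Hp1 : 0 < (1 + rho) ^ K) by (apply pow_lt; lra).
  exists K, (Rabs (ln A) + Rabs (ln B) + 4 * (ln A - ln B + 1)).
  intros h z0 Q HQ Hh HMh Hdh.
  destruct (zero_factorization h z0 Q rho M d K Hr HQ Hh HMh Hdh HKd) as [l [g [Hlen [Hg [E [Hl Hnz]]]]]].
  exists l. split; auto. split; auto. split.
  - intros z Hz Hhz. assert (Hin : In z l).
    { destruct (in_dec Ceq_dec z l) as [|Hn]; auto. exfalso.
      rewrite E in Hhz by lra. revert Hhz. apply Cmult_neq_0; [now apply prodl_neq_0|auto]. }
    split; auto. destruct (prodl_order l z) as [m [l' [H1 [H2 H3]]]].
    assert (Hgz : (prodl l' z * g z)%C <> 0) by (apply Cmult_neq_0; [now apply prodl_neq_0|auto]).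
    exists m, (fun w => prodl l' w * g w)%C. split; [|split; [|split; auto]].
    + destruct m; [|lia]. exfalso. rewrite E, H3 in Hhz by lra. simpl in Hhz.
      apply Hgz. rewrite <- Hhz. ring.
    + apply hol_mult; auto. apply prodl_hol.
    + intros w Hw. rewrite E, H3 by auto. ring.
  - intros z Hz Hhz.
    assert (Hnin : ~ In z l) by (intros Hi; apply Hhz, Hl, Hi).
    rewrite E, Cmod_mult, ln_mult, ln_prodl; auto; try lra.
    2:{ apply Cmod_pos, prodl_neq_0; auto. }
    2:{ apply Cmod_pos, Hnz; lra. }
    eapply Rle_trans; [apply Rabs_triang|]. rewrite Rplus_comm. apply Rplus_le_compat; [|apply Rabs_sumR].
    apply (harnack g z0 rho A B); auto.
    + apply hol_sub with (2 := Hg). rewrite Cmod_minus_self. lra.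
    + intros w Hw. eapply Rle_trans;
        [apply (quotient_bound h g l z0 Q rho M); auto; [intros; now apply Hl|lra]|].
      unfold A, Rdiv. rewrite <- pow_inv. apply Rmult_le_compat_l; [lra|].
      apply pow_bounds; auto. apply Rinv_0_lt_compat. lra.
    + unfold B. now apply Rdiv_lt_0_compat.
    + assert (C0r : Cmod (z0 - z0) < rho) by (rewrite Cmod_minus_self; lra).
      specialize (E z0 ltac:(lra)). rewrite E, Cmod_mult in Hdh.
      assert (B2 := prodl_le l z0 rho ltac:(intros a Ha; rewrite Cmod_sub_sym; left; now apply Hl)).
      assert (B3 := pow_bounds rho K (length l) Hr Hlen).
      unfold B. apply (Rmult_le_reg_l ((1 + rho) ^ K)); auto.
      replace ((1 + rho) ^ K * (d / (1 + rho) ^ K)) with d by (field; lra).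
      eapply Rle_trans; [exact Hdh|]. apply Rmult_le_compat_r; [apply Cmod_ge_0|lra].
Qed.

(** * Local structure of functions in the class N1 *)

(** The third coordinate under stereographic projection. It is Lipschitz for [rhoS] and changes sign
    under w -> 1/w, so a real inequality decides which of f and 1/f is bounded. *)
Definition height (p : Sphere) : R :=
  match p with None => 1 | Some v => (Cmod v ^ 2 - 1) / (Cmod v ^ 2 + 1) end.

Lemma height_le_rhoS_finite (z w : C) :
  Rabs (height (Some z) - height (Some w)) <= rhoS (Some z) (Some w).
Proof.
  unfold height, rhoS. change (Cnorm (Csub z w)) with (Cmod (z - w)).
  change (Cnorm z) with (Cmod z). change (Cnorm w) with (Cmod w).
  pose proof (Cmod_ge_0 z) as Pz. pose proof (Cmod_ge_0 w) as Pw.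
  assert (D : Rabs (Cmod z - Cmod w) <= Cmod (z - w)).
  { pose proof (Cmod_le_dist z w). pose proof (Cmod_le_dist w z) as T.
    rewrite Cmod_sub_sym in T. apply Rabs_le. lra. }
  set (a := Cmod z) in *. set (b := Cmod w) in *.
  set (X := sqrt (1 + a ^ 2)). set (Y := sqrt (1 + b ^ 2)).
  assert (X2 : X * X = 1 + a ^ 2) by (apply sqrt_sqrt; nra).
  assert (Y2 : Y * Y = 1 + b ^ 2) by (apply sqrt_sqrt; nra).
  assert (PX : 0 < X) by (apply sqrt_lt_R0; nra).
  assert (PY : 0 < Y) by (apply sqrt_lt_R0; nra).
  (* (1 + a^2)(1 + b^2) - (a + b)^2 = (1 - ab)^2. *)
  assert (S : a + b <= X * Y).
  { apply Rsqr_incr_0; [|lra|apply Rmult_le_pos; lra]. unfold Rsqr.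
    replace (X * Y * (X * Y)) with ((X * X) * (Y * Y)) by ring. rewrite X2, Y2.
    pose proof (Rle_0_sqr (1 - a * b)) as Q. unfold Rsqr in Q. nra. }
  replace ((a ^ 2 - 1) / (a ^ 2 + 1) - (b ^ 2 - 1) / (b ^ 2 + 1))
    with (2 * ((a - b) * (a + b)) * / (X * Y * (X * Y))).
  2:{ replace (X * Y * (X * Y)) with ((X * X) * (Y * Y)) by ring. rewrite X2, Y2.
      field. split; nra. }
  assert (PXY : 0 < X * Y) by now apply Rmult_lt_0_compat.
  rewrite !Rabs_mult, (Rabs_pos_eq 2), (Rabs_pos_eq (a + b)), (Rabs_pos_eq (/ (X * Y * (X * Y)))) by
    (try lra; left; apply Rinv_0_lt_compat; now apply Rmult_lt_0_compat).
  unfold Rdiv. rewrite Rinv_mult.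
  assert (Q : Rabs (a - b) * ((a + b) * / (X * Y)) <= Cmod (z - w) * 1).
  { apply Rmult_le_compat; auto using Rabs_pos.
    - apply Rmult_le_pos; [lra|]. left. now apply Rinv_0_lt_compat.
    - apply (Rmult_le_reg_r (X * Y)); auto. rewrite Rmult_assoc, Rinv_l by lra. lra. }
  replace (2 * (Rabs (a - b) * (a + b)) * (/ (X * Y) * / (X * Y)))
    with (2 * (Rabs (a - b) * ((a + b) * / (X * Y))) * / (X * Y)) by ring.
  apply Rmult_le_compat_r; [left; now apply Rinv_0_lt_compat|]. lra.
Qed.

Lemma height_le_rhoS_infinity (z : C) : Rabs (height (Some z) - 1) <= 2 / sqrt (1 + Cmod z ^ 2).
Proof.
  unfold height. pose proof (Cmod_ge_0 z) as Pz. set (a := Cmod z) in *.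
  set (X := sqrt (1 + a ^ 2)).
  assert (X2 : X * X = 1 + a ^ 2) by (apply sqrt_sqrt; nra).
  assert (PX : 0 < X) by (apply sqrt_lt_R0; nra).
  assert (X1 : 1 <= X) by nra.
  replace ((a ^ 2 - 1) / (a ^ 2 + 1) - 1) with (- (2 * / (X * X))).
  2:{ rewrite X2. field. nra. }
  rewrite Rabs_Ropp, Rabs_pos_eq.
  - unfold Rdiv. apply Rmult_le_compat_l; [lra|]. apply Rinv_le_contravar; nra.
  - apply Rmult_le_pos; [lra|]. left. apply Rinv_0_lt_compat. now apply Rmult_lt_0_compat.
Qed.

Lemma height_le_rhoS p q : Rabs (height p - height q) <= rhoS p q.
Proof.
  destruct p as [z|], q as [w|].
  - apply height_le_rhoS_finite.
  - apply height_le_rhoS_infinity.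
  - rewrite Rabs_minus_sym. apply height_le_rhoS_infinity.
  - simpl. rewrite Rminus_diag, Rabs_R0. lra.
Qed.

Lemma recip_0 : recip (RtoC 0) = None.
Proof. unfold recip. destruct (Ceq_dec (RtoC 0) C0) as [|N]; auto. now destruct N. Qed.

Lemma recip_neq (v : C) : v <> 0 -> recip v = Some (/ v)%C.
Proof. intros H. unfold recip. destruct (Ceq_dec v C0) as [E|]; [now destruct H|reflexivity]. Qed.

Lemma Cinv_neq_0 (v : C) : v <> 0 -> (/ v)%C <> 0.
Proof.
  intros H E. apply C1_nz. rewrite <- (Cinv_r v H), E. ring.
Qed.

Lemma height_recip v : height (recip v) = - height (Some v).
Proof.
  destruct (Ceq_dec v (RtoC 0)) as [->|H].
  - rewrite recip_0. simpl. rewrite Cmod_0. field.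
  - rewrite recip_neq by auto. simpl. rewrite Cmod_inv by auto.
    assert (0 < Cmod v) by now apply Cmod_pos. field.
    split; [|lra]. nra.
Qed.

Lemma height_continuous_at (g : C -> C) z L : cdiff g z L -> forall eps, 0 < eps ->
  exists d, 0 < d /\ forall w, Cmod (w - z) < d ->
    Rabs (height (Some (g w)) - height (Some (g z))) < eps.
Proof.
  intros H eps He. destruct (cdiff_continuous _ _ _ H (eps / 2)) as [d [Hd K]]; [lra|].
  exists d. split; auto. intros w Hw. specialize (K w Hw).
  eapply Rle_lt_trans; [apply height_le_rhoS_finite|].
  unfold rhoS. change (Cnorm (Csub (g w) (g z))) with (Cmod (g w - g z)).
  set (X := sqrt _). set (Y := sqrt _).
  assert (O : forall x, 1 <= sqrt (1 + x ^ 2)).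
  { intros x. rewrite <- sqrt_1 at 1. apply sqrt_le_1_alt. nra. }
  assert (HX : 1 <= X) by apply O. assert (HY : 1 <= Y) by apply O.
  pose proof (Cmod_ge_0 (g w - g z)%C).
  assert (HXY : 1 <= X * Y) by nra.
  apply (Rmult_lt_reg_r (X * Y)); [lra|]. unfold Rdiv. rewrite Rmult_assoc, Rinv_l by lra.
  nra.
Qed.

Lemma height_meromorphic_continuous f z : meromorphic f -> forall eps, 0 < eps ->
  exists d, 0 < d /\ forall w, Cmod (w - z) < d -> Rabs (height (f w) - height (f z)) < eps.
Proof.
  intros Hf eps He. destruct (Hf z) as [r [Hr [g [Hg Hor]]]].
  assert (Zr : Cmod (z - z) < r) by (rewrite Cmod_minus_self; lra).
  destruct (Hg z Zr) as [L HL].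
  destruct (height_continuous_at g z L HL eps He) as [d [Hd K]].
  exists (Rmin d r). split; [apply Rmin_pos; lra|]. intros w Hw.
  rmin d r.
  specialize (K w ltac:(lra)).
  destruct Hor as [E|E]; rewrite (E w), (E z) by (auto; change (Cmod (w - z) < r); lra); auto.
  rewrite !height_recip. replace (- height (Some (g w)) - - height (Some (g z)))
    with (- (height (Some (g w)) - height (Some (g z)))) by ring. now rewrite Rabs_Ropp.
Qed.

Lemma nat_choice {A : Type} (P : nat -> A -> Prop) : (forall n, exists a, P n a) ->
  exists h : nat -> A, forall n, P n (h n).
Proof.
  intros H. exists (fun n => proj1_sig (constructive_indefinite_description _ (H n))).
  intros n. apply proj2_sig.
Qed.

Lemma increasing_ge (phi : nat -> nat) : (forall n, (phi n < phi (S n))%nat) -> forall n, (n <= phi n)%nat.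
Proof. intros H n. induction n; [lia|]. specialize (H n). lia. Qed.

Lemma inv_INR_small d : 0 < d -> exists N, forall n, (N <= n)%nat -> / (INR n + 1) < d.
Proof.
  intros Hd. destruct (archimed_cor1 d Hd) as [N [H1 H2]]. exists N. intros n Hn.
  eapply Rle_lt_trans; [|exact H1]. apply Rinv_le_contravar.
  - apply lt_0_INR. lia.
  - apply le_INR in Hn. lra.
Qed.

(** Otherwise there are pairs of points ever closer together at which the heights differ by 1/2.
    Along a subsequence the translates to these points are Cauchy, so they can be compared with one
    fixed translate, where f is continuous. *)
Lemma normal_height_uniformly_continuous f : normal_fn f ->
  exists eta, 0 < eta /\ forall z w, Cmod (z - w) < eta -> Rabs (height (f z) - height (f w)) < 1 / 2.
Proof.
  intros [Hm Hn]. apply NNPP. intros Hno.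
  assert (Hseq : forall n : nat, exists p : C * C, Cmod (fst p - snd p) < / (INR n + 1) /\
    1 / 2 <= Rabs (height (f (fst p)) - height (f (snd p)))).
  { intros n. apply NNPP. intros Hp. apply Hno. exists (/ (INR n + 1)). split.
    - apply Rinv_0_lt_compat. pose proof (pos_INR n). lra.
    - intros z w Hzw. apply Rnot_le_lt. intros Hle. apply Hp. now exists (z, w). }
  destruct (nat_choice _ Hseq) as [p Hp]. clear Hseq Hno.
  destruct (Hn (fun n => snd (p n))) as [phi [Hphi Hc]].
  (* Three comparisons follow, each with error 1/8: to the fixed translate, within it, and back.
     Their sum stays below 1/2. *)
  destruct (Hc 1 (1 / 8) ltac:(lra)) as [N HN]. clear Hc.
  set (c := snd (p (phi N))).
  destruct (height_meromorphic_continuous f c Hm (1 / 8) ltac:(lra)) as [d [Hd K]].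
  destruct (inv_INR_small (Rmin d 1) (Rmin_pos _ _ Hd Rlt_0_1)) as [N2 HN2].
  set (n := max N N2).
  assert (Hphin := increasing_ge phi Hphi n).
  destruct (Hp (phi n)) as [P1 P2]. specialize (HN2 (phi n) ltac:(lia)).
  rmin d 1.
  set (a := fst (p (phi n))) in *. set (b := snd (p (phi n))) in *.
  set (z := (a - b)%C).
  assert (Hz : Cmod z < d /\ Cmod z <= 1) by (unfold z; lra).
  assert (A1 : Rabs (height (f a) - height (f (z + c)%C)) < 1 / 8).
  { eapply Rle_lt_trans; [apply height_le_rhoS|].
    replace a with (z + b)%C by (unfold z; ring).
    apply (HN n N); try lia. apply Hz. }
  assert (A2 : Rabs (height (f (z + c)%C) - height (f c)) < 1 / 8).
  { apply K. replace (z + c - c)%C with z by ring. apply Hz. }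
  assert (A3 : Rabs (height (f c) - height (f b)) < 1 / 8).
  { eapply Rle_lt_trans; [apply height_le_rhoS|].
    replace c with (0 + c)%C by ring. replace b with (0 + b)%C by ring.
    apply (HN N n); try lia. change (Cmod 0 <= 1). rewrite Cmod_0. lra. }
  apply Rabs_def2 in A1. apply Rabs_def2 in A2. apply Rabs_def2 in A3.
  assert (Rabs (height (f a) - height (f b)) < 1 / 2) by (apply Rabs_def1; lra).
  lra.
Qed.

(** * The two charts of the sphere and the class N1 *)

Definition rep (b : bool) (v : C) : Sphere := if b then recip v else Some v.

(** The value at infinity is a default; as a value of f, [val] is evaluated in estimates only away
    from the poles. *)
Definition val (p : Sphere) : C := match p with Some v => v | None => RtoC 0 end.

Definition sinv (p : Sphere) : Sphere := match p with Some v => recip v | None => Some (RtoC 0) end.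

Lemma Cinv_inv (v : C) : v <> 0 -> (/ / v)%C = v.
Proof. intros H. field. auto. Qed.

Lemma val_sinv_recip v : val (sinv (recip v)) = v.
Proof.
  destruct (Ceq_dec v (RtoC 0)) as [->|H].
  - now rewrite recip_0.
  - rewrite (recip_neq v) by auto. simpl. rewrite recip_neq by now apply Cinv_neq_0.
    simpl. now apply Cinv_inv.
Qed.

Lemma rep_inj b u v : rep b u = rep b v -> u = v.
Proof.
  destruct b; simpl; intros E.
  - rewrite <- (val_sinv_recip u), <- (val_sinv_recip v). now rewrite E.
  - now injection E.
Qed.

Lemma rep_opposite b u v : rep b u = rep (negb b) v -> (u * v)%C = 1.
Proof.
  assert (K : forall u v, recip u = Some v -> (u * v)%C = 1).
  { clear. intros u v E. destruct (Ceq_dec u (RtoC 0)) as [->|H].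
    - rewrite recip_0 in E. discriminate.
    - rewrite recip_neq in E by auto. injection E as <-. field. auto. }
  destruct b; simpl; intros E.
  - now apply K.
  - rewrite Cmult_comm. now apply K.
Qed.

Lemma height_lt_half v : height (Some v) < 1 / 2 -> Cmod v <= 2.
Proof.
  unfold height. intros H. pose proof (Cmod_ge_0 v). set (a := Cmod v) in *.
  apply Rnot_lt_le. intros Hlt.
  assert (1 / 2 <= (a ^ 2 - 1) / (a ^ 2 + 1)); [|lra].
  apply (Rmult_le_reg_r (a ^ 2 + 1)); [nra|].
  unfold Rdiv at 2. rewrite Rmult_assoc, Rinv_l by nra. nra.
Qed.

Lemma cdiff_neq_near (g : C -> C) z L : cdiff g z L -> g z <> 0 -> exists d, 0 < d /\
  forall w, Cmod (w - z) < d -> g w <> 0.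
Proof.
  intros H Hz. assert (P : 0 < Cmod (g z)) by now apply Cmod_pos.
  destruct (cdiff_continuous _ _ _ H _ P) as [d [Hd K]].
  exists d. split; auto. intros w Hw E. specialize (K w Hw). rewrite E in K.
  replace (0 - g z)%C with (- g z)%C in K by ring. rewrite Cmod_opp in K. lra.
Qed.

Lemma meromorphic_val_cdiff f z : meromorphic f -> f z <> None ->
  exists L, cdiff (fun w => val (f w)) z L.
Proof.
  intros Hf Hz. destruct (Hf z) as [r [Hr [g [Hg Hor]]]].
  assert (Zr : Cmod (z - z) < r) by (rewrite Cmod_minus_self; lra).
  destruct (Hg z Zr) as [L HL].
  destruct Hor as [E|E].
  - exists L. apply (cdiff_ext_near g _ z L r); auto. intros w Hw. now rewrite (E w Hw).
  - assert (Hn : g z <> RtoC 0).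
    { intros Z. apply Hz. rewrite (E z Zr), Z. apply recip_0. }
    destruct (cdiff_neq_near g z L HL Hn) as [d [Hd K]].
    eexists. apply (cdiff_ext_near (fun w => / g w)%C _ z _ (Rmin d r)).
    + apply Rmin_pos; lra.
    + intros w Hw. rmin d r.
      rewrite (E w) by (change (Cmod (w - z) < r); lra).
      rewrite recip_neq by (apply K; lra). reflexivity.
    + apply cdiff_inv; [exact Hn|exact HL].
Qed.

Lemma meromorphic_val_sinv_cdiff f z : meromorphic f -> f z <> Some (RtoC 0) ->
  exists L, cdiff (fun w => val (sinv (f w))) z L.
Proof.
  intros Hf Hz. destruct (Hf z) as [r [Hr [g [Hg Hor]]]].
  assert (Zr : Cmod (z - z) < r) by (rewrite Cmod_minus_self; lra).
  destruct (Hg z Zr) as [L HL].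
  destruct Hor as [E|E].
  - assert (Hn : g z <> RtoC 0).
    { intros Z. apply Hz. now rewrite (E z Zr), Z. }
    destruct (cdiff_neq_near g z L HL Hn) as [d [Hd K]].
    eexists. apply (cdiff_ext_near (fun w => / g w)%C _ z _ (Rmin d r)).
    + apply Rmin_pos; lra.
    + intros w Hw. rmin d r.
      rewrite (E w) by (change (Cmod (w - z) < r); lra). simpl.
      rewrite recip_neq by (apply K; lra). reflexivity.
    + apply cdiff_inv; [exact Hn|exact HL].
  - exists L. apply (cdiff_ext_near g _ z L r); auto. intros w Hw.
    now rewrite (E w Hw), val_sinv_recip.
Qed.

(** On every disc of radius eta a single chart suffices, with coordinate bounded by 2; the chart may
    depend on the disc but eta does not. *)
Definition branched (f : Cx -> Sphere) (eta : R) : Prop :=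
  forall w, exists b h, hol w eta h /\
    (forall z, Cmod (z - w) < eta -> Cmod (h z) <= 2 /\ f z = rep b (h z)).

(** The sign of the height at the centre selects the chart. Heights vary by less than 1/2 on the
    disc, so in that chart the height stays below 1/2, which keeps the coordinate bounded by 2. *)
Lemma normal_branched f : normal_fn f -> exists eta, 0 < eta /\ branched f eta.
Proof.
  intros Hn. destruct (normal_height_uniformly_continuous f Hn) as [eta [He K]].
  destruct Hn as [Hm _]. exists eta. split; auto. intros w.
  destruct (Rle_lt_dec (height (f w)) 0) as [H|H].
  - assert (F : forall z, Cmod (z - w) < eta -> height (f z) < 1 / 2).
    { intros z Hz. specialize (K z w Hz). apply Rabs_def2 in K. lra. }
    assert (Fin : forall z, Cmod (z - w) < eta -> f z <> None).
    { intros z Hz E. specialize (F z Hz). rewrite E in F. simpl in F. lra. }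
    exists false, (fun z => val (f z)). split.
    + intros z Hz. apply meromorphic_val_cdiff; auto.
    + intros z Hz. specialize (F z Hz). specialize (Fin z Hz).
      destruct (f z) as [v|]; [|congruence]. split; auto. now apply height_lt_half.
  - assert (F : forall z, Cmod (z - w) < eta -> - height (f z) < 1 / 2).
    { intros z Hz. specialize (K z w Hz). apply Rabs_def2 in K. lra. }
    assert (Fin : forall z, Cmod (z - w) < eta -> f z <> Some (RtoC 0)).
    { intros z Hz E. specialize (F z Hz). rewrite E in F. simpl in F. rewrite Cmod_0 in F. lra. }
    exists true, (fun z => val (sinv (f z))). split.
    + intros z Hz. apply meromorphic_val_sinv_cdiff; auto.
    + intros z Hz. specialize (F z Hz). specialize (Fin z Hz).
      destruct (f z) as [v|]; simpl.
      * assert (Hv : v <> RtoC 0) by (intros ->; now apply Fin).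
        rewrite recip_neq by auto. simpl. split.
        -- apply height_lt_half. rewrite <- (Cinv_inv v Hv) in F.
           rewrite <- recip_neq in F by now apply Cinv_neq_0.
           rewrite height_recip in F. lra.
        -- rewrite recip_neq by now apply Cinv_neq_0. now rewrite Cinv_inv.
      * rewrite recip_0, Cmod_0. split; auto. lra.
Qed.

Definition small (f : Cx -> Sphere) (b : bool) (e : R) (z : C) : Prop :=
  exists v, f z = rep b v /\ Cmod v <= e.

Lemma small_rhoS b v : rhoS (rep b v) (rep b (RtoC 0)) <= 2 * Cmod v.
Proof.
  pose proof (Cmod_ge_0 v) as Pv. destruct b; simpl rep.
  - rewrite recip_0. destruct (Ceq_dec v (RtoC 0)) as [->|H].
    + rewrite recip_0, Cmod_0. simpl. lra.
    + rewrite recip_neq by auto. unfold rhoS.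
      change (Cnorm (/ v)%C) with (Cmod (/ v)). rewrite Cmod_inv by auto.
      assert (Hp : 0 < Cmod v) by now apply Cmod_pos.
      assert (Q : / Cmod v <= sqrt (1 + (/ Cmod v) ^ 2)).
      { rewrite <- (sqrt_pow2 (/ Cmod v)) at 1 by (left; now apply Rinv_0_lt_compat).
        apply sqrt_le_1_alt. lra. }
      assert (0 < / Cmod v) by now apply Rinv_0_lt_compat.
      unfold Rdiv. apply Rmult_le_compat_l; [lra|].
      rewrite <- (Rinv_inv (Cmod v)) at 2. apply Rinv_le_contravar; lra.
  - unfold rhoS. change (Cnorm (Csub v (RtoC 0))) with (Cmod (v - RtoC 0)).
    replace (v - RtoC 0)%C with v by ring.
    set (X := sqrt _). set (Y := sqrt _).
    assert (O : forall x, 1 <= sqrt (1 + x ^ 2)).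
    { intros x. rewrite <- sqrt_1 at 1. apply sqrt_le_1_alt. nra. }
    assert (HX : 1 <= X) by apply O. assert (HY : 1 <= Y) by apply O.
    assert (HXY : 1 <= X * Y) by nra.
    apply (Rmult_le_reg_r (X * Y)); [lra|]. unfold Rdiv. rewrite Rmult_assoc, Rinv_l by lra.
    nra.
Qed.

Lemma Cplus_minus_cancel (z h : C) : (z + h - h)%C = z.
Proof. ring. Qed.

(** If this failed for every n, f would be within 1/(n+1) of 0, or of infinity, on discs of radius
    n. The translates to their centres would converge to a constant, which [N1] excludes. *)
Lemma N1_not_small f b : N1 f -> exists n : nat, forall w, exists z,
  Cmod (z - w) <= INR n /\ ~ small f b (/ (INR n + 1)) z.
Proof.
  intros [_ Hc]. apply NNPP. intros Hno.
  assert (Hseq : forall n : nat, exists w, forall z, Cmod (z - w) <= INR n -> small f b (/ (INR n + 1)) z).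
  { intros n. apply NNPP. intros Hp. apply Hno. exists n. intros w. apply NNPP. intros Hz.
    apply Hp. exists w. intros z Hzw. apply NNPP. intros Hs. apply Hz. now exists z. }
  destruct (nat_choice _ Hseq) as [h Hh].
  apply (Hc h (fun _ => rep b (RtoC 0))); [|now exists (rep b (RtoC 0))].
  intros Rad eps He.
  destruct (inv_INR_small (eps / 2)) as [N HN]; [lra|].
  destruct (INR_unbounded Rad) as [N2 HN2].
  exists (max N N2). intros n Hn z Hz.
  destruct (Hh n (Cadd z (h n))) as [v [E Hv]].
  { change (Cmod (z + h n - h n) <= INR n). rewrite Cplus_minus_cancel.
    change (Cmod z <= Rad) in Hz. assert (INR N2 <= INR n) by (apply le_INR; lia). lra. }
  rewrite E. eapply Rle_lt_trans; [apply small_rhoS|].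
  specialize (HN n ltac:(lia)). lra.
Qed.

(** One application of [smallness_propagation] inside a single chart disc, from the circle of radius
    eta/200 to the disc of radius (eta/2)/3 = eta/6. *)
Lemma small_spread f eta b e : 0 < eta -> branched f eta -> 0 < e ->
  exists d, 0 < d /\ forall w,
    (forall z, Cmod (z - w) < eta / 100 -> small f b d z) ->
    forall z, Cmod (z - w) <= eta / 6 -> small f b e z.
Proof.
  intros Heta Hb He.
  destruct (smallness_propagation (eta / 200) (eta / 2) 2 e) as [d [Hd K]]; try lra.
  (* The 1/4 fixes the chart: in opposite charts the two coordinates of f w would have product 1,
     whereas their moduli are at most 1/4 and 2. *)
  exists (Rmin d (1 / 4)). split; [apply Rmin_pos; lra|].
  intros w Hw z Hz. rmin d (1 / 4).
  destruct (Hb w) as [b' [h [Hh Hf]]].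
  assert (b' = b).
  { destruct (Hw w) as [v [E Hv]]; [rewrite Cmod_minus_self; lra|].
    destruct (Hf w) as [B E2]; [rewrite Cmod_minus_self; lra|].
    destruct (Bool.bool_dec b' b) as [|N]; auto. exfalso.
    assert (E3 : (v * h w)%C = 1).
    { apply (rep_opposite b). rewrite <- E, E2. f_equal. now destruct b, b'. }
    apply (f_equal Cmod) in E3. rewrite Cmod_mult, Cmod_1 in E3.
    pose proof (Cmod_ge_0 v). pose proof (Cmod_ge_0 (h w)). nra. }
  subst b'. exists (h z). split; [apply Hf; lra|].
  apply (K h w eta); auto; try lra.
  - intros t. apply Hf. rewrite circ_dist; lra.
  - intros t. destruct (Hw (circ w (eta / 200) t)) as [v [E Hv]]; [rewrite circ_dist; lra|].
    destruct (Hf (circ w (eta / 200) t)) as [_ E2]; [rewrite circ_dist; lra|].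
    rewrite E in E2. apply rep_inj in E2. rewrite <- E2. lra.
Qed.

(** A chain of discs along the segment from w to z. Each link advances by eta/10, which is possible
    because eta/100 + eta/10 < eta/6. *)
Lemma small_spread_iter f eta b n : 0 < eta -> branched f eta -> forall e, 0 < e ->
  exists d, 0 < d /\ forall w,
    (forall z, Cmod (z - w) < eta / 100 -> small f b d z) ->
    forall z, Cmod (z - w) < eta / 100 + INR n * (eta / 10) -> small f b e z.
Proof.
  intros Heta Hb. induction n as [|n IH]; intros e He.
  - exists e. split; auto. intros w Hw z Hz. apply Hw. simpl in Hz. lra.
  - destruct (small_spread f eta b e Heta Hb He) as [d1 [Hd1 K1]].
    destruct (IH d1 Hd1) as [d [Hd K]]. exists d. split; auto.
    intros w Hw z Hz. specialize (K w Hw). rewrite S_INR in Hz.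
    pose proof (pos_INR n) as Pn. set (a := INR n * (eta / 10)) in *.
    assert (Ha : 0 <= a) by (apply Rmult_le_pos; lra).
    assert (Hw' : exists w', Cmod (w' - w) <= a /\ Cmod (z - w') <= eta / 6).
    { destruct (Rle_lt_dec (Cmod (z - w)) a) as [Hle|Hlt].
      - exists z. split; auto. rewrite Cmod_minus_self. lra.
      - set (m := Cmod (z - w)) in *. exists (w + RtoC (a / m) * (z - w))%C. split.
        + replace (w + RtoC (a / m) * (z - w) - w)%C with (RtoC (a / m) * (z - w))%C by ring.
          rewrite Cmod_mult, Cmod_R, Rabs_pos_eq.
          * fold m. right. field. lra.
          * apply Rmult_le_pos; auto. left. apply Rinv_0_lt_compat. lra.
        + replace (z - (w + RtoC (a / m) * (z - w)))%C with (RtoC (1 - a / m) * (z - w))%C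
            by (rewrite RtoC_minus; ring).
          assert (a / m <= 1).
          { apply (Rmult_le_reg_r m); [lra|]. unfold Rdiv. rewrite Rmult_assoc, Rinv_l; lra. }
          rewrite Cmod_mult, Cmod_R, Rabs_pos_eq by lra. fold m.
          replace ((1 - a / m) * m) with (m - a) by (field; lra). unfold a in *. lra. }
    destruct Hw' as [w' [H1 H2]]. apply (K1 w'); auto.
    intros y Hy. apply K. pose proof (Cmod_dist_triangle y w' w). lra.
Qed.

(** If f were too small on some disc of radius eta/100, a chain long enough to cover the radius n of
    [N1_not_small] would carry the smallness to the whole large disc. *)
Lemma N1_lower_bound f eta : N1 f -> 0 < eta -> branched f eta ->
  exists d, 0 < d /\ forall b w, exists z, Cmod (z - w) < eta / 100 /\ ~ small f b d z.
Proof.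
  intros Hf Heta Hb.
  assert (K : forall b, exists d, 0 < d /\ forall w, exists z, Cmod (z - w) < eta / 100 /\ ~ small f b d z).
  { intros b. destruct (N1_not_small f b Hf) as [n Hn].
    destruct (INR_unbounded (INR n / (eta / 10))) as [k Hk].
    assert (He : 0 < / (INR n + 1)) by (apply Rinv_0_lt_compat; pose proof (pos_INR n); lra).
    destruct (small_spread_iter f eta b k Heta Hb _ He) as [d [Hd K]].
    exists d. split; auto. intros w. apply NNPP. intros Hno.
    destruct (Hn w) as [z [Hz Hs]]. apply Hs. apply (K w).
    - intros y Hy. apply NNPP. intros Hys. apply Hno. now exists y.
    - assert (INR n < INR k * (eta / 10)); [|lra].
      apply (Rmult_lt_reg_r (/ (eta / 10))); [apply Rinv_0_lt_compat; lra|].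
      rewrite Rmult_assoc, Rinv_r, Rmult_1_r by lra. exact Hk. }
  destruct (K true) as [d1 [H1 K1]]. destruct (K false) as [d2 [H2 K2]].
  exists (Rmin d1 d2). split; [now apply Rmin_pos|]. intros b w.
  rmin d1 d2.
  destruct b; [destruct (K1 w) as [z [Hz Hs]]|destruct (K2 w) as [z [Hz Hs]]];
    exists z; split; auto; intros [v [E Hv]]; apply Hs; exists v; split; auto; lra.
Qed.

Definition logabs (f : Cx -> Sphere) (z : C) : R := ln (Cmod (val (f z))).

Definition singular (f : Cx -> Sphere) (z : C) : Prop := f z = Some (RtoC 0) \/ f z = None.

Lemma singular_rep f b (v : C) z : f z = rep b v -> (singular f z <-> v = 0).
Proof.
  intros E. unfold singular. rewrite E. destruct b; simpl.
  - split.
    + intros [H|H]; destruct (Ceq_dec v (RtoC 0)) as [|N]; auto; rewrite recip_neq in H by auto.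
      * exfalso. apply (Cinv_neq_0 v N). congruence.
      * discriminate.
    + intros ->. right. apply recip_0.
  - split.
    + intros [H|H]; [congruence|discriminate].
    + intros ->. now left.
Qed.

Lemma logabs_rep f b (v : C) z : f z = rep b v -> v <> 0 -> Rabs (logabs f z) = Rabs (ln (Cmod v)).
Proof.
  intros E H. unfold logabs. rewrite E. destruct b; simpl; auto.
  rewrite recip_neq by auto. simpl. rewrite Cmod_inv by auto.
  rewrite ln_Rinv by now apply Cmod_pos. apply Rabs_Ropp.
Qed.

(** The local estimate is applied about a nearby point z0 at which the chart coordinate is at least
    d in modulus, not about w itself, where f may well vanish. The list l may therefore contain
    singular points outside the disc of radius s; D only locates them. *)
Lemma N1_local_structure f : N1 f -> exists s K M D, 0 < s /\ forall w,
  exists b h l, (length l <= K)%nat /\ hol w s h /\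
    (forall z, Cmod (z - w) < s -> f z = rep b (h z)) /\
    (forall p, In p l -> singular f p /\ Cmod (p - w) <= D) /\
    (forall z, Cmod (z - w) < s -> singular f z -> In z l) /\
    (forall z, Cmod (z - w) < s -> singular f z ->
       exists m g, (m > 0)%nat /\ hol w s g /\ g z <> 0 /\
         forall y, Cmod (y - w) < s -> h y = (Complex.Cpow (y - z) m * g y)%C) /\
    (forall z, Cmod (z - w) < s -> ~ singular f z ->
       Rabs (logabs f z) <= M + sumR (fun p => Rabs (ln (Cmod (z - p)))) l).
Proof.
  intros Hf. destruct (normal_branched f) as [eta [He Hb]]; [apply Hf|].
  destruct (N1_lower_bound f eta Hf He Hb) as [d [Hd Hlow]].
  (* With rho = eta/8 the estimate needs a disc of radius more than 3 eta/8 about z0, and eta/2 is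
     available. It is valid up to distance eta/16 from z0, which covers the disc of radius eta/32
     about w because |z0 - w| < eta/100. *)
  destruct (local_log_bound (eta / 8) 2 d) as [K [M HL]]; try lra.
  exists (eta / 32), K, M, eta. split; [lra|]. intros w.
  destruct (Hb w) as [b [h [Hh Hfh]]].
  destruct (Hlow b w) as [z0 [Hz0 Hns]].
  assert (Near : forall z, Cmod (z - z0) < eta / 2 -> Cmod (z - w) < eta).
  { intros z Hz. pose proof (Cmod_dist_triangle z z0 w). lra. }
  assert (Near2 : forall z, Cmod (z - w) < eta / 32 -> Cmod (z - z0) < eta / 16).
  { intros z Hz. pose proof (Cmod_dist_triangle z w z0) as T. rewrite (Cmod_sub_sym w z0) in T. lra. }
  destruct (HL h z0 (eta / 2)) as [l [Hlen [Hl [Hord Hlog]]]].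
  - lra.
  - apply hol_sub with (2 := Hh). lra.
  - intros z Hz. apply Hfh, Near, Hz.
  - apply Rnot_lt_le. intros Hlt. apply Hns. exists (h z0). split; [apply Hfh|]; lra.
  - exists b, h, l. split; auto. split; [|split; [|split; [|split; [|split]]]].
    + apply hol_sub with (2 := Hh). rewrite Cmod_minus_self. lra.
    + intros z Hz. apply Hfh. lra.
    + intros p Hp. destruct (Hl p Hp) as [H1 H2]. split; [|left; apply Near; lra].
      apply (singular_rep f b (h p)); auto.
      apply Hfh, Near. lra.
    + intros z Hz Hs. specialize (Near2 z Hz). apply Hord; [lra|].
      apply (singular_rep f b (h z) z); auto. apply Hfh. lra.
    + intros z Hz Hs. pose proof (Near2 z Hz). destruct (Hord z) as [_ [m [g [Hm [Hg [Hgz E]]]]]]; [lra| |].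
      * apply (singular_rep f b (h z) z); auto. apply Hfh. lra.
      * exists m, g. repeat split; auto.
        -- apply hol_sub with (2 := Hg). rewrite Cmod_sub_sym. lra.
        -- intros y Hy. apply E. specialize (Near2 y Hy). lra.
    + intros z Hz Hs. specialize (Near2 z Hz).
      assert (E : f z = rep b (h z)) by (apply Hfh; lra).
      assert (Hn : h z <> 0) by (intros Z; apply Hs; now apply (singular_rep f b (h z) z)).
      rewrite (logabs_rep f b (h z) z) by auto. apply Hlog; auto. lra.
Qed.

(** * Logarithmic means of f over circles *)

Lemma continuous_ln x : 0 < x -> continuous ln x.
Proof.
  intros Hx. apply continuity_pt_filterlim. apply derivable_continuous_pt.
  exists (/ x). now apply derivable_pt_lim_ln.
Qed.

Lemma ln_Cmod_continuous (g : R -> C) t : ccont g t -> g t <> 0 ->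
  continuous (fun s => ln (Cmod (g s))) t.
Proof.
  intros Hg Hn. apply (continuous_comp (fun s => Cmod (g s)) ln).
  - now apply ccont_Cmod.
  - apply continuous_ln. now apply Cmod_pos.
Qed.

Lemma logabs_continuous f c r t : meromorphic f -> ~ singular f (circ c r t) ->
  continuous (fun t => logabs f (circ c r t)) t.
Proof.
  intros Hm Hs.
  destruct (meromorphic_val_cdiff f (circ c r t) Hm) as [L HL].
  { intros E. apply Hs. now right. }
  apply (ln_Cmod_continuous (fun t => val (f (circ c r t)))).
  - apply (ccont_comp (fun w => val (f w)) (circ c r) t L HL). apply circ_ccont.
  - intros E. apply Hs. destruct (f (circ c r t)) as [v|] eqn:Ev; [left|now right].
    rewrite Ev. f_equal. exact E.
Qed.

Lemma RInt_le_primitive (f Phi phi : R -> R) a b : a <= b ->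
  (forall t, a <= t <= b -> continuous f t) ->
  (forall t, a <= t <= b -> is_derive Phi t (phi t)) ->
  (forall t, a <= t <= b -> continuous phi t) ->
  (forall t, a <= t <= b -> f t <= phi t) -> RInt f a b <= Phi b - Phi a.
Proof.
  intros Hab Hf HP Hc Hle.
  assert (E : is_RInt phi a b (Phi b - Phi a)).
  { apply (is_RInt_derive (V := R_CompleteNormedModule));
      rewrite Rmin_left, Rmax_right by lra; auto. }
  rewrite <- (is_RInt_unique _ _ _ _ E). apply RInt_le; auto.
  - apply ex_RInt_cont; auto.
  - eexists; exact E.
  - intros x Hx. apply Hle. lra.
Qed.

(* A bounded primitive of a function comparable with [(x^2 + d^2)^(-1/4)], uniformly in [d]. *)
Definition quarter (d x : R) : R := x / sqrt (sqrt (x ^ 2 + d ^ 2)).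
Definition quarter' (d x : R) : R :=
  (x ^ 2 + 2 * d ^ 2) / (2 * (x ^ 2 + d ^ 2) * sqrt (sqrt (x ^ 2 + d ^ 2))).

Lemma sum_sq_pos d x : 0 < d -> 0 < x ^ 2 + d ^ 2.
Proof. intros Hd. assert (0 < d ^ 2) by (apply pow_lt; auto). pose proof (pow2_ge_0 x). lra. Qed.

Lemma quarter_derive d x : 0 < d -> is_derive (quarter d) x (quarter' d x).
Proof.
  intros Hd. pose proof (sum_sq_pos d x Hd) as HS.
  assert (H1 : 0 < sqrt (x ^ 2 + d ^ 2)) by now apply sqrt_lt_R0.
  assert (H2 : 0 < sqrt (sqrt (x ^ 2 + d ^ 2))) by now apply sqrt_lt_R0.
  unfold quarter. auto_derive.
  - simpl in *. repeat split; auto; lra.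
  - unfold quarter'. simpl in *. rewrite !Rmult_1_r in *.
    set (S := x * x + d * d) in *. set (P := sqrt S) in *. set (y := sqrt P) in *.
    assert (EP : P * P = S) by (apply sqrt_sqrt; lra).
    assert (Ey : y * y = P) by (apply sqrt_sqrt; lra).
    assert (Ed : d * d = S - x * x) by (unfold S; ring).
    replace (2 * (d * d)) with (2 * (S - x * x)) by lra.
    rewrite <- EP, <- Ey. field. lra.
Qed.

Lemma quarter'_continuous d x : 0 < d -> continuous (quarter' d) x.
Proof.
  intros Hd. pose proof (sum_sq_pos d x Hd) as HS.
  assert (H1 : 0 < sqrt (x ^ 2 + d ^ 2)) by now apply sqrt_lt_R0.
  assert (H2 : 0 < sqrt (sqrt (x ^ 2 + d ^ 2))) by now apply sqrt_lt_R0.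
  apply ex_derive_cont.
  unfold quarter'. auto_derive. simpl in *. repeat split; auto.
  apply Rgt_not_eq. repeat apply Rmult_lt_0_compat; lra.
Qed.

Lemma quarter'_ge d x : 0 < d -> / sqrt (sqrt (x ^ 2 + d ^ 2)) <= 2 * quarter' d x.
Proof.
  intros Hd. pose proof (sum_sq_pos d x Hd) as HS.
  assert (H1 : 0 < sqrt (x ^ 2 + d ^ 2)) by now apply sqrt_lt_R0.
  assert (H2 : 0 < sqrt (sqrt (x ^ 2 + d ^ 2))) by now apply sqrt_lt_R0.
  unfold quarter'. set (y := sqrt (sqrt _)) in *. set (S := x ^ 2 + d ^ 2) in *.
  replace (2 * ((x ^ 2 + 2 * d ^ 2) / (2 * S * y))) with ((S + d ^ 2) / S * / y).
  2:{ unfold S at 1. field. split; lra. }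
  rewrite <- (Rmult_1_l (/ y)) at 1. apply Rmult_le_compat_r; [left; now apply Rinv_0_lt_compat|].
  apply (Rmult_le_reg_r S); auto. unfold Rdiv. rewrite Rmult_assoc, Rinv_l by lra.
  pose proof (pow2_ge_0 d). lra.
Qed.

Lemma quarter_bound d x D : 0 < d -> Rabs x <= D -> 1 <= D -> Rabs (quarter d x) <= D.
Proof.
  intros Hd Hx HD. pose proof (sum_sq_pos d x Hd) as HS.
  assert (H1 : 0 < sqrt (x ^ 2 + d ^ 2)) by now apply sqrt_lt_R0.
  assert (H2 : 0 < sqrt (sqrt (x ^ 2 + d ^ 2))) by now apply sqrt_lt_R0.
  unfold quarter, Rdiv. rewrite Rabs_mult, Rabs_inv, (Rabs_pos_eq (sqrt _)) by lra.
  set (y := sqrt (sqrt _)) in *.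
  assert (Hy : Rabs x <= y * y).
  { unfold y. rewrite sqrt_sqrt by lra. rewrite <- sqrt_Rsqr_abs. apply sqrt_le_1_alt.
    unfold Rsqr. pose proof (pow2_ge_0 d). lra. }
  pose proof (Rabs_pos x).
  apply (Rmult_le_reg_r y); auto. rewrite Rmult_assoc, Rinv_l, Rmult_1_r by lra.
  destruct (Rle_lt_dec D y); nra.
Qed.

(** Since x dominates both |tau| and d, it is at least half of P = sqrt(tau^2 + d^2). With y = sqrt
    P this gives - ln x <= ln 2 - 2 ln y <= 1 + 2/y, and 1/y is at most twice [quarter']. *)
Lemma Rabs_ln_le x tau d D : 1 <= D -> 0 < x <= D -> 0 < d -> d <= x -> Rabs tau <= x ->
  Rabs (ln x) <= 2 * ln D + 1 + 4 * quarter' d tau.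
Proof.
  intros HD Hx Hd Hdx Ht.
  pose proof (sum_sq_pos d tau Hd) as HS.
  set (P := sqrt (tau ^ 2 + d ^ 2)).
  assert (H1 : 0 < P) by now apply sqrt_lt_R0.
  set (y := sqrt P). assert (H2 : 0 < y) by now apply sqrt_lt_R0.
  assert (Hq := quarter'_ge d tau Hd). fold P y in Hq.
  assert (HlnD : 0 <= ln D) by (rewrite <- ln_1; apply ln_le; lra).
  assert (HxD : ln x <= ln D) by (apply ln_le; lra).
  assert (Hlow : - ln x <= 1 + 4 * quarter' d tau).
  { assert (PP : P * P = tau ^ 2 + d ^ 2) by (apply sqrt_sqrt; lra).
    assert (Yy : y * y = P) by (apply sqrt_sqrt; lra).
    assert (Q : P <= 2 * x).
    { apply Rsqr_incr_0; try lra. unfold Rsqr. rewrite PP.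
      assert (tau ^ 2 <= x * x).
      { rewrite <- (pow2_abs tau). pose proof (Rabs_pos tau). simpl. nra. }
      nra. }
    assert (L : ln (y * y) <= ln (2 * x)) by (apply ln_le; nra).
    rewrite !ln_mult in L by lra.
    assert (L2 : ln 2 <= 1).
    { pose proof (ln_lt_2). pose proof exp_ineq1 1. rewrite <- (ln_exp 1). apply ln_le; lra. }
    assert (Ly : - ln y <= / y).
    { rewrite <- ln_Rinv by auto. left.
      assert (0 < / y) by now apply Rinv_0_lt_compat.
      apply exp_lt_inv. rewrite exp_ln by auto.
      apply Rlt_trans with (1 + / y); [lra|]. apply exp_ineq1. lra. }
    lra. }
  assert (0 <= quarter' d tau).
  { assert (0 < / y) by now apply Rinv_0_lt_compat. lra. }
  apply Rabs_le. lra.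
Qed.

Lemma cos_ge_half x : 0 <= x <= 1 -> 1 / 2 <= cos x.
Proof.
  intros Hx. rewrite <- cos_PI3. pose proof PI2_3_2. apply cos_decr_1; lra.
Qed.

(** On a short arc the displacement along the tangent at its starting point moves at speed at least
    π t, so it serves as integration variable for the logarithmic singularity. The bounded primitive
    [quarter] then gives O(1/t), wherever p lies. *)
Lemma arc_factor_bound c t p al h s0 D : 0 < t -> 0 < h -> 2 * PI * t * h <= s0 ->
  s0 <= t -> s0 <= 1 -> 1 <= D ->
  (forall x, al <= x <= al + h -> circ c t x <> p /\ Cmod (circ c t x - p) <= D) ->
  RInt (fun x => Rabs (ln (Cmod (circ c t x - p)))) al (al + h)
    <= (2 * ln D + 1) * h + 8 * D / (PI * t).
Proof.
  intros Ht Hh Hs Hst Hs1 HD Hp. pose proof PI_RGT_0 as Hpi.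
  (* [tau] is the component of circ c t x - p along the tangent at the angle al; its modulus is at
     most the distance to p. *)
  set (q := snd ((p - c) * Cconj (cis al))%C).
  set (tau := fun x => t * sin (2 * PI * (x - al)) - q).
  assert (Cp : forall x, ccont (fun x => circ c t x - p)%C x).
  { intros x. apply ccont_minus; [apply circ_ccont|apply ccont_const]. }
  (* This d depends on p and may be arbitrarily small. It only keeps the primitive smooth; the bound
     of [quarter] does not involve it. *)
  assert (Hmin : exists d, 0 < d /\ forall x, al <= x <= al + h -> d <= Cmod (circ c t x - p)).
  { destruct (continuity_ab_min (fun x => Cmod (circ c t x - p)) al (al + h)) as [x0 [H1 H2]]; [lra| |].
    - intros x _. apply continuity_pt_filterlim. apply (ccont_Cmod (fun x => circ c t x - p)%C), Cp.
    - exists (Cmod (circ c t x0 - p)). split; auto.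
      apply Cmod_pos, Cminus_eq_contra. now apply Hp. }
  destruct Hmin as [d [Hd Hmin]].
  assert (Htau : forall x, Rabs (tau x) <= Cmod (circ c t x - p)).
  { intros x.
    replace (tau x) with (snd ((circ c t x - p) * Cconj (cis al))%C).
    - eapply Rle_trans; [apply Rabs_snd_le_Cmod|]. rewrite Cmod_mult, Cmod_conj, Cmod_cis. lra.
    - unfold tau, q, circ, cis, Cconj. simpl.
      replace (2 * PI * (x - al)) with (2 * PI * x - 2 * PI * al) by ring.
      rewrite sin_minus. ring. }
  set (Phi := fun x => (2 * ln D + 1) * x + 4 / (PI * t) * quarter d (tau x)).
  set (tau' := fun x => t * (2 * PI * cos (2 * PI * (x - al)))).
  set (phi := fun x => (2 * ln D + 1) + 4 / (PI * t) * (tau' x * quarter' d (tau x))).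
  assert (Dtau : forall x, is_derive tau x (tau' x)).
  { intros x. unfold tau, tau'. auto_derive; auto. unfold Rminus. ring. }
  assert (Hpt : 0 < PI * t) by now apply Rmult_lt_0_compat.
  eapply Rle_trans; [apply (RInt_le_primitive _ Phi phi); [lra| | | |]|].
  - intros x Hx. apply (continuous_comp (fun x => ln (Cmod (circ c t x - p))) Rabs).
    + apply (ln_Cmod_continuous (fun x => circ c t x - p)%C); [apply Cp|].
      apply Cminus_eq_contra. now apply Hp.
    + apply continuous_Rabs.
  - intros x Hx. unfold Phi, phi.
    apply (is_derive_plus (K := R_AbsRing) (V := R_NormedModule)).
    + auto_derive; auto. ring.
    + apply (is_derive_scal (fun x => quarter d (tau x))).
      apply (is_derive_comp (quarter d) tau); [now apply quarter_derive|apply Dtau].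
  - intros x Hx. unfold phi.
    apply continuous_Rplus; [apply continuous_const|].
    apply continuous_Rmult; [apply continuous_const|].
    apply continuous_Rmult.
    + apply ex_derive_cont.
      unfold tau'. auto_derive. auto.
    + apply (continuous_comp tau (quarter' d)); [|now apply quarter'_continuous].
      apply ex_derive_cont.
      eexists. apply Dtau.
  - intros x Hx. destruct (Hp x Hx) as [P1 P2].
    eapply Rle_trans; [apply (Rabs_ln_le _ (tau x) d D); auto|].
    + split; auto. apply Cmod_pos, Cminus_eq_contra. auto.
    + unfold phi. apply Rplus_le_compat_l.
      assert (Q0 : 0 <= quarter' d (tau x)).
      { pose proof (quarter'_ge d (tau x) Hd).
        assert (0 < / sqrt (sqrt (tau x ^ 2 + d ^ 2))); [|lra].
        apply Rinv_0_lt_compat. do 2 apply sqrt_lt_R0. now apply sum_sq_pos. }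
      assert (T : PI * t <= tau' x).
      { unfold tau'. assert (1 / 2 <= cos (2 * PI * (x - al))); [|nra].
        apply cos_ge_half. split; [apply Rmult_le_pos; lra|].
        apply (Rmult_le_reg_l t); auto.
        assert (t * (2 * PI * (x - al)) <= t * (2 * PI * h)).
        { apply Rmult_le_compat_l; [lra|]. apply Rmult_le_compat_l; lra. }
        lra. }
      replace 4 with (4 / (PI * t) * (PI * t)) at 1 by (field; lra).
      rewrite Rmult_assoc. apply Rmult_le_compat_l.
      * left. apply Rdiv_lt_0_compat; lra.
      * apply Rmult_le_compat_r; auto.
  - unfold Phi.
    assert (B : forall x, al <= x <= al + h -> Rabs (quarter d (tau x)) <= D).
    { intros x Hx. apply quarter_bound; auto. eapply Rle_trans; [apply Htau|]. now apply Hp. }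
    pose proof (B (al + h) ltac:(lra)) as B1. pose proof (B al ltac:(lra)) as B2.
    apply Rabs_le_between in B1. apply Rabs_le_between in B2.
    assert (4 / (PI * t) * (quarter d (tau (al + h)) - quarter d (tau al)) <= 4 / (PI * t) * (2 * D)).
    { apply Rmult_le_compat_l; [left; apply Rdiv_lt_0_compat; lra|lra]. }
    replace (8 * D / (PI * t)) with (4 / (PI * t) * (2 * D)) by (field; lra). lra.
Qed.

Lemma RInt_sumR_le {T} (F : T -> R -> R) (l : list T) a b B : a <= b ->
  (forall p x, In p l -> a <= x <= b -> continuous (F p) x) ->
  (forall p, In p l -> RInt (F p) a b <= B) ->
  (forall x, a <= x <= b -> continuous (fun x => sumR (fun p => F p x) l) x) /\
  RInt (fun x => sumR (fun p => F p x) l) a b <= INR (length l) * B.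
Proof.
  intros Hab. unfold sumR. induction l as [|p l IH]; intros Hc HB.
  - simpl. split; [intros; apply continuous_const|]. rewrite RInt_const.
    unfold scal; simpl; unfold mult; simpl. lra.
  - destruct IH as [I1 I2].
    + intros; apply Hc; auto; now right.
    + intros; apply HB; now right.
    + assert (C1 : forall x, a <= x <= b -> continuous (F p) x) by (intros; apply Hc; auto; now left).
      split.
      * intros x Hx. apply continuous_Rplus; auto.
      * cbn [map fold_right length].
        rewrite (RInt_plus (V := R_CompleteNormedModule) (F p)
          (fun x => fold_right Rplus 0 (map (fun p => F p x) l))).
        -- specialize (HB p (or_introl eq_refl)). unfold plus; simpl plus.
           rewrite S_INR. simpl. lra.
        -- apply ex_RInt_cont; auto.
        -- apply ex_RInt_cont; auto.
Qed.

Lemma RInt_subdivide (u : R -> R) N X : (0 < N)%nat ->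
  (forall x, 0 <= x <= 1 -> continuous u x) ->
  (forall k, (k < N)%nat -> RInt u (INR k / INR N) (INR k / INR N + / INR N) <= X) ->
  RInt u 0 1 <= INR N * X.
Proof.
  intros HN Hu HX. assert (PN : 0 < INR N) by now apply lt_0_INR.
  assert (K : forall n, (n <= N)%nat -> RInt u 0 (INR n / INR N) <= INR n * X).
  { induction n as [|n IH]; intros Hn.
    - simpl. unfold Rdiv. rewrite !Rmult_0_l, RInt_point. unfold zero; simpl. lra.
    - assert (Hle : INR (S n) / INR N <= 1).
      { apply (Rmult_le_reg_r (INR N)); auto. unfold Rdiv. rewrite Rmult_assoc, Rinv_l by lra.
        apply le_INR in Hn. lra. }
      assert (E : INR (S n) / INR N = INR n / INR N + / INR N) by (rewrite S_INR; field; lra).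
      assert (Pi : 0 < / INR N) by now apply Rinv_0_lt_compat.
      assert (P0 : 0 <= INR n / INR N) by (apply Rmult_le_pos; [apply pos_INR|lra]).
      rewrite <- (RInt_Chasles (V := R_CompleteNormedModule) u 0 (INR n / INR N)).
      + unfold plus; simpl plus. rewrite E at 1. specialize (HX n ltac:(lia)).
        specialize (IH ltac:(lia)). rewrite S_INR. simpl. lra.
      + apply ex_RInt_cont; [lra|]. intros; apply Hu; lra.
      + apply ex_RInt_cont; [lra|]. intros; apply Hu; lra. }
  specialize (K N (le_n _)). unfold Rdiv in K. now rewrite Rinv_r in K by lra.
Qed.

Lemma subdivision_count x : 1 <= x -> exists N, (0 < N)%nat /\ x <= INR N <= 2 * x.
Proof.
  intros Hx. destruct (archimed x) as [A1 A2].
  assert (Hz : (0 <= up x)%Z) by (apply le_IZR; lra).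
  exists (Z.to_nat (up x)).
  assert (E : INR (Z.to_nat (up x)) = IZR (up x)) by (rewrite INR_IZR_INZ, Z2Nat.id; auto).
  split; [apply INR_lt; simpl; lra|lra].
Qed.

(** The circle is cut into N arcs with N comparable to t. On each of them the local structure
    applies with at most K logarithmic factors and contributes a constant times 1/N, so the sum does
    not depend on t or c. *)
Lemma N1_circle_bound f : N1 f -> exists B, forall c t, 1 <= t ->
  (forall x, ~ singular f (circ c t x)) ->
  RInt (fun x => Rabs (logabs f (circ c t x))) 0 1 <= B.
Proof.
  intros Hf. pose proof PI_RGT_0 as Hpi. pose proof PI2_3_2 as Hpi3.
  destruct (N1_local_structure f Hf) as [s [K [M [D [Hs HL]]]]].
  (* The bound s0 <= 1 gives s0 <= t. The bound s/4 keeps each arc inside its local disc: the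
     Lipschitz estimate of [cis] moves points by at most 4 π t h <= 2 s0 <= s/2. *)
  set (s0 := Rmin 1 (s / 4)).
  assert (Hs0 : 0 < s0) by (apply Rmin_pos; lra).
  assert (Hs1 : s0 <= 1) by apply Rmin_l. assert (Hs4 : s0 <= s / 4) by apply Rmin_r.
  set (D1 := Rabs D + s + 1). assert (HD1 : 1 <= D1) by (unfold D1; pose proof (Rabs_pos D); lra).
  assert (HlnD : 0 <= ln D1) by (rewrite <- ln_1; apply ln_le; lra).
  set (B1 := 2 * ln D1 + 1 + 32 * D1 / s0).
  assert (HB1 : 0 <= B1).
  { unfold B1. assert (0 < 32 * D1 / s0) by (apply Rdiv_lt_0_compat; lra). lra. }
  exists (Rabs M + INR K * B1). intros c t Ht Hns.
  destruct (subdivision_count (2 * PI * t / s0)) as [N [HN [HN1 HN2]]].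
  { apply (Rmult_le_reg_r s0); auto. unfold Rdiv. rewrite Rmult_assoc, Rinv_l by lra. nra. }
  assert (PN : 0 < INR N) by now apply lt_0_INR.
  set (h := / INR N). assert (Hh : 0 < h) by now apply Rinv_0_lt_compat.
  assert (Hth : 2 * PI * t * h <= s0).
  { apply (Rmult_le_reg_r (INR N)); auto. unfold h. rewrite Rmult_assoc, Rinv_l, Rmult_1_r by lra.
    apply (Rmult_le_compat_r s0) in HN1; [|lra]. unfold Rdiv in HN1.
    rewrite Rmult_assoc, Rinv_l in HN1 by lra. lra. }
  (* This uses the upper bound N <= 4 π t / s0: an error of order 1/t per arc is a multiple of the
     arc's own measure 1/N. *)
  assert (Hinvt : 8 * D1 / (PI * t) <= 32 * D1 / s0 * h).
  { apply (Rmult_le_reg_r (PI * t * s0 * INR N)).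
    { apply Rmult_lt_0_compat; [apply Rmult_lt_0_compat; [apply Rmult_lt_0_compat|]|]; lra. }
    unfold h.
    replace (8 * D1 / (PI * t) * (PI * t * s0 * INR N)) with (8 * D1 * (s0 * INR N)) by (field; lra).
    replace (32 * D1 / s0 * / INR N * (PI * t * s0 * INR N)) with (8 * D1 * (4 * PI * t)) by (field; lra).
    apply Rmult_le_compat_l; [lra|].
    apply (Rmult_le_compat_l s0) in HN2; [|lra].
    replace (s0 * (2 * (2 * PI * t / s0))) with (4 * PI * t) in HN2 by (field; lra). lra. }
  assert (Hu : forall x, continuous (fun x => Rabs (logabs f (circ c t x))) x).
  { intros x. apply (continuous_comp (fun x => logabs f (circ c t x)) Rabs).
    - apply logabs_continuous; auto. apply Hf.
    - apply continuous_Rabs. }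
  replace (Rabs M + INR K * B1) with (INR N * (Rabs M * h + INR K * (B1 * h)))
    by (unfold h; field; lra).
  apply RInt_subdivide; auto. intros k Hk. set (al := INR k / INR N). fold h.
  destruct (HL (circ c t al)) as [b [hh [l [Hlen [_ [_ [Hl [_ [_ Hlog]]]]]]]]].
  assert (Near : forall x, al <= x <= al + h -> Cmod (circ c t x - circ c t al) < s).
  { intros x Hx. unfold circ.
    replace (c + RtoC t * cis x - (c + RtoC t * cis al))%C with (RtoC t * (cis x - cis al))%C by ring.
    rewrite Cmod_mult, Cmod_R, Rabs_pos_eq by lra.
    pose proof (cis_lipschitz x al) as T. rewrite (Rabs_pos_eq (x - al)) in T by lra.
    assert (t * Cmod (cis x - cis al) <= t * (4 * PI * h)).
    { apply Rmult_le_compat_l; [lra|]. eapply Rle_trans; [exact T|].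
      apply Rmult_le_compat_l; lra. }
    lra. }
  destruct (RInt_sumR_le (fun p x => Rabs (ln (Cmod (circ c t x - p)))) l al (al + h) (B1 * h)) as [S1 S2].
  - lra.
  - intros p x Hp Hx. apply (continuous_comp (fun x => ln (Cmod (circ c t x - p))) Rabs).
    + apply (ln_Cmod_continuous (fun x => circ c t x - p)%C).
      * apply ccont_minus; [apply circ_ccont|apply ccont_const].
      * apply Cminus_eq_contra. intros E. apply (Hns x). rewrite E. now apply Hl.
    + apply continuous_Rabs.
  - intros p Hp. eapply Rle_trans; [apply (arc_factor_bound c t p al h s0 D1); auto; try lra|].
    + intros x Hx. split.
      * intros E. apply (Hns x). rewrite E. now apply Hl.
      * pose proof (Cmod_dist_triangle (circ c t x) (circ c t al) p) as T.
        specialize (Near x Hx). destruct (Hl p Hp) as [_ Hd]. rewrite Cmod_sub_sym in Hd.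
        pose proof (Rle_abs D). unfold D1. lra.
    + unfold B1. lra.
  - set (SS := fun x => sumR (fun p => Rabs (ln (Cmod (circ c t x - p)))) l) in *.
    apply Rle_trans with (RInt (fun x => plus (Rabs M : R_NormedModule) (SS x)) al (al + h)).
    + apply RInt_le; [lra| | |].
      * apply ex_RInt_cont; auto; lra.
      * apply ex_RInt_cont; [lra|]. intros x Hx.
        apply continuous_Rplus; [apply continuous_const|auto].
      * intros x Hx. specialize (Hlog (circ c t x) (Near x ltac:(lra)) (Hns x)).
        unfold plus; simpl. unfold SS. pose proof (Rle_abs M). lra.
    + rewrite (RInt_plus (V := R_CompleteNormedModule) (fun _ => Rabs M) SS).
      * rewrite RInt_const. unfold scal; simpl; unfold mult; simpl. unfold plus; simpl.
        apply Rplus_le_compat; [right; ring|].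
        eapply Rle_trans; [exact S2|]. apply Rmult_le_compat_r.
        -- apply Rmult_le_pos; lra.
        -- now apply le_INR.
      * apply ex_RInt_const.
      * apply ex_RInt_cont; [lra|]. auto.
Qed.

(** * The divisor in a disc *)

Lemma disc_cover c Q s : 0 < s -> exists ws : list C, forall z,
  Cmod (z - c) < Q -> exists w, In w ws /\ Cmod (z - w) < s.
Proof.
  intros Hs. set (d := s / 3). assert (Hd : 0 < d) by (unfold d; lra).
  destruct (INR_unbounded (2 * Q / d)) as [n Hn].
  exists (map (fun p => (fst c - Q + INR (fst p) * d, snd c - Q + INR (snd p) * d) : C)
    (list_prod (seq 0 n) (seq 0 n))).
  assert (K : forall x, Rabs x < Q -> exists i, (i < n)%nat /\ Rabs (x - (- Q + INR i * d)) <= d).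
  { intros x Hx. apply Rabs_def2 in Hx.
    assert (H0 : 0 <= (x + Q) / d) by (left; apply Rdiv_lt_0_compat; lra).
    destruct (nfloor_ex _ H0) as [i Hi]. exists i. split.
    - apply INR_lt. apply Rle_lt_trans with ((x + Q) / d); [lra|].
      apply Rlt_trans with (2 * Q / d); [|lra].
      apply Rmult_lt_compat_r; [now apply Rinv_0_lt_compat|lra].
    - assert (INR i * d <= x + Q < (INR i + 1) * d).
      { replace (x + Q) with ((x + Q) / d * d) by (field; lra). split.
        - apply Rmult_le_compat_r; lra.
        - apply Rmult_lt_compat_r; lra. }
      apply Rabs_le. lra. }
  intros z Hz.
  destruct (K (fst z - fst c)) as [i [Hi Ei]].
  { eapply Rle_lt_trans; [apply (Rabs_fst_le_Cmod (z - c))|exact Hz]. }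
  destruct (K (snd z - snd c)) as [j [Hj Ej]].
  { eapply Rle_lt_trans; [apply (Rabs_snd_le_Cmod (z - c))|exact Hz]. }
  eexists. split.
  - apply in_map_iff. exists (i, j). split; [reflexivity|].
    apply in_prod; apply in_seq; lia.
  - eapply Rle_lt_trans; [apply Cmod_le_sum|]. simpl.
    replace (fst z + - (fst c - Q + INR i * d)) with (fst z - fst c - (- Q + INR i * d)) by ring.
    replace (snd z + - (snd c - Q + INR j * d)) with (snd z - snd c - (- Q + INR j * d)) by ring.
    unfold d in *. lra.
Qed.

(** [zlist] and [plist] are chosen by [epsilon], so they mean what they should only once a finite
    list is known to exist. It comes from covering the disc by finitely many local discs. *)
Lemma N1_finite_singular f c Q : N1 f ->
  exists l, forall z, Cmod (z - c) < Q -> singular f z -> In z l.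
Proof.
  intros Hf. destruct (N1_local_structure f Hf) as [s [K [M [D [Hs HL]]]]].
  destruct (disc_cover c Q s Hs) as [ws Hws].
  assert (HL2 : forall w, exists l, forall z, Cmod (z - w) < s -> singular f z -> In z l).
  { intros w. destruct (HL w) as [b [h [l [_ [_ [_ [_ [H _]]]]]]]]. now exists l. }
  exists (flat_map (fun w => proj1_sig (constructive_indefinite_description _ (HL2 w))) ws).
  intros z Hz Hsing. destruct (Hws z Hz) as [w [Hw Hzw]].
  apply in_flat_map. exists w. split; auto.
  destruct (constructive_indefinite_description _ (HL2 w)) as [l Hl]. simpl. now apply Hl.
Qed.

Lemma finite_set_list (P : C -> Prop) l : (forall z, P z -> In z l) ->
  exists l', NoDup l' /\ forall z, In z l' <-> P z.
Proof.
  intros H.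
  exists (nodup Ceq_dec (filter (fun z => if excluded_middle_informative (P z) then true else false) l)).
  split; [apply NoDup_nodup|]. intros z. rewrite nodup_In, filter_In.
  destruct (excluded_middle_informative (P z)) as [HP|HP]; split.
  - auto.
  - intros _. split; [now apply H|reflexivity].
  - intros [_ E]. discriminate E.
  - intros Hz. contradiction.
Qed.

Lemma zlist_spec f c t : N1 f -> NoDup (zlist f c t) /\
  forall z, In z (zlist f c t) <-> (Cmod (z - c) < t /\ f z = Some C0).
Proof.
  intros Hf. unfold zlist. apply epsilon_spec.
  destruct (N1_finite_singular f c t Hf) as [l Hl].
  apply (finite_set_list (fun z => Cmod (z - c) < t /\ f z = Some C0) l).
  intros z [H1 H2]. apply Hl; auto. now left.
Qed.

Lemma plist_spec f c t : N1 f -> NoDup (plist f c t) /\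
  forall z, In z (plist f c t) <-> (Cmod (z - c) < t /\ f z = None).
Proof.
  intros Hf. unfold plist. apply epsilon_spec.
  destruct (N1_finite_singular f c t Hf) as [l Hl].
  apply (finite_set_list (fun z => Cmod (z - c) < t /\ f z = None) l).
  intros z [H1 H2]. apply Hl; auto. now right.
Qed.

(** The local factorization supplies a positive order, which makes the [epsilon] choice meet its
    specification. The reciprocal chart is excluded because 1/h never takes the value 0. *)
Lemma zord_spec f a : N1 f -> f a = Some C0 -> zero_order f a (zord f a).
Proof.
  intros Hf Ha. unfold zord.
  apply (epsilon_spec (inhabits 0%nat) (fun m => (m > 0)%nat /\ zero_order f a m)).
  destruct (N1_local_structure f Hf) as [s [K [M [D [Hs HL]]]]].
  destruct (HL a) as [b [h [l [_ [_ [Hr [_ [_ [Hord _]]]]]]]]].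
  assert (Aa : Cmod (a - a) < s) by (rewrite Cmod_minus_self; lra).
  destruct (Hord a Aa) as [m [g [Hm [Hg [Hga E]]]]]; [now left|].
  exists m. split; auto. exists s. split; auto. exists g. split; [exact Hg|]. split; [exact Hga|].
  destruct b.
  - exfalso. pose proof (Hr a Aa) as Ea. rewrite Ha in Ea. simpl in Ea. symmetry in Ea.
    destruct (Ceq_dec (h a) (RtoC 0)) as [Z|N].
    + rewrite Z, recip_0 in Ea. discriminate.
    + rewrite recip_neq in Ea by auto. apply (Cinv_neq_0 (h a) N). change (Some (/ h a)%C = Some (RtoC 0)) in Ea. congruence.
  - intros z Hz. rewrite (Hr z Hz). exact (f_equal Some (E z Hz)).
Qed.

Lemma pord_spec f a : N1 f -> f a = None -> pole_order f a (pord f a).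
Proof.
  intros Hf Ha. unfold pord.
  apply (epsilon_spec (inhabits 0%nat) (fun m => (m > 0)%nat /\ pole_order f a m)).
  destruct (N1_local_structure f Hf) as [s [K [M [D [Hs HL]]]]].
  destruct (HL a) as [b [h [l [_ [_ [Hr [_ [_ [Hord _]]]]]]]]].
  assert (Aa : Cmod (a - a) < s) by (rewrite Cmod_minus_self; lra).
  destruct (Hord a Aa) as [m [g [Hm [Hg [Hga E]]]]]; [now right|].
  exists m. split; auto. split; auto.
  destruct b.
  2:{ pose proof (Hr a Aa) as Ea. rewrite Ha in Ea. discriminate. }
  destruct (Hg a Aa) as [L HL2].
  (* The cofactor g is known to be nonzero only at a, so the disc is shrunk until 1/g is holomorphic
     on it. *)
  destruct (cdiff_neq_near g a L HL2 Hga) as [d [Hd Hnz]].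
  rmin d s.
  exists (Rmin d s). split; [apply Rmin_pos; lra|].
  exists (fun z => (RtoC 1 / g z)%C). split; [|split].
  - intros z Hz. change (Cmod (z - a) < Rmin d s) in Hz.
    destruct (Hg z) as [L' HL']; [lra|]. eexists.
    apply (cdiff_div (fun _ => RtoC 1) g); [apply Hnz; lra|apply cdiff_const|exact HL'].
  - change ((RtoC 1 / g a)%C <> RtoC 0). unfold Cdiv. rewrite Cmult_1_l. now apply Cinv_neq_0.
  - intros z Hz Hza. change (Cmod (z - a) < Rmin d s) in Hz.
    rewrite (Hr z) by lra. simpl.
    assert (Hzn : (z - a)%C <> 0) by now apply Cminus_eq_contra.
    assert (Hpn : Complex.Cpow (z - a) m <> 0) by now apply Cpow_nz.
    assert (Hgn : g z <> 0) by (apply Hnz; lra).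
    rewrite E by lra. rewrite recip_neq by now apply Cmult_neq_0.
    assert (E2 : (/ (Complex.Cpow (z - a) m * g z))%C = (RtoC 1 / g z * / Complex.Cpow (z - a) m)%C)
      by (field; auto).
    exact (f_equal Some E2).
Qed.

Lemma list_separation (S : list C) p : exists d, 0 < d /\
  forall q, In q S -> q <> p -> d <= Cmod (q - p).
Proof.
  induction S as [|a S [d [Hd K]]].
  - exists 1. split; [lra|]. intros q [].
  - destruct (Ceq_dec a p) as [->|Ha].
    + exists d. split; auto. intros q [<-|Hq] Hn; [congruence|auto].
    + assert (0 < Cmod (a - p)) by now apply Cmod_pos, Cminus_eq_contra.
      exists (Rmin d (Cmod (a - p))). split; [now apply Rmin_pos|].
      rmin d (Cmod (a - p)).
      intros q [<-|Hq] Hn; [lra|]. specialize (K q Hq Hn). lra.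
Qed.

(** Filling in removable singularities at finitely many points. The points are isolated, so near
    each of them the patched function coincides with the local extension [Gp], and near any other
    point with G. *)
Lemma hol_patch (G : C -> C) z0 Q (S : list C) :
  (forall z, Cmod (z - z0) < Q -> ~ In z S -> G z <> 0 /\ exists L, cdiff G z L) ->
  (forall p, Cmod (p - z0) < Q -> In p S -> exists r Gp L, 0 < r /\ cdiff Gp p L /\
     Gp p <> 0 /\ forall z, Cmod (z - p) < r -> z <> p -> G z = Gp z) ->
  exists g, hol z0 Q g /\ (forall z, Cmod (z - z0) < Q -> g z <> 0) /\
    forall z, Cmod (z - z0) < Q -> ~ In z S -> g z = G z.
Proof.
  intros H1 H2.
  (* The hypotheses are moved under the existential so that choice yields a total function v;
     outside the relevant points the value is arbitrary. *)
  assert (H3 : forall p, exists v, Cmod (p - z0) < Q -> In p S -> exists r Gp L, 0 < r /\ cdiff Gp p L /\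
     Gp p <> 0 /\ Gp p = v /\ forall z, Cmod (z - p) < r -> z <> p -> G z = Gp z).
  { intros p. destruct (classic (Cmod (p - z0) < Q /\ In p S)) as [[Hp Hin]|Hn].
    - destruct (H2 p Hp Hin) as [r [Gp [L [A [B [D E]]]]]].
      exists (Gp p). intros _ _. exists r, Gp, L. auto.
    - exists (RtoC 0). intros A B. exfalso. now apply Hn. }
  set (v := fun p => proj1_sig (constructive_indefinite_description _ (H3 p))).
  assert (Hv : forall p, Cmod (p - z0) < Q -> In p S -> exists r Gp L, 0 < r /\ cdiff Gp p L /\
     Gp p <> 0 /\ Gp p = v p /\ forall z, Cmod (z - p) < r -> z <> p -> G z = Gp z).
  { intros p. unfold v. apply (proj2_sig (constructive_indefinite_description _ (H3 p))). }
  exists (fun z => if in_dec Ceq_dec z S then v z else G z). split; [|split].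
  - intros z Hz. destruct (list_separation S z) as [d [Hd K]].
    destruct (in_dec Ceq_dec z S) as [Hin|Hin].
    + destruct (Hv z Hz Hin) as [r [Gp [L [Hr [HL [_ [Ev E]]]]]]].
      exists L. apply (cdiff_ext_near Gp _ z L (Rmin d r)); auto; [now apply Rmin_pos|].
      rmin d r.
      intros w Hw. destruct (in_dec Ceq_dec w S) as [Hw2|Hw2].
      * destruct (Ceq_dec w z) as [->|Hwz]; auto.
        specialize (K w Hw2 Hwz). lra.
      * symmetry. apply E; [lra|]. intros ->. contradiction.
    + destruct (H1 z Hz Hin) as [_ [L HL]]. exists L.
      apply (cdiff_ext_near G _ z L d); auto.
      intros w Hw. destruct (in_dec Ceq_dec w S) as [Hw2|Hw2]; auto.
      assert (w <> z) by (intros ->; contradiction). specialize (K w Hw2 H). lra.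
  - intros z Hz. destruct (in_dec Ceq_dec z S) as [Hin|Hin]; [|now apply H1].
    destruct (Hv z Hz Hin) as [r [Gp [L [_ [_ [Hn [Ev _]]]]]]]. now rewrite <- Ev.
  - intros z Hz Hin. destruct (in_dec Ceq_dec z S); [contradiction|auto].
Qed.

Definition prodw (m : C -> nat) (l : list C) (z : C) : C :=
  fold_right (fun a p => Complex.Cpow (z - a) (m a) * p)%C (RtoC 1) l.

Lemma prodw_cdiff m l z : exists L, cdiff (prodw m l) z L.
Proof.
  induction l as [|a l [L HL]]; [eexists; apply (cdiff_const 1)|].
  destruct (hol_pow z 1 (fun w => w - a)%C (m a) (hol_shift z 1 a) z) as [L1 HL1];
    [rewrite Cmod_minus_self; lra|].
  eexists. apply (cdiff_mult (fun w => Complex.Cpow (w - a) (m a)) (prodw m l) z _ _ HL1 HL).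
Qed.

Lemma prodw_neq_0 m l z : ~ In z l -> prodw m l z <> 0.
Proof.
  induction l as [|a l IH]; intros H; simpl; [apply C1_nz|].
  apply Cmult_neq_0; [|apply IH; intros Hi; apply H; now right].
  apply Cpow_nz, Cminus_eq_contra. intros ->. apply H. now left.
Qed.

Lemma prodw_extract m l p : NoDup l -> In p l -> exists l', ~ In p l' /\
  forall z, prodw m l z = (Complex.Cpow (z - p) (m p) * prodw m l' z)%C.
Proof.
  intros Hl Hin. destruct (in_split p l Hin) as [l1 [l2 ->]].
  exists (l1 ++ l2). split; [now apply NoDup_remove_2|].
  intros z. clear Hl Hin. induction l1 as [|a l1 IH]; simpl; [reflexivity|].
  unfold prodw in *. simpl in *. rewrite IH. ring.
Qed.

Lemma ln_Cmod_Cpow (z : C) n : z <> 0 -> ln (Cmod (Complex.Cpow z n)) = INR n * ln (Cmod z).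
Proof.
  intros Hz. rewrite Cmod_pow, ln_pow; auto. now apply Cmod_pos.
Qed.

Lemma ln_prodw m l z : ~ In z l ->
  ln (Cmod (prodw m l z)) = sumR (fun p => INR (m p) * ln (Cmod (z - p))) l.
Proof.
  unfold sumR. induction l as [|a l IH]; intros H; simpl.
  - rewrite Cmod_1. apply ln_1.
  - assert (Hz : (z - a)%C <> 0) by (apply Cminus_eq_contra; intros ->; apply H; now left).
    assert (Hp : prodw m l z <> 0) by (apply prodw_neq_0; intros Hi; apply H; now right).
    fold (prodw m l z). rewrite Cmod_mult, ln_mult.
    + rewrite ln_Cmod_Cpow, IH; auto. intros Hi; apply H; now right.
    + apply Cmod_pos. now apply Cpow_nz.
    + now apply Cmod_pos.
Qed.

Definition signed_divisor (f : Cx -> Sphere) (c : C) (Q : R) : list (C * R) :=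
  map (fun z => (z, INR (zord f z))) (zlist f c Q) ++
  map (fun z => (z, - INR (pord f z))) (plist f c Q).

Lemma sumR_app {T} (F : T -> R) l1 l2 : sumR F (l1 ++ l2) = sumR F l1 + sumR F l2.
Proof.
  unfold sumR. induction l1 as [|a l IH]; simpl; [ring|]. rewrite IH. ring.
Qed.

Lemma sumR_map {T U} (F : U -> R) (G : T -> U) l : sumR F (map G l) = sumR (fun x => F (G x)) l.
Proof. unfold sumR. now rewrite map_map. Qed.

Lemma sumR_ext {T} (F G : T -> R) l : (forall x, In x l -> F x = G x) -> sumR F l = sumR G l.
Proof. intros H. unfold sumR. f_equal. apply map_ext_in. exact H. Qed.

Lemma sumR_scal {T} k (F : T -> R) l : sumR (fun x => k * F x) l = k * sumR F l.
Proof. unfold sumR. induction l as [|a l IH]; simpl; [ring|]. rewrite IH. ring. Qed.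

Lemma sumR_plus {T} (F G : T -> R) l : sumR (fun x => F x + G x) l = sumR F l + sumR G l.
Proof. unfold sumR. induction l as [|a l IH]; simpl; [ring|]. rewrite IH. ring. Qed.

(** With A and B the monic polynomials of the zeros and of the poles in the disc, f B / A has only
    removable singularities and no zeros. At each point of the divisor the power of z - p in A or B
    cancels against the local order. *)
Lemma N1_factorization f c Q : N1 f -> exists g, hol c Q g /\
  (forall z, Cmod (z - c) < Q -> g z <> 0) /\
  forall z, Cmod (z - c) < Q -> ~ singular f z ->
    logabs f z = sumR (fun q => snd q * ln (Cmod (z - fst q))) (signed_divisor f c Q)
                 + ln (Cmod (g z)).
Proof.
  intros Hf. destruct (zlist_spec f c Q Hf) as [Nz Hz]. destruct (plist_spec f c Q Hf) as [Np Hp].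
  set (zl := zlist f c Q) in *. set (pl := plist f c Q) in *.
  set (A := prodw (zord f) zl). set (B := prodw (pord f) pl).
  assert (Disj : forall z, In z zl -> In z pl -> False).
  { intros z H1 H2. apply Hz in H1. apply Hp in H2. destruct H1, H2. congruence. }
  assert (HS : forall z, Cmod (z - c) < Q -> singular f z -> In z (zl ++ pl)).
  { intros z Hzc [E|E]; apply in_or_app; [left; apply Hz|right; apply Hp]; auto. }
  assert (HS2 : forall z, In z (zl ++ pl) -> singular f z).
  { intros z Hin. apply in_app_or in Hin. destruct Hin as [Hin|Hin].
    - left. now apply Hz.
    - right. now apply Hp. }
  set (G := fun z => (val (f z) * B z / A z)%C).
  assert (Nonz : forall z, ~ singular f z -> f z <> None /\ val (f z) <> 0).
  { intros z Hs. split; [intros E; apply Hs; now right|]. intros E. apply Hs.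
    unfold singular. destruct (f z) as [v|]; [left; simpl in E; now rewrite E|now right]. }
  destruct (hol_patch G c Q (zl ++ pl)) as [g [Hg [Hgn Eg]]].
  - intros z Hzc Hin.
    assert (Hs : ~ singular f z) by (intros Hs; apply Hin, HS; auto).
    destruct (Nonz z Hs) as [N1' N2'].
    assert (HA : A z <> 0) by (apply prodw_neq_0; intros Hi; apply Hin, in_or_app; now left).
    assert (HB : B z <> 0) by (apply prodw_neq_0; intros Hi; apply Hin, in_or_app; now right).
    split.
    + unfold G, Cdiv. repeat apply Cmult_neq_0; auto. now apply Cinv_neq_0.
    + destruct (meromorphic_val_cdiff f z) as [L1 HL1]; auto; [apply Hf|].
      destruct (prodw_cdiff (zord f) zl z) as [L2 HL2].
      destruct (prodw_cdiff (pord f) pl z) as [L3 HL3].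
      eexists. apply (cdiff_div (fun z => val (f z) * B z)%C A); auto; [|exact HL2].
      apply (cdiff_mult (fun z => val (f z)) B); [exact HL1|exact HL3].
  - intros p Hpc Hin. destruct (in_dec Ceq_dec p zl) as [Hpz|Hpz].
    + assert (Hpp : ~ In p pl) by (intros Hi; now apply (Disj p)).
      destruct (zord_spec f p Hf) as [r [Hr [gp [Hgp [Hgpn E]]]]]; [now apply Hz|].
      destruct (prodw_extract (zord f) zl p Nz Hpz) as [l' [Hl' El']].
      destruct (Hgp p) as [L1 HL1]; [change (Cmod (p - p) < r); rewrite Cmod_minus_self; lra|].
      destruct (prodw_cdiff (zord f) l' p) as [L2 HL2].
      destruct (prodw_cdiff (pord f) pl p) as [L3 HL3].
      assert (HA : prodw (zord f) l' p <> 0) by now apply prodw_neq_0.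
      destruct (cdiff_neq_near _ p L2 HL2 HA) as [d [Hd Hnz]].
      rmin d r.
      exists (Rmin d r), (fun z => gp z * B z / prodw (zord f) l' z)%C. eexists. split; [|split; [|split]].
      * apply Rmin_pos; lra.
      * apply (cdiff_div (fun z => gp z * B z)%C (prodw (zord f) l')); auto; [|exact HL2].
        apply (cdiff_mult gp B); [exact HL1|exact HL3].
      * unfold Cdiv. repeat apply Cmult_neq_0; auto; [|now apply Cinv_neq_0].
        now apply prodw_neq_0.
      * intros z Hzp Hne. unfold G, A. rewrite El'.
        rewrite (E z) by (change (Cmod (z - p) < r); lra).
        change (val (Some ?x)) with x.
        change (Cmul ?x ?y) with (Cmult x y).
        change (Cpow (Csub z p) (zord f p)) with (Complex.Cpow (z - p)%C (zord f p)).
        assert (Complex.Cpow (z - p)%C (zord f p) <> 0) by now apply Cpow_nz, Cminus_eq_contra.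
        assert (prodw (zord f) l' z <> 0) by (apply Hnz; lra).
        field. auto.
    + assert (Hpp : In p pl) by (apply in_app_or in Hin; destruct Hin; [contradiction|auto]).
      destruct (pord_spec f p Hf) as [_ [r [Hr [gp [Hgp [Hgpn E]]]]]]; [now apply Hp|].
      destruct (prodw_extract (pord f) pl p Np Hpp) as [l' [Hl' El']].
      destruct (Hgp p) as [L1 HL1]; [change (Cmod (p - p) < r); rewrite Cmod_minus_self; lra|].
      destruct (prodw_cdiff (pord f) l' p) as [L2 HL2].
      destruct (prodw_cdiff (zord f) zl p) as [L3 HL3].
      assert (HA : A p <> 0) by now apply prodw_neq_0.
      destruct (cdiff_neq_near _ p L3 HL3 HA) as [d [Hd Hnz]].
      rmin d r.
      exists (Rmin d r), (fun z => gp z * prodw (pord f) l' z / A z)%C. eexists. split; [|split; [|split]].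
      * apply Rmin_pos; lra.
      * apply (cdiff_div (fun z => gp z * prodw (pord f) l' z)%C A); auto; [|exact HL3].
        apply (cdiff_mult gp (prodw (pord f) l')); [exact HL1|exact HL2].
      * unfold Cdiv. repeat apply Cmult_neq_0; auto; [|now apply Cinv_neq_0].
        now apply prodw_neq_0.
      * intros z Hzp Hne. unfold G, B. rewrite El'.
        rewrite (E z) by (auto; change (Cmod (z - p) < r); lra).
        change (val (Some ?x)) with x.
        change (Cmul ?x ?y) with (Cmult x y).
        change (Cinv (Cpow (Csub z p) (pord f p))) with (Complex.Cinv (Complex.Cpow (z - p)%C (pord f p))).
        assert (Complex.Cpow (z - p)%C (pord f p) <> 0) by now apply Cpow_nz, Cminus_eq_contra.
        assert (A z <> 0) by (apply Hnz; lra).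
        field. auto.
  - exists g. split; auto. split; auto. intros z Hzc Hs.
    destruct (Nonz z Hs) as [N1' N2'].
    assert (Hin : ~ In z (zl ++ pl)) by (intros Hi; now apply Hs, HS2).
    assert (HinA : ~ In z zl) by (intros Hi; apply Hin, in_or_app; now left).
    assert (HinB : ~ In z pl) by (intros Hi; apply Hin, in_or_app; now right).
    assert (HA : A z <> 0) by now apply prodw_neq_0.
    assert (HB : B z <> 0) by now apply prodw_neq_0.
    rewrite Eg by auto. unfold G, logabs.
    rewrite Cmod_div, Cmod_mult by auto.
    assert (P1 : 0 < Cmod (val (f z))) by now apply Cmod_pos.
    assert (P2 : 0 < Cmod (A z)) by now apply Cmod_pos.
    assert (P3 : 0 < Cmod (B z)) by now apply Cmod_pos.
    rewrite ln_div, ln_mult by (auto; now apply Rmult_lt_0_compat).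
    unfold A, B. rewrite !ln_prodw by auto.
    unfold signed_divisor. fold zl pl. rewrite sumR_app, !sumR_map. cbn [fst snd].
    rewrite (sumR_ext (fun x => - INR (pord f x) * ln (Cmod (z - x)))
      (fun x => (-1) * (INR (pord f x) * ln (Cmod (z - x))))) by (intros; ring).
    rewrite sumR_scal. change Cx with C. ring.
Qed.

(** * Integrals over the divisor *)

Lemma is_RInt_sumR {T} (F : T -> R -> R) (v : T -> R) (l : list T) a b :
  (forall q, In q l -> is_RInt (F q) a b (v q)) ->
  is_RInt (fun t => sumR (fun q => F q t) l) a b (sumR v l).
Proof.
  unfold sumR. induction l as [|q l IH]; intros H; simpl.
  - pose proof (is_RInt_const (V := R_NormedModule) a b 0) as K.
    assert (E : scal (b - a) (0 : R_NormedModule) = 0) by apply Rmult_0_r.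
    rewrite E in K. exact K.
  - apply (is_RInt_plus (V := R_NormedModule) (F q)).
    + apply H. now left.
    + apply IH. intros; apply H. now right.
Qed.

Lemma continuous_sumR {T} (F : T -> R -> R) (l : list T) t :
  (forall q, In q l -> continuous (F q) t) -> continuous (fun t => sumR (fun q => F q t) l) t.
Proof.
  unfold sumR. induction l as [|q l IH]; intros H; simpl.
  - apply continuous_const.
  - apply (continuous_Rplus (F q)).
    + apply H. now left.
    + apply IH. intros; apply H. now right.
Qed.

Lemma is_RInt_of_derive (Phi phi : R -> R) a b : a <= b ->
  (forall t, a <= t <= b -> is_derive Phi t (phi t)) ->
  (forall t, a <= t <= b -> continuous phi t) -> is_RInt phi a b (Phi b - Phi a).
Proof.
  intros Hab HP Hc. apply (is_RInt_derive (V := R_CompleteNormedModule));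
    rewrite Rmin_left, Rmax_right by lra; auto.
Qed.

Lemma is_RInt_ext_open (f g : R -> R) a b l : a <= b -> (forall t, a < t < b -> f t = g t) ->
  is_RInt f a b l -> is_RInt g a b l.
Proof.
  intros Hab E. apply is_RInt_ext. rewrite Rmin_left, Rmax_right by lra. exact E.
Qed.

(** For integrands with one breakpoint A: a single function Theta is a primitive on both sides and
    is continuous across A. The value of f at A itself does not affect the integral. *)
Lemma is_RInt_Rmax_split (f Theta th1 th2 : R -> R) A r : 1 < r ->
  (forall t, A < t -> f t = th1 t) -> (forall t, t < A -> f t = th2 t) ->
  (forall a b, 1 <= a <= b -> A <= a -> is_RInt th1 a b (Theta b - Theta a)) ->
  (forall a b, 1 <= a <= b -> b <= A -> is_RInt th2 a b (Theta b - Theta a)) ->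
  is_RInt f 1 r (Theta r - Theta 1).
Proof.
  intros Hr E1 E2 I1 I2.
  destruct (Rle_lt_dec A 1) as [H1|H1].
  - apply (is_RInt_ext_open th1); [lra| |apply I1; lra]. intros t Ht. symmetry. apply E1. lra.
  - destruct (Rle_lt_dec r A) as [H2|H2].
    + apply (is_RInt_ext_open th2); [lra| |apply I2; lra]. intros t Ht. symmetry. apply E2. lra.
    + replace (Theta r - Theta 1) with (plus (Theta A - Theta 1 : R_NormedModule) (Theta r - Theta A))
        by (unfold plus; simpl; ring).
      apply (is_RInt_Chasles (V := R_NormedModule) f 1 A r).
      * apply (is_RInt_ext_open th2); [lra| |apply I2; lra]. intros t Ht. symmetry. apply E2. lra.
      * apply (is_RInt_ext_open th1); [lra| |apply I1; lra]. intros t Ht. symmetry. apply E1. lra.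
Qed.

(** The contribution to card/t of one point at distance A from the centre, which is counted as soon
    as A < t. *)
Definition step (A t : R) : R := if Rlt_dec A t then / t else 0.

(** The primitive ln(max(t, A)) is also the circle mean of ln |z - a|: this is Jensen's formula for
    one factor. *)
Lemma is_RInt_step A r : 1 < r -> is_RInt (step A) 1 r (ln (Rmax r A) - ln (Rmax 1 A)).
Proof.
  intros Hr. apply (is_RInt_Rmax_split (step A) (fun t => ln (Rmax t A)) Rinv (fun _ => 0) A r); auto.
  - intros t Ht. unfold step. destruct (Rlt_dec A t); [auto|lra].
  - intros t Ht. unfold step. destruct (Rlt_dec A t); [lra|auto].
  - intros a b Hab HA. rewrite !Rmax_left by lra. apply is_RInt_of_derive; [lra| |].
    + intros t Ht. auto_derive; [lra|]. field. lra.
    + intros t Ht. apply ex_derive_cont.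
      auto_derive. lra.
  - intros a b Hab HA. rewrite !Rmax_right by lra.
    apply (is_RInt_of_derive (fun _ => ln A) (fun _ => 0) a b); [lra| |].
    + intros t Ht. auto_derive; auto.
    + intros t Ht. apply continuous_const.
Qed.

(* First Fourier coefficient of [ln |. - a|] on the circle of radius [t] about [c], divided by
   [a - c], when [A = |a - c|]. *)
Definition coef (A t : R) : R := - (t / (2 * Rmax t A ^ 2)).

(** Solved for the logarithms, this is the formula r U(r) - U(1) - 2 ∫_1^r U for one factor of the
    divisor, up to the weight a - c. *)
Lemma is_RInt_coef A r : 1 < r -> is_RInt (coef A) 1 r
  ((r * coef A r - coef A 1 - (ln (Rmax r A) - ln (Rmax 1 A))) / 2).
Proof.
  intros Hr.
  set (Theta := fun t => (t * coef A t - ln (Rmax t A)) / 2).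
  replace ((r * coef A r - coef A 1 - (ln (Rmax r A) - ln (Rmax 1 A))) / 2)
    with (Theta r - Theta 1) by (unfold Theta; field).
  apply (is_RInt_Rmax_split (coef A) Theta (fun t => - (/ (2 * t))) (fun t => - (t / (2 * A ^ 2))) A r); auto.
  - intros t Ht. unfold coef. rewrite Rmax_left by lra.
    (* A is a bare real here and may be negative, so t = 0 can occur; both sides are then 0 because
       [/ 0] is 0. *)
    destruct (Req_dec t 0) as [->|H]; [|field; auto].
    unfold Rdiv. rewrite !Rmult_0_r, !Rmult_0_l, Rinv_0. ring.
  - intros t Ht. unfold coef. now rewrite Rmax_right by lra.
  - intros a b Hab HA. unfold Theta, coef. rewrite !Rmax_left by lra.
    replace ((b * - (b / (2 * b ^ 2)) - ln b) / 2 - (a * - (a / (2 * a ^ 2)) - ln a) / 2)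
      with ((- ln b / 2) - (- ln a / 2)) by (field; lra).
    apply (is_RInt_of_derive (fun t => - ln t / 2) (fun t => - (/ (2 * t))) a b); [lra| |].
    + intros t Ht. auto_derive; [lra|]. field. lra.
    + intros t Ht. apply ex_derive_cont.
      auto_derive. lra.
  - intros a b Hab HA. unfold Theta, coef. rewrite !Rmax_right by lra.
    replace ((b * - (b / (2 * A ^ 2)) - ln A) / 2 - (a * - (a / (2 * A ^ 2)) - ln A) / 2)
      with (- (b ^ 2 / (4 * A ^ 2)) - - (a ^ 2 / (4 * A ^ 2))) by (field; lra).
    apply (is_RInt_of_derive (fun t => - (t ^ 2 / (4 * A ^ 2))) (fun t => - (t / (2 * A ^ 2))) a b); [lra| |].
    + intros t Ht. auto_derive; [auto|]. field. lra.
    + intros t Ht. apply ex_derive_cont.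
      auto_derive. auto.
Qed.

Lemma continuous_Rmax A t : continuous (fun t => Rmax t A) t.
Proof.
  apply continuous_R_eps. intros eps He. exists eps. split; auto. intros s Hs.
  eapply Rle_lt_trans; [|exact Hs]. apply Rabs_le_between.
  pose proof (Rabs_le_between (s - t) (Rabs (s - t))) as [K _]. specialize (K (Rle_refl _)).
  unfold Rmax. destruct (Rle_dec s A), (Rle_dec t A); lra.
Qed.

Lemma continuous_ln_Rmax A t : 0 < t -> continuous (fun t => ln (Rmax t A)) t.
Proof.
  intros Ht. apply (continuous_comp (fun t => Rmax t A) ln); [apply continuous_Rmax|].
  apply continuous_ln. pose proof (Rmax_l t A). lra.
Qed.

Lemma continuous_coef A t : 0 < t -> continuous (coef A) t.
Proof.
  intros Ht. unfold coef, Rdiv. apply (continuous_opp (V := R_NormedModule)).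
  apply continuous_Rmult; [apply continuous_id|].
  apply (continuous_comp (fun t => Rmax t A) (fun m => / (2 * m ^ 2))); [apply continuous_Rmax|].
  apply ex_derive_cont.
  pose proof (Rmax_l t A). auto_derive. apply Rgt_not_eq.
  assert (0 < Rmax t A) by lra.
  apply Rmult_lt_0_compat; [lra|]. simpl. nra.
Qed.

(** The circle means are bounded only for circles that avoid the divisor. Every radius in the
    half-open range is a limit from the right of such radii, and the explicit sums are continuous in
    the radius. *)
Lemma bound_off_finite_set (F : R -> R) (bad : list R) B Q t : 1 <= t < Q -> continuous F t ->
  (forall s, 1 <= s < Q -> ~ In s bad -> Rabs (F s) <= B) -> Rabs (F t) <= B.
Proof.
  intros Ht HF H. apply Rnot_lt_le. intros Hlt.
  destruct (proj1 (continuous_R_eps F t) HF (Rabs (F t) - B)) as [d [Hd K]]; [lra|].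
  assert (Sep : exists e, 0 < e /\ forall s, t < s < t + e -> ~ In s bad).
  { clear - bad. induction bad as [|b l [e [He IH]]].
    - exists 1. split; [lra|]. intros s _ [].
    - destruct (Rlt_dec t b) as [Hb|Hb].
      + exists (Rmin e (b - t)). split; [apply Rmin_pos; lra|].
        rmin e (b - t).
        intros s Hs [E|Hin]; [lra|]. apply (IH s); auto. lra.
      + exists e. split; auto. intros s Hs [E|Hin]; [lra|]. now apply (IH s). }
  destruct Sep as [e [He Sep]].
  set (x := Rmin (Rmin d e) (Q - t)).
  assert (Hx : 0 < x) by (unfold x; repeat apply Rmin_pos; lra).
  assert (x <= Q - t) by apply Rmin_r.
  assert (x <= Rmin d e) by apply Rmin_l.
  rmin d e.
  specialize (H (t + x / 2) ltac:(lra) ltac:(apply Sep; lra)).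
  specialize (K (t + x / 2)). replace (t + x / 2 - t) with (x / 2) in K by ring.
  rewrite (Rabs_pos_eq (x / 2)) in K by lra. specialize (K ltac:(lra)).
  pose proof (Rabs_triang_inv (F t) (F (t + x / 2))) as T. rewrite Rabs_minus_sym in T. lra.
Qed.

(** Treats the real and imaginary parts of the first moment in one argument. *)
Definition proj (b : bool) (z : C) : R := if b then fst z else snd z.

Lemma proj_scal b x z : proj b (RtoC x * z)%C = x * proj b z.
Proof. destruct b; simpl; ring. Qed.

Lemma proj_CInt b F x y : proj b (CInt F x y) = RInt (fun t => proj b (F t)) x y.
Proof. destruct b; reflexivity. Qed.

Lemma Rabs_proj_le b z : Rabs (proj b z) <= Cmod z.
Proof. destruct b; [apply Rabs_fst_le_Cmod|apply Rabs_snd_le_Cmod]. Qed.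

Lemma ccont_proj b f t : ccont f t -> continuous (fun s => proj b (f s)) t.
Proof. intros [H1 H2]. destruct b; auto. Qed.

Lemma continuous_is_RInt (f : R -> R) l : (forall t, continuous f t) -> RInt f 0 1 = l -> is_RInt f 0 1 l.
Proof.
  intros Hc <-. apply (RInt_correct (V := R_CompleteNormedModule)).
  apply ex_RInt_cont; auto; lra.
Qed.

Lemma log_means_is_RInt (g : C -> C) (z0 : C) r v (w : C) : 0 < r ->
  (forall t, ccont (fun t => g (circ z0 r t)) t /\ g (circ z0 r t) <> 0) ->
  RInt (fun t => ln (Cmod (g (circ z0 r t)))) 0 1 = v ->
  CInt (fun t => RtoC (ln (Cmod (g (circ z0 r t)))) * cis t)%C 0 1 = w ->
  is_RInt (fun t => ln (Cmod (g (circ z0 r t)))) 0 1 v /\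
  forall b, is_RInt (fun t => ln (Cmod (g (circ z0 r t))) * proj b (cis t)) 0 1 (proj b w).
Proof.
  intros Hr Hg E1 E2.
  assert (Cl : forall t, continuous (fun t => ln (Cmod (g (circ z0 r t)))) t).
  { intros t. destruct (Hg t). now apply (ln_Cmod_continuous (fun t => g (circ z0 r t))). }
  split; [now apply continuous_is_RInt|]. intros b. apply continuous_is_RInt.
  - intros t. apply continuous_Rmult; auto. apply ccont_proj, ccont_cis.
  - rewrite <- E2, proj_CInt. apply RInt_ext. intros t _. now rewrite proj_scal.
Qed.

(** Both sums are means of ln |f|, plain or weighted by a coordinate of [cis], computed factor by
    factor. The terms e0 and t/2 · k0 come from the zero-free factor; they depend on c and Q without
    control, but not on t, so they can be eliminated between radii. Only B is uniform. *)
Lemma N1_moment_bounds f : N1 f -> exists B, 0 <= B /\ forall c Q, exists e0 (k0 : C),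
  forall t, 1 <= t < Q ->
    Rabs (sumR (fun q => snd q * ln (Rmax t (Cmod (fst q - c)))) (signed_divisor f c Q) + e0) <= B /\
    forall b, Rabs (sumR (fun q => snd q * proj b (fst q - c)%C * coef (Cmod (fst q - c)) t)
      (signed_divisor f c Q) + t / 2 * proj b k0) <= B.
Proof.
  intros Hf. destruct (N1_circle_bound f Hf) as [B HB].
  exists (Rabs B). split; [apply Rabs_pos|]. intros c Q.
  destruct (Rle_lt_dec Q 1) as [HQ|HQ].
  { exists 0, (RtoC 0). intros t Ht. lra. }
  destruct (N1_factorization f c Q Hf) as [g [Hg [Hgn El]]].
  set (SL := signed_divisor f c Q) in *.
  assert (Cc : Cmod (c - c) < Q) by (rewrite Cmod_minus_self; lra).
  destruct (Hg c Cc) as [M HM].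
  assert (Hgc : g c <> 0) by auto.
  set (L := (M / g c)%C).
  assert (HL : cdiff g c (L * g c)%C).
  { apply (cdiff_eq _ _ _ _ HM). unfold L. field. auto. }
  exists (ln (Cmod (g c))), (Cconj L).
  (* The radii of the circles about c that pass through a zero or a pole. *)
  set (bad := map (fun q => Cmod (fst q - c)) SL).
  set (E := fun t => sumR (fun q => snd q * ln (Rmax t (Cmod (fst q - c)))) SL + ln (Cmod (g c))).
  set (Y := fun b t => sumR (fun q => snd q * proj b (fst q - c)%C * coef (Cmod (fst q - c)) t) SL
                       + t / 2 * proj b (Cconj L)).
  assert (Gen : forall t, 1 <= t < Q -> ~ In t bad -> Rabs (E t) <= Rabs B /\ forall b, Rabs (Y b t) <= Rabs B).
  { intros t Ht Hbad.
    assert (Hin : forall x, Cmod (circ c t x - c) < Q) by (intros x; rewrite circ_dist; lra).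
    assert (Hne : forall q, In q SL -> t <> Cmod (fst q - c)).
    { intros q Hq Et. apply Hbad. unfold bad. rewrite Et. now apply (in_map (fun q => Cmod (fst q - c))). }
    assert (Hns : forall x, ~ singular f (circ c t x)).
    { intros x Hs. assert (exists k, In (circ c t x, k) SL) as [k Hk].
      { unfold SL, signed_divisor. destruct Hs as [Hs|Hs].
        - eexists. apply in_or_app. left. apply in_map_iff. eexists. split; [reflexivity|].
          apply zlist_spec; auto.
        - eexists. apply in_or_app. right. apply in_map_iff. eexists. split; [reflexivity|].
          apply plist_spec; auto. }
      apply (Hne _ Hk). simpl. rewrite circ_dist; lra. }
    specialize (HB c t ltac:(lra) Hns).
    assert (Cl : forall x, continuous (fun x => logabs f (circ c t x)) x).
    { intros x. apply logabs_continuous; auto. apply Hf. }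
    assert (Hq : forall q, In q SL ->
      is_RInt (fun x => ln (Cmod (circ c t x - fst q))) 0 1 (ln (Rmax t (Cmod (fst q - c)))) /\
      forall b, is_RInt (fun x => ln (Cmod (circ c t x - fst q)) * proj b (cis x)) 0 1
        (proj b (RtoC (coef (Cmod (fst q - c)) t) * (fst q - c))%C)).
    { intros q Hq. destruct (factor_log_means (fst q) c t ltac:(lra) (Hne q Hq)) as [F1 F2].
      apply (log_means_is_RInt (fun z => z - fst q)%C c t); auto; [lra|].
      intros x. split; [apply ccont_minus; [apply circ_ccont|apply ccont_const]|].
      apply Cminus_eq_contra. intros Ex. apply (Hne q Hq). rewrite <- Ex, circ_dist; lra. }
    destruct (log_circle_means g c Q t L) as [G1 G2]; auto; [lra|].
    assert (Gc : forall x, ccont (fun x => g (circ c t x)) x /\ g (circ c t x) <> 0).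
    { intros x. split; [apply hol_circ_ccont with Q; auto; lra|auto]. }
    destruct (log_means_is_RInt g c t (ln (Cmod (g c))) (RtoC (t / 2) * Cconj L)%C ltac:(lra) Gc G1 G2)
      as [G3 G4].
    assert (Eint : is_RInt (fun x => logabs f (circ c t x)) 0 1 (E t)).
    { apply (is_RInt_ext_open (fun x => plus (sumR (fun q => snd q * ln (Cmod (circ c t x - fst q))) SL : R_NormedModule)
        (ln (Cmod (g (circ c t x)))))); [lra| |].
      - intros x _. symmetry. apply El; auto.
      - apply (is_RInt_plus (V := R_NormedModule)); auto.
        apply (is_RInt_sumR (fun q x => snd q * ln (Cmod (circ c t x - fst q)))
          (fun q => snd q * ln (Rmax t (Cmod (fst q - c))))).
        intros q Hqi. apply (is_RInt_scal (V := R_NormedModule)). exact (proj1 (Hq q Hqi)). }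
    assert (Yint : forall b, is_RInt (fun x => logabs f (circ c t x) * proj b (cis x)) 0 1 (Y b t)).
    { intros b.
      apply (is_RInt_ext_open (fun x => plus (sumR (fun q => snd q * (ln (Cmod (circ c t x - fst q)) * proj b (cis x))) SL : R_NormedModule)
        (ln (Cmod (g (circ c t x))) * proj b (cis x)))); [lra| |].
      - intros x _. rewrite El; auto. unfold plus; simpl.
        rewrite (sumR_ext _ (fun q => proj b (cis x) * (snd q * ln (Cmod (circ c t x - fst q)))))
          by (intros; ring).
        rewrite sumR_scal. ring.
      - unfold Y. apply (is_RInt_plus (V := R_NormedModule)).
        + apply (is_RInt_sumR (fun q x => snd q * (ln (Cmod (circ c t x - fst q)) * proj b (cis x)))
          (fun q => snd q * proj b (fst q - c)%C * coef (Cmod (fst q - c)) t)).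
          intros q Hqi.
          replace (snd q * proj b (fst q - c)%C * coef (Cmod (fst q - c)) t)
            with (scal (snd q) (proj b (RtoC (coef (Cmod (fst q - c)) t) * (fst q - c))%C : R_NormedModule)).
          * apply (is_RInt_scal (V := R_NormedModule)). exact (proj2 (Hq q Hqi) b).
          * rewrite proj_scal. unfold scal; simpl; unfold mult; simpl. ring.
        + rewrite <- proj_scal. apply G4. }
    assert (Ex : forall u : R -> R, (forall x, continuous u x) -> ex_RInt u 0 1).
    { intros u Hu. apply ex_RInt_cont; auto; lra. }
    assert (Cabs : forall u : R -> R, (forall x, continuous u x) -> forall x, continuous (fun x => Rabs (u x)) x).
    { intros u Hu x. apply (continuous_comp u Rabs); [auto|apply continuous_Rabs]. }
    (* Both integrands are dominated by |ln |f||, the coordinates of [cis] being at most 1 in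
       modulus; so one bound serves for the mean and the first coefficient. *)
    assert (Bnd : forall u v, (forall x, continuous u x) -> (forall x, Rabs (u x) <= Rabs (logabs f (circ c t x))) ->
      is_RInt u 0 1 v -> Rabs v <= Rabs B).
    { intros u v Hu Hle Hv. rewrite <- (is_RInt_unique _ _ _ _ Hv).
      eapply Rle_trans; [apply abs_RInt_le; [lra|now apply Ex]|].
      eapply Rle_trans; [|apply Rle_abs]. eapply Rle_trans; [|exact HB].
      apply RInt_le; [lra|apply Ex; auto|apply Ex; auto|]. intros x _. apply Hle. }
    split.
    - apply (Bnd (fun x => logabs f (circ c t x))); auto. intros x. lra.
    - intros b. apply (Bnd (fun x => logabs f (circ c t x) * proj b (cis x))); auto.
      + intros x. apply continuous_Rmult; auto. apply ccont_proj, ccont_cis.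
      + intros x. rewrite Rabs_mult. pose proof (Rabs_proj_le b (cis x)) as P. rewrite Cmod_cis in P.
        pose proof (Rabs_pos (logabs f (circ c t x))). nra. }
  intros t Ht. split.
  - apply (bound_off_finite_set E bad (Rabs B) Q t); auto.
    + unfold E. apply continuous_Rplus; [|apply continuous_const].
      apply (continuous_sumR (fun q t => snd q * ln (Rmax t (Cmod (fst q - c))))). intros q _.
      apply continuous_Rmult; [apply continuous_const|].
      apply continuous_ln_Rmax. lra.
    + intros s H1 H2. now apply Gen.
  - intros b. apply (bound_off_finite_set (Y b) bad (Rabs B) Q t); auto.
    + unfold Y. apply continuous_Rplus.
      * apply (continuous_sumR (fun q t => snd q * proj b (fst q - c)%C * coef (Cmod (fst q - c)) t)).
        intros q _. apply continuous_Rmult; [apply continuous_const|].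
        apply continuous_coef. lra.
      * apply ex_derive_cont. auto_derive. auto.
    + intros s H1 H2. now apply Gen.
Qed.

Lemma sumR_perm {T} (F : T -> R) l1 l2 : Permutation l1 l2 -> sumR F l1 = sumR F l2.
Proof.
  unfold sumR. induction 1; simpl; try lra.
Qed.

Lemma sumR_filter {T} (F : T -> R) (p : T -> bool) l :
  sumR F (filter p l) = sumR (fun x => if p x then F x else 0) l.
Proof.
  unfold sumR. induction l as [|a l IH]; simpl; [auto|].
  destruct (p a); simpl; rewrite IH; ring.
Qed.

(** The lists for the radii t and Q are independent [epsilon] choices, so they are related only
    through membership: the smaller one is a permutation of a filter of the larger one. *)
Lemma sumR_sublist (F : C -> R) (l l' : list C) c t : NoDup l -> NoDup l' ->
  (forall z, In z l <-> In z l' /\ Cmod (z - c) < t) -> t <> 0 ->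
  sumR F l / t = sumR (fun z => F z * step (Cmod (z - c)) t) l'.
Proof.
  intros H1 H2 H Ht.
  set (p := fun z => if Rlt_dec (Cmod (z - c)) t then true else false).
  rewrite (sumR_perm F l (filter p l')).
  - rewrite sumR_filter. unfold Rdiv. rewrite Rmult_comm, <- sumR_scal.
    apply sumR_ext. intros z _. unfold p, step. destruct (Rlt_dec _ _); ring.
  - apply NoDup_Permutation; auto using NoDup_filter.
    intros z. rewrite H, filter_In. unfold p. destruct (Rlt_dec _ _); intuition; discriminate.
Qed.

(** Expresses the sums at a varying radius t over the fixed divisor at radius Q, so that they can be
    integrated term by term. G = 1 gives the counts, a coordinate of z - c the first moments. *)
Lemma divisor_sum_step f c Q t (G : C -> R) : N1 f -> 0 < t <= Q ->
  (sumR (fun z => INR (zord f z) * G z) (zlist f c t)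
   - sumR (fun z => INR (pord f z) * G z) (plist f c t)) / t
  = sumR (fun q => snd q * G (fst q) * step (Cmod (fst q - c)) t) (signed_divisor f c Q).
Proof.
  intros Hf Ht.
  destruct (zlist_spec f c t Hf) as [Z1 Z2]. destruct (zlist_spec f c Q Hf) as [Z3 Z4].
  destruct (plist_spec f c t Hf) as [P1 P2]. destruct (plist_spec f c Q Hf) as [P3 P4].
  unfold signed_divisor. rewrite sumR_app, !sumR_map. cbn [fst snd].
  unfold Rdiv. rewrite Rmult_minus_distr_r.
  fold (sumR (fun z => INR (zord f z) * G z) (zlist f c t) / t)
    (sumR (fun z => INR (pord f z) * G z) (plist f c t) / t).
  rewrite (sumR_sublist _ _ _ c t Z1 Z3), (sumR_sublist _ _ _ c t P1 P3); try lra.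
  - unfold Rminus. f_equal.
    replace (sumR (fun x => - INR (pord f x) * G x * step (Cmod (x - c)) t) (plist f c Q))
      with (sumR (fun x => -1 * (INR (pord f x) * G x * step (Cmod (x - c)) t)) (plist f c Q)).
    + rewrite sumR_scal. change Cx with C. ring.
    + apply sumR_ext. intros; ring.
  - intros z. rewrite P2, P4. intuition lra.
  - intros z. rewrite Z2, Z4. intuition lra.
Qed.

Lemma proj_csum b (F : C -> C) l : proj b (fold_right Cadd C0 (map F l)) = sumR (fun z => proj b (F z)) l.
Proof.
  unfold sumR. induction l as [|a l IH]; simpl.
  - now destruct b.
  - rewrite <- IH. now destruct b.
Qed.

Lemma proj_zsum b f c t :
  proj b (zsum f c t) = sumR (fun z => INR (zord f z) * proj b (z - c)%C) (zlist f c t).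
Proof.
  unfold zsum. rewrite proj_csum. apply sumR_ext. intros z _. now destruct b.
Qed.

Lemma proj_psum b f c t :
  proj b (psum f c t) = sumR (fun z => INR (pord f z) * proj b (z - c)%C) (plist f c t).
Proof.
  unfold psum. rewrite proj_csum. apply sumR_ext. intros z _. now destruct b.
Qed.

Lemma is_RInt_RiemannInt (f : R -> R) a b v : is_RInt f a b v ->
  exists pr : Riemann_integrable f a b, RiemannInt pr = v.
Proof.
  intros H. assert (ex : ex_RInt f a b) by (now exists v).
  exists (ex_RInt_Reals_0 f a b ex). rewrite <- RInt_Reals. now apply is_RInt_unique.
Qed.

Lemma divisor_sum_integral f c Q r (G : C -> R) (u : R -> R) : N1 f -> 1 < r <= Q ->
  (forall t, 1 < t < r -> u t = (sumR (fun z => INR (zord f z) * G z) (zlist f c t)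
   - sumR (fun z => INR (pord f z) * G z) (plist f c t)) / t) ->
  is_RInt u 1 r (sumR (fun q => snd q * G (fst q)
    * (ln (Rmax r (Cmod (fst q - c))) - ln (Rmax 1 (Cmod (fst q - c))))) (signed_divisor f c Q)).
Proof.
  intros Hf Hr Hu.
  apply (is_RInt_ext_open (fun t => sumR (fun q => snd q * G (fst q) * step (Cmod (fst q - c)) t)
    (signed_divisor f c Q))); [lra| |].
  - intros t Ht. rewrite Hu by auto. symmetry. apply divisor_sum_step; auto. lra.
  - apply (is_RInt_sumR (fun q t => snd q * G (fst q) * step (Cmod (fst q - c)) t)).
    intros q _. apply (is_RInt_scal (V := R_NormedModule)). now apply is_RInt_step.
Qed.

(** The constant k is uncontrolled, so the sum is expressed through the bounded function Y by a
    combination in which k cancels. This leaves rB + B + 2(r-1)B = (3r-1)B, which is below 4Br. *)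
Lemma first_moment_bound B (SL : list (C * R)) c b k r : 0 <= B -> 1 < r ->
  (forall t, 1 <= t <= r -> Rabs (sumR (fun q => snd q * proj b (fst q - c)%C * coef (Cmod (fst q - c)) t) SL
     + t / 2 * k) <= B) ->
  Rabs (sumR (fun q => snd q * proj b (fst q - c)%C
    * (ln (Rmax r (Cmod (fst q - c))) - ln (Rmax 1 (Cmod (fst q - c))))) SL) <= 4 * B * r.
Proof.
  intros HB Hr HY.
  set (be := fun q : C * R => snd q * proj b (fst q - c)%C).
  set (A := fun q : C * R => Cmod (fst q - c)).
  set (Y := fun t => sumR (fun q => be q * coef (A q) t) SL + t / 2 * k).
  set (lg := fun q => ln (Rmax r (A q)) - ln (Rmax 1 (A q))).
  change (Rabs (sumR (fun q => be q * lg q) SL) <= 4 * B * r).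
  change (forall t, 1 <= t <= r -> Rabs (Y t) <= B) in HY.
  set (I := sumR (fun q => be q * ((r * coef (A q) r - coef (A q) 1 - lg q) / 2)) SL + k * ((r ^ 2 - 1) / 4)).
  assert (HI : is_RInt Y 1 r I).
  { unfold Y, I. apply (is_RInt_plus (V := R_NormedModule)).
    - apply (is_RInt_sumR (fun q t => be q * coef (A q) t)
        (fun q => be q * ((r * coef (A q) r - coef (A q) 1 - lg q) / 2))).
      intros q _. apply (is_RInt_scal (V := R_NormedModule)). now apply is_RInt_coef.
    - replace (k * ((r ^ 2 - 1) / 4)) with (r ^ 2 / 4 * k - 1 ^ 2 / 4 * k) by field.
      apply (is_RInt_of_derive (fun t => t ^ 2 / 4 * k) (fun t => t / 2 * k)); [lra| |].
      + intros t _. auto_derive; auto. field.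
      + intros t _. apply ex_derive_cont. auto_derive. auto. }
  (* The terms with k have total coefficient r · r/2 - 1/2 - 2 (r^2 - 1)/4 = 0. *)
  assert (Id : sumR (fun q => be q * lg q) SL = r * Y r - Y 1 - 2 * I).
  { unfold Y, I.
    rewrite (sumR_ext (fun q => be q * ((r * coef (A q) r - coef (A q) 1 - lg q) / 2))
      (fun q => r / 2 * (be q * coef (A q) r) + (- / 2 * (be q * coef (A q) 1) + - / 2 * (be q * lg q))))
      by (intros; field).
    rewrite !sumR_plus, !sumR_scal. field. }
  assert (BI : Rabs I <= (r - 1) * B).
  { rewrite <- (is_RInt_unique _ _ _ _ HI). apply abs_RInt_le_const; auto; [lra|].
    eexists; exact HI. }
  rewrite Id.
  pose proof (HY r ltac:(lra)) as Y1. pose proof (HY 1 ltac:(lra)) as Y2.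
  apply Rabs_le_between in Y1. apply Rabs_le_between in Y2. apply Rabs_le_between in BI.
  assert (r * Y r <= r * B) by (apply Rmult_le_compat_l; lra).
  assert (r * - B <= r * Y r) by (apply Rmult_le_compat_l; lra).
  apply Rabs_le_between. nra.
Qed.

Theorem mainTheorem17 (f : Cx -> Sphere) (Hf : N1 f) :
  exists Cst : R, forall (c : Cx) (r : R), r > 1 ->
    (exists pr : Riemann_integrable (fun t => (zcount f c t - pcount f c t) / t) 1 r,
       Rabs (RiemannInt pr) < Cst) /\
    (exists (pr1 : Riemann_integrable
               (fun t => fst (Csub (zsum f c t) (psum f c t)) / t) 1 r)
            (pr2 : Riemann_integrable
               (fun t => snd (Csub (zsum f c t) (psum f c t)) / t) 1 r),
       Cnorm (/ r * RiemannInt pr1, / r * RiemannInt pr2) < Cst).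
Proof.
  destruct (N1_moment_bounds f Hf) as [B [HB HM]].
  (* Each coordinate of the second quantity is at most 4B and the first quantity is at most 2B; the
     1 makes the inequalities strict. *)
  exists (8 * B + 1). intros c r Hr.
  (* The moment bounds hold for radii strictly below Q; Q = r + 1 includes the radius r itself. *)
  destruct (HM c (r + 1)) as [e0 [k0 Hk]].
  set (SL := signed_divisor f c (r + 1)) in *.
  split.
  - destruct (is_RInt_RiemannInt _ _ _ _
      (divisor_sum_integral f c (r + 1) r (fun _ => 1) (fun t => (zcount f c t - pcount f c t) / t) Hf
        ltac:(lra) ltac:(intros t _; unfold zcount, pcount, sumR;
          do 3 f_equal; apply map_ext; intros; ring))) as [pr Epr].
    exists pr. rewrite Epr. fold SL.
    (* The unknown e0 is the same at the radii r and 1 and disappears in the difference. *)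
    destruct (Hk r ltac:(lra)) as [K1 _]. destruct (Hk 1 ltac:(lra)) as [K2 _].
    rewrite (sumR_ext _ (fun q => snd q * ln (Rmax r (Cmod (fst q - c)))
      + -1 * (snd q * ln (Rmax 1 (Cmod (fst q - c)))))) by (intros; ring).
    rewrite sumR_plus, sumR_scal.
    apply Rabs_le_between in K1. apply Rabs_le_between in K2.
    apply Rle_lt_trans with (2 * B); [|lra]. apply Rabs_le_between. lra.
  - assert (P : forall b, exists pr : Riemann_integrable
        (fun t => proj b (Csub (zsum f c t) (psum f c t)) / t) 1 r, Rabs (/ r * RiemannInt pr) <= 4 * B).
    { intros b.
      destruct (is_RInt_RiemannInt _ _ _ _
        (divisor_sum_integral f c (r + 1) r (fun z => proj b (z - c)%C)
          (fun t => proj b (Csub (zsum f c t) (psum f c t)) / t) Hf ltac:(lra)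
          ltac:(intros t _;
            transitivity ((proj b (zsum f c t) - proj b (psum f c t)) / t);
            [destruct b; reflexivity|rewrite proj_zsum, proj_psum; reflexivity]))) as [pr Epr].
      exists pr. rewrite Epr. fold SL.
      assert (K := first_moment_bound B SL c b (proj b k0) r HB Hr
        (fun t Ht => proj2 (Hk t ltac:(lra)) b)).
      rewrite Rabs_mult, (Rabs_pos_eq (/ r)) by (left; apply Rinv_0_lt_compat; lra).
      apply (Rmult_le_reg_l r); [lra|]. rewrite <- Rmult_assoc, Rinv_r by lra. lra. }
    destruct (P true) as [pr1 H1]. destruct (P false) as [pr2 H2].
    exists pr1, pr2. eapply Rle_lt_trans; [apply (Cmod_le_sum (_, _))|]. simpl fst. simpl snd.
    change (Rabs (/ r * RiemannInt pr1) + Rabs (/ r * RiemannInt pr2) < 8 * B + 1). lra.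
Qed.
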